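(* Suppose $f_0\in A^\gamma[0,1]$ for some $\gamma>1/2$. If the kernel $K_\gamma$ is used in the Gaussian process prior with regularization parameter $\lambda\asymp\log n/n$, then for any $k\in\mathbb N_0$ the posterior distribution $\Pi_{n,k}(\cdot\mid\mathbb D_n)$ contracts at $f_0^{(k)}$ at the rate $\epsilon_n=(\log n)^{k+1}/\sqrt n$ under the $L_2$ norm; that is, for any $M_n\to\infty$, $$\Pi_{n,k}\left(\|f^{(k)}-f_0^{(k)}\|_2>M_n\epsilon_n\,\big|\,\mathbb D_n\right)\to0\quad\text{in }\mathbb P_0^{(n)}\text{-probability}.$$
   Context: Model: $\mathbb D_n=\{(X_i,Y_i)\}_{i=1}^n$ are i.i.d. with $X_i\sim\mathrm{Unif}[0,1]$ and $Y_i=f_0(X_i)+\varepsilon_i$, $\varepsilon_i\sim N(0,\sigma^2)$ independent of $X_i$; $\mathbb P_0^{(n)}$ is the law of $\mathbb D_n$. $X=(X_1,\dots,X_n)^T$, $Y=(Y_1,\dots,Y_n)^T$. $\|\cdot\|_2$ is the $L^2[0,1]$ norm and $\langle f,g\rangle_2=\int_0^1fg$. $a_n\asymp b_n$ means each is bounded by a constant multiple of the other. $\mathbb N_0=\mathbb N\cup\{0\}$. Fourier basis: $\psi_1(x)=1$, $\psi_{2i}(x)=\sqrt2\cos(2\pi ix)$, $\psi_{2i+1}(x)=\sqrt2\sin(2\pi ix)$, $i\in\mathbb N$. Function class: $A^\gamma[0,1]=\{f:\sum_{i\ge1}e^{2\gamma i}f_i^2<\infty,\ f_i=\langle f,\psi_i\rangle_2\}$.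 Kernel: $K_\gamma(x,x')=\sum_{i\ge1}\mu_i\psi_i(x)\psi_i(x')$ with $\mu_1\ge\mu_2\ge\cdots>0$ and $\mu_i\asymp e^{-2\gamma i}$. Posterior: with $K=K_\gamma$ and the prior $f\sim\mathrm{GP}(0,\sigma^2(n\lambda)^{-1}K)$, the posterior $\Pi_{n,k}(\cdot\mid\mathbb D_n)$ of $f^{(k)}$ is $\mathrm{GP}(\hat f_n^{(k)},\tilde V_n^k)$, where $$\hat f_n^{(k)}(x)=K_{k0}(x,X)[K(X,X)+n\lambda I_n]^{-1}Y,$$ $$\tilde V_n^k(x,x')=\sigma^2(n\lambda)^{-1}\{K_{kk}(x,x')-K_{k0}(x,X)[K(X,X)+n\lambda I_n]^{-1}K_{0k}(X,x')\},$$ with $K(X,X)=(K(X_i,X_j))_{i,j}$, $K_{k0}(x,X)=(\partial_x^kK(x,X_i))_{i=1}^n$ (row), $K_{0k}(X,x')=(\partial_{x'}^kK(X_i,x'))_{i=1}^n$ (column), $K_{kk}(x,x')=\partial_x^k\partial_{x'}^kK(x,x')$. *)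

(* Defs.v *)
From mathcomp Require Export all_boot all_order all_algebra.
From mathcomp Require Export all_classical all_reals all_analysis.
Set Implicit Arguments.
Unset Strict Implicit.
Unset Printing Implicit Defensive.
Export Order.TTheory GRing.Theory Num.Theory.
Export numFieldNormedType.Exports.
Global Open Scope classical_set_scope.
Global Open Scope ring_scope.

(* Functions on [0,1] are functions R -> R whose values outside [0,1] are
   ignored. *)

(* Indexed from 1; the value at index 0 is never used. *)
Definition fourier {R : realType} (i : nat) (x : R) : R :=
  if (i <= 1)%N then 1
  else if odd i then Num.sqrt 2 * sin (2 * pi * (i./2)%:R * x)
  else Num.sqrt 2 * cos (2 * pi * (i./2)%:R * x).

Definition L2norm {R : realType} (f : R -> R) : \bar R :=
  'N[lebesgue_measure]_2%:E[(EFin \o f) \_ `[0%R, 1%R]]%E.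

Definition fourier_coef {R : realType} (f : R -> R) (i : nat) : R :=
  (\int[lebesgue_measure]_(x in `[0%R, 1%R]) (f x * fourier i x))%R.

Definition analytic_class {R : realType} (gamma : R) : set (R -> R) :=
  [set f : R -> R | [/\ measurable_fun (`[0, 1] : set R) f, (L2norm f < +oo)%E &
    (\sum_(1 <= i <oo)
       (expR (2 * gamma * i%:R) * fourier_coef f i ^+ 2)%:E < +oo)%E]].

(* An element of [analytic_class] with gamma > 0 is only determined up to a null
   set and has a unique version that is continuous on [0,1]; its derivatives
   are those of that version. *)
Definition continuous_version {R : realType} (f : R -> R) : R -> R :=
  xget f [set g : R -> R | {within `[0%R, 1%R], continuous g} /\
    {ae lebesgue_measure, forall x : R, x \in `[0, 1] -> f x = g x}].

(* [derive1n] is two-sided, so this is meaningful on the open interval ]0,1[,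
   which is all that matters for the L2[0,1] norm. *)
Definition derivative_of {R : realType} (k : nat) (f : R -> R) : R -> R :=
  derive1n k (continuous_version f).

Definition independent_pair d d1 d2 (T : measurableType d)
    (T1 : measurableType d1) (T2 : measurableType d2) (R : realType)
    (P : probability T R) (U : T -> T1) (V : T -> T2) : Prop :=
  forall A B, measurable A -> measurable B ->
    P (U @^-1` A `&` V @^-1` B) = (P (U @^-1` A) * P (V @^-1` B))%E.

Definition independent_family d d' (T : measurableType d)
    (T' : measurableType d') (R : realType) (P : probability T R)
    (I : choiceType) (U : I -> T -> T') : Prop :=
  forall (J : seq I) (B : I -> set T'), uniq J ->
    (forall i, measurable (B i)) ->
    P (\bigcap_(i in [set` J]) (U i @^-1` B i)) =
    (\big[*%E/1]_(i <- J) P (U i @^-1` B i))%E.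

(* The data are (X_i, f_0(X_i) + eps_i).  Independence of the pairs (X_i, eps_i)
   amounts to that of the pairs (X_i, Y_i). *)
Record regression_model d (T : measurableType d) (R : realType)
    (P : probability T R) (sigma : R) (X eps : nat -> {RV P >-> R}) : Prop := {
  design_uniform : forall i A, measurable A ->
    distribution P (X i) A = uniform_prob (@ltr01 R) A;
  noise_normal : forall i A, measurable A ->
    distribution P (eps i) A = normal_prob 0 sigma A;
  design_noise_independent : forall i, independent_pair P (X i) (eps i);
  observations_independent :
    independent_family P (fun i w => (X i w, eps i w)) }.

Definition kernel_of {R : realType} (mu : nat -> R) (x x' : R) : R :=
  limn (fun n => \sum_(1 <= i < n) mu i * fourier i x * fourier i x').

Section posterior.
Context {R : realType} (K : R -> R -> R) (sigma : R) (k n : nat) (lambda : R).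

Definition Kk0 (t : R) (x : 'cV[R]_n) : 'rV[R]_n :=
  \row_i derive1n k (fun u => K u (x i 0)) t.

Definition K0k (x : 'cV[R]_n) (t : R) : 'cV[R]_n :=
  \col_i derive1n k (fun u => K (x i 0) u) t.

Definition Kkk (t t' : R) : R := 
  derive1n k (fun u => derive1n k (fun v => K u v) t') t.

Definition regularized_gram (x : 'cV[R]_n) : 'M[R]_n :=
  (\matrix_(i, j) K (x i 0) (x j 0)) + (n%:R * lambda)%:M.

Definition posterior_mean (x y : 'cV[R]_n) (t : R) : R :=
  (Kk0 t x *m invmx (regularized_gram x) *m y) 0 0.

Definition posterior_cov (x : 'cV[R]_n) (t t' : R) : R :=
  sigma ^+ 2 * (n%:R * lambda)^-1 *
  (Kkk t t' - (Kk0 t x *m invmx (regularized_gram x) *m K0k x t') 0 0).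

End posterior.

(* N(m, v), including the degenerate case; [normal_prob] is parametrized by the
   standard deviation and is not a point mass at standard deviation 0. *)
Definition normal_law {R : realType} (m v : R) (A : set R) : \bar R :=
  if v == 0 then dirac m A else normal_prob m (Num.sqrt v) A.

(* Under Q, the random function [path] on [0,1] is GP(m, V): every finite linear
   combination of its values is Gaussian.  Joint measurability makes the law of
   the L2 distance from [path] to a fixed measurable function well defined and
   determined by m and V. *)
Definition gaussian_process d (S : measurableType d) (R : realType)
    (Q : probability S R) (path : S -> R -> R) (m : R -> R) (V : R -> R -> R) :
    Prop :=
  measurable_fun ([set: S] `*` (`[0, 1] : set R))
    (fun z : S * R => path z.1 z.2) /\
  forall (N : nat) (t a : 'I_N -> R), (forall j, t j \in `[0, 1]) ->
    let v := \sum_i \sum_j a i * a j * V (t i) (t j) in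
    0 <= v /\
    forall A, measurable A ->
      Q [set s | A (\sum_j a j * path s (t j))] =
      normal_law (\sum_j a j * m (t j)) v A.

(* Stated with the outer measure P^*, which agrees with P on measurable sets, so
   that measurability of w |-> Z n w need not be assumed. *)
Definition cvg0_in_probability d (T : measurableType d) (R : realType)
    (P : probability T R) (Z : nat -> T -> \bar R) : Prop :=
  forall delta : R, 0 < delta ->
    P^*%mu [set w | (delta%:E < Z n w)%E] @[n --> \oo] --> 0%E.

(* Main.v *)
Require Import Defs.
From HB Require Import structures.
From mathcomp Require Import ring lra zify measurable_realfun.
(** The posterior of [f^(k)(t)] is a normal law whose mean is linear in the
    data, with the kernel ridge regression weights [krr_weights]. These
    weights minimize the [energy]: the squared norm, in the dual of the RKHS,
    of the error made when evaluation of [f^(k)] at [t] is replaced by a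
    weighted sum of evaluations at the design points, plus [n lambda] times
    the squared length of the weights. The minimal energy controls the three
    parts of the error. The posterior variance is [sigma^2 / (n lambda)] times
    it ([posterior_covE]). The squared bias is at most a constant times it,
    because [f0] lies in the RKHS: its coefficients decay like the eigenvalues
    require ([analytic_class_rkhs], [bias_le_energy]). The variance of the
    noise term is [sigma^2] times the expected squared length of the weights,
    which the penalty bounds by the energy over [n lambda] ([noise_error_le]).

    Hence it is enough to bound the energy of any explicit weights
    ([energy_min]). The [plugin_weights] estimate the Fourier coefficients of
    [f] below frequency [m] by averages over the design and differentiate the
    truncated series. They are averages of bounded functions of independent
    uniform variables, so two moments suffice: the expected energy is of order
    [exp (- m) + (1 + n lambda) m^(2k+1) / n] ([expected_energy_le]). The
    assumption [1/2 < gamma] makes the tail of the kernel series,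
    differentiated [k] times, at most of order [exp (- m)]. With [m] about
    [ln n] and [n lambda] of order [ln n] this is [(ln n)^(2k+2) / n], the
    square of the rate ([log_rate_bound]).

    The passage to the posterior probability uses Markov's inequality twice,
    first under the posterior and then under the law of the data, with
    Tonelli's theorem to integrate the pointwise bounds over [0, 1]
    ([gaussian_process_tail_le], [contraction_probability_le]).

    The regression function is given by its Fourier coefficients. Completeness
    of the Fourier basis for integrable functions ([fourier_complete])
    identifies it almost everywhere with the sum of its Fourier series, which
    is smooth and may be differentiated term by term ([is_derive_tseries]);
    thus the responses and the target [derivative_of k f0] are those of the
    series ([design_ae], [derivative_of_analytic]). *)

Set Implicit Arguments.
Unset Strict Implicit.
Unset Printing Implicit Defensive.

Implicit Types (R : realType).

(** * Exponentially decaying sequences *)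

(** Indices start at 1, like the Fourier basis; a negative [g] describes
    growth. *)
Definition exp_decay R (g : R) (c : nat -> R) :=
  exists A : R, forall i, (1 <= i)%N -> `|c i| <= A * expR (- (g * i%:R)).

Lemma exp_decay_ge0 R (g : R) c : exp_decay g c ->
  exists2 A : R, 0 <= A & forall i, (1 <= i)%N -> `|c i| <= A * expR (- (g * i%:R)).
Proof.
move=> [A cA]; exists A => //; have := cA 1%N isT.
move/(le_trans (normr_ge0 _)); rewrite pmulr_lge0//; exact: expR_gt0.
Qed.

(** The sharper bound [(1 - exp (- g n)) / g] goes through by induction,
    because [1 + g <= exp g]. *)
Lemma sum_expR_le R (g : R) n : 0 < g ->
  \sum_(1 <= i < n) expR (- (g * i%:R)) <= g^-1.
Proof.
move=> g0; case: n => [|n]; first by rewrite big_geq// invr_ge0 ltW.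
suff : \sum_(1 <= i < n.+1) expR (- (g * i%:R)) <=
    (1 - expR (- (g * n%:R))) * g^-1.
  move=> /le_trans; apply; rewrite ler_piMl ?invr_ge0 ?ltW//.
  by rewrite gtrBl expR_gt0.
elim: n => [|n ih]; first by rewrite big_geq// mulr0 oppr0 expR0 subrr mul0r.
rewrite big_nat_recr//= (le_trans (lerD ih (lexx _)))//.
have -> : expR (- (g * n%:R)) = expR (- (g * n.+1%:R)) * expR g.
  by rewrite -expRD -natr1; congr expR; ring.
have ge := expR_ge1Dx g.
set e := expR (- _); have e0 : 0 < e by exact: expR_gt0.
rewrite -lerBrDl -mulrBl ler_pdivlMr//.
have := ler_wpM2l (ltW e0) ge; lra.
Qed.

Lemma exp_decay_sum_le R (g : R) c : 0 < g -> exp_decay g c ->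
  exists2 C : R, 0 <= C & forall n, \sum_(1 <= i < n) `|c i| <= C.
Proof.
move=> g0 /exp_decay_ge0[A A0 cA]; exists (A / g).
  by rewrite divr_ge0// ltW.
move=> n; apply: (@le_trans _ _ (\sum_(1 <= i < n) A * expR (- (g * i%:R)))).
  by rewrite !big_nat; apply: ler_sum => i /andP[i1 _]; exact: cA.
by rewrite -mulr_sumr ler_wpM2l// sum_expR_le.
Qed.

Lemma cvg_partial_sumsE R (c : nat -> R) :
  cvgn (series (fun i => c i.+1)) -> cvgn (fun n => \sum_(1 <= i < n) c i).
Proof.
move=> cc; apply/cvg_ex; exists (limn (series (fun i => c i.+1))).
rewrite -cvg_shiftS /=.
under eq_fun do rewrite big_add1/=.
exact: cc.
Qed.

Lemma exp_decay_cvg R (g : R) c : 0 < g -> exp_decay g c ->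
  cvgn (fun n => \sum_(1 <= i < n) c i).
Proof.
move=> g0 cg; apply: cvg_partial_sumsE; apply: normed_cvg.
have [C _ cC] := exp_decay_sum_le g0 cg.
apply: nondecreasing_is_cvgn.
  by apply: nondecreasing_series => i _ _ /=.
by exists C => _ [n _ <-]; have := cC n.+1; rewrite big_add1.
Qed.

Lemma exp_decayM R (g h : R) c d : exp_decay g c -> exp_decay h d ->
  exp_decay (g + h) (fun i => c i * d i).
Proof.
move=> /exp_decay_ge0[A A0 cA] /exp_decay_ge0[B B0 dB].
exists (A * B) => i i1; rewrite normrM mulrDl opprD expRD mulrACA.
by rewrite ler_pM// ?cA ?dB.
Qed.

(** Raise [d i <= exp (d i)] to the power [k], with [d] so small that
    [d k <= g]. *)
Lemma natr_exp_decay R (g : R) k : 0 < g -> exp_decay (- g) (fun i => i%:R ^+ k).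
Proof.
(* The denominator is [k.+1] so that [k = 0] is covered. *)
move=> g0; pose d := g / k.+1%:R; have d0 : 0 < d by rewrite divr_gt0.
have dg : d * k%:R <= g.
  by rewrite /d mulrAC ler_pdivrMr// ler_wpM2l ?(ltW g0)// ler_nat.
exists (d^-1 ^+ k) => i i1; rewrite mulNr opprK ger0_norm ?exprn_ge0//.
apply: (@le_trans _ _ ((d^-1 * expR (d * i%:R)) ^+ k)).
  apply: lerXn2r; rewrite ?nnegrE ?mulr_ge0 ?invr_ge0 ?expR_ge0 ?(ltW d0)//.
  rewrite mulrC ler_pdivlMr// mulrC.
  by rewrite (le_trans _ (expR_ge1Dx _))// lerDr.
rewrite exprMn -expRM_natr ler_wpM2l ?exprn_ge0 ?invr_ge0 ?(ltW d0)//.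
by rewrite ler_expR mulrAC ler_wpM2r.
Qed.

(** * The Fourier basis and its derivatives *)

Definition amplitude R (i : nat) : R := if (i <= 1)%N then 1 else Num.sqrt 2.

Definition frequency R (i : nat) : R := 2 * pi * (i./2)%:R.

Definition phase R (i : nat) : R := if (1 < i)%N && odd i then - (pi / 2) else 0.

(** The [k]-th derivative of the [i]-th basis function. With sine and cosine
    written as shifted cosines, a derivative is a factor [frequency R i] and
    a quarter turn of the phase. *)
Definition dfourier R (k i : nat) (x : R) : R :=
  amplitude R i * frequency R i ^+ k *
    cos (frequency R i * x + phase R i + k%:R * (pi / 2)).

(** The amplitude is at most 2 and the frequency at most [pi * i]. *)
Definition dfourier_bound R (k i : nat) : R := 2 * (pi * i%:R) ^+ k.

Lemma dfourier0 R i : @dfourier R 0 i = fourier i.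
Proof.
apply/funext => x; rewrite /dfourier expr0 mulr1 mul0r addr0 /fourier.
rewrite /amplitude /phase; have [i1|i1] := leqP i 1.
  by case: i i1 => [|[|]]//= _; rewrite /frequency mulr0 mul0r addr0 cos0 mulr1.
by rewrite /=; case: ifPn => _; rewrite ?addr0 ?cosBpihalf.
Qed.

Lemma is_derive_dfourier R k i (x : R) :
  is_derive x 1 (dfourier k i) (dfourier k.+1 i x).
Proof.
rewrite /dfourier.
set a := amplitude R i * _; set w := frequency R i; set p := k%:R * _.
apply: (@is_derive_eq _ _ _ _ _ _ _ _ _); rewrite ?scaler0 ?add0r.
rewrite -natr1 mulrDl mul1r addrA cosDpihalf exprSr /GRing.scale/=.
rewrite /a -/w; ring.
Qed.

Lemma dfourier_bound_ge0 R k i : 0 <= dfourier_bound R k i.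
Proof. by rewrite mulr_ge0// exprn_ge0// mulr_ge0// pi_ge0. Qed.

Lemma dfourier_le R k i (x : R) : `|dfourier k i x| <= dfourier_bound R k i.
Proof.
rewrite /dfourier /dfourier_bound !normrM -mulrA.
apply: ler_pM => //.
  rewrite /amplitude; case: ifP => _; rewrite ?normr1 ?ler1n//.
  rewrite ger0_norm ?sqrtr_ge0// -(ler_pXn2r (n := 2))// ?nnegrE ?sqrtr_ge0//.
  by rewrite sqr_sqrtr// expr2 ler_peMl// ler1n.
apply: (@le_trans _ _ (`|frequency R i ^+ k| * 1)).
  by rewrite ler_wpM2l// cos_max.
rewrite mulr1 normrX; apply: lerXn2r; rewrite ?nnegrE// ?mulr_ge0 ?pi_ge0//.
rewrite ger0_norm /frequency ?mulr_ge0 ?pi_ge0// -mulrA mulrCA ler_wpM2l ?pi_ge0//.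
by rewrite -natrM ler_nat mul2n -[leqRHS]odd_double_half leq_addl.
Qed.

Lemma mvt_between R (f df : R -> R) (a b : R) :
  (forall x : R, is_derive x 1 f (df x)) ->
  exists2 c, `|c - a| <= `|b - a| & f b - f a = df c * (b - a).
Proof.
move=> fdf.
have cf : continuous f.
  by move=> x; apply: differentiable_continuous; apply/derivable1_diffP; have [] := fdf x.
have [ab|ba|->] := ltgtP a b.
- have [//|c] := @MVT R f df a b ab (fun x _ => fdf x) _.
    by apply: continuous_subspaceT.
  rewrite in_itv/= => /andP[ac cb] ->; exists c => //.
  rewrite !ger0_norm; lra.
- have [//|c] := @MVT R f df b a ba (fun x _ => fdf x) _.
    by apply: continuous_subspaceT.
  rewrite in_itv/= => /andP[ac cb] e; exists c.
    rewrite !ler0_norm; lra.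
  by rewrite -opprB e; ring.
- by exists b; rewrite ?subrr// mulr0.
Qed.

(** Two applications of the mean value theorem, at the price of the factor
    1/2 of Taylor's formula. *)
Lemma taylor1_le R (f df ddf : R -> R) M :
  (forall x : R, is_derive x 1 f (df x)) -> (forall x : R, is_derive x 1 df (ddf x)) ->
  (forall x, `|ddf x| <= M) ->
  forall x h, `|f (x + h) - f x - h * df x| <= h ^+ 2 * M.
Proof.
move=> fdf dfd dM x h.
have [c cx ->] := mvt_between x (x + h) fdf.
rewrite (addrC x h) addrK in cx *; rewrite [df c * h]mulrC -mulrBr.
have [e _ ->] := mvt_between x c dfd.
rewrite !normrM -real_normK ?num_real// expr2 -mulrA ler_wpM2l// mulrC.
by rewrite ler_pM.
Qed.

Lemma dfourier_taylor1 R k i (x h : R) :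
  `|dfourier k i (x + h) - dfourier k i x - h * dfourier k.+1 i x| <=
  h ^+ 2 * dfourier_bound R k.+2 i.
Proof.
apply: (taylor1_le (is_derive_dfourier k i) (is_derive_dfourier k.+1 i)) => y.
exact: dfourier_le.
Qed.

Lemma continuous_dfourier R k i : continuous (@dfourier R k i).
Proof.
move=> x; apply: differentiable_continuous; apply/derivable1_diffP.
by have [] := is_derive_dfourier k i x.
Qed.

(** * Term-by-term differentiation of trigonometric series *)

Lemma cvgn_le R (u : nat -> R) (l b : R) :
  u n @[n --> \oo] --> l -> (forall n, u n <= b) -> l <= b.
Proof.
move=> ul ub; rewrite -(cvg_lim (@Rhausdorff R) ul).
by apply: limr_le; [apply/cvg_ex; exists l|near=> n; exact: ub].
Unshelve. all: by end_near. Qed.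

Lemma cvgn_norm_le R (u : nat -> R) (l b : R) :
  u n @[n --> \oo] --> l -> (forall n, `|u n| <= b) -> `|l| <= b.
Proof. by move=> ul; apply: cvgn_le (cvg_norm ul). Qed.

Lemma exp_decay_dom R (g : R) (c d : nat -> R) :
  (forall i, (1 <= i)%N -> `|d i| <= `|c i|) -> exp_decay g c -> exp_decay g d.
Proof.
by move=> dc [A cA]; exists A => i i1; rewrite (le_trans (dc _ i1))// cA.
Qed.

Lemma exp_decay_dfourier_bound R (g : R) (c : nat -> R) k : 0 < g ->
  exp_decay g c -> exp_decay (g / 2) (fun i => c i * dfourier_bound R k i).
Proof.
move=> g0 cg; have g20 : 0 < g / 2 by rewrite divr_gt0.
have [A cA] := exp_decayM cg (natr_exp_decay k g20).
exists (A * (2 * pi ^+ k)) => i i1; have := cA _ i1.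
have -> : g + - (g / 2) = g / 2 by lra.
rewrite /dfourier_bound => {}cA.
have -> : c i * (2 * (pi * i%:R) ^+ k) = (2 * pi ^+ k) * (c i * i%:R ^+ k).
  by rewrite exprMn; ring.
have p0 : 0 <= 2 * pi ^+ k :> R by rewrite mulr_ge0// exprn_ge0// pi_ge0.
rewrite normrM (ger0_norm p0) (mulrC A) -[leRHS]mulrA; exact: ler_wpM2l.
Qed.

Lemma exp_decay_dfourier R (g : R) (c : nat -> R) k x : 0 < g ->
  exp_decay g c -> exp_decay (g / 2) (fun i => c i * dfourier k i x).
Proof.
move=> g0 cg; apply: (exp_decay_dom _ (exp_decay_dfourier_bound k g0 cg)) => i _.
rewrite normrM [leRHS]normrM ler_wpM2l// (le_trans (dfourier_le _ _ _))//.
by rewrite ger0_norm// dfourier_bound_ge0.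
Qed.

Definition tseries R (c : nat -> R) (k : nat) (x : R) : R :=
  limn (fun n => \sum_(1 <= i < n) c i * dfourier k i x).

Lemma tseries_cvg R (g : R) (c : nat -> R) k x : 0 < g -> exp_decay g c ->
  (\sum_(1 <= i < n) c i * dfourier k i x) @[n --> \oo] --> tseries c k x.
Proof.
move=> g0 cg; apply: (@exp_decay_cvg _ (g / 2)); first by rewrite divr_gt0.
exact: exp_decay_dfourier.
Qed.

Lemma quadratic_is_derive R (f : R -> R) (x df C : R) :
  (forall h, `|f (x + h) - f x - h * df| <= h ^+ 2 * C) ->
  is_derive x 1 f df.
Proof.
move=> fC.
have C0 : 0 <= C by have := le_trans (normr_ge0 _) (fC 1); rewrite expr1n mul1r.
have dfx : h^-1 *: (f (h *: (1 : R) + x) - f x) @[h --> 0^'] --> df.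
  apply/cvgrPdist_le => e e0; near=> h.
  have h0 : h != 0 by near: h; exact: nbhs_dnbhs_neq.
  rewrite /GRing.scale/= mulr1 distrC (addrC h).
  have -> : h^-1 * (f (x + h) - f x) - df = h^-1 * (f (x + h) - f x - h * df).
    by rewrite [RHS]mulrBr mulKf.
  rewrite normrM normfV mulrC ler_pdivrMr ?normr_gt0//.
  rewrite (le_trans (fC h))// -real_normK ?num_real// expr2 -mulrA mulrC.
  rewrite ler_wpM2r//.
  have he : `|h| <= e / (C + 1).
    near: h; apply: dnbhs0_le; rewrite divr_gt0// ltr_wpDl//.
  rewrite (le_trans (ler_wpM2r C0 he))// -mulrA ler_piMr ?(ltW e0)//.
  by rewrite mulrC ler_pdivrMr ?ltr_wpDl// mul1r lerDl.
split; last exact: cvg_lim.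
by apply/cvg_ex; exists df.
Unshelve. all: by end_near. Qed.

(** The first-order remainders of the terms are [h ^+ 2] times a summable
    sequence, so the remainder of the sum is quadratic in [h]. *)
Lemma is_derive_tseries R (g : R) (c : nat -> R) k (x : R) : 0 < g ->
  exp_decay g c -> is_derive x 1 (tseries c k) (tseries c k.+1 x).
Proof.
move=> g0 cg; have g20 : 0 < g / 2 by rewrite divr_gt0.
have [C C0 cC] := exp_decay_sum_le g20 (exp_decay_dfourier_bound k.+2 g0 cg).
apply: (@quadratic_is_derive _ _ _ _ C) => h.
have cvgL : (\sum_(1 <= i < n) c i * (dfourier k i (x + h) - dfourier k i x
    - h * dfourier k.+1 i x)) @[n --> \oo] -->
    tseries c k (x + h) - tseries c k x - h * tseries c k.+1 x.
  have := @tseries_cvg _ _ _ k (x + h) g0 cg.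
  move=> /cvgB/(_ (@tseries_cvg _ _ _ k x g0 cg)).
  move=> /cvgB/(_ (cvgM (@cvg_cst _ h _ _ _) (@tseries_cvg _ _ _ k.+1 x g0 cg))).
  apply: cvg_trans; apply: near_eq_cvg; near=> n.
  rewrite !fctE/= mulr_sumr -!sumrB; apply: eq_bigr => i _; ring.
apply: (cvgn_norm_le cvgL) => n.
rewrite (le_trans (ler_norm_sum _ _ _))//.
rewrite (le_trans _ (ler_wpM2l (sqr_ge0 h) (cC n)))// mulr_sumr.
apply: ler_sum => i _; rewrite normrM [`|c i * dfourier_bound _ _ _|]normrM [leRHS]mulrCA.
by rewrite ler_wpM2l// (ger0_norm (dfourier_bound_ge0 _ _ _)) dfourier_taylor1.
Unshelve. all: by end_near. Qed.

Lemma continuous_tseries R (g : R) (c : nat -> R) k : 0 < g ->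
  exp_decay g c -> continuous (tseries c k).
Proof.
move=> g0 cg x; apply: differentiable_continuous; apply/derivable1_diffP.
by have [] := is_derive_tseries k x g0 cg.
Qed.

Lemma derive1n_tseries R (g : R) (c : nat -> R) k : 0 < g ->
  exp_decay g c -> derive1n k (tseries c 0) = tseries c k.
Proof.
move=> g0 cg; elim: k => [|k ih]; first by rewrite derive1n0.
rewrite derive1nS ih; apply/funext => x; rewrite derive1E.
by have [_ ->] := is_derive_tseries k x g0 cg.
Qed.

(** * Positive definite quadratic forms *)

Lemma cvgn_sum (R : realType) (I : finType) (u : I -> nat -> R) (l : I -> R) :
  (forall i, u i n @[n --> \oo] --> l i) ->
  (\sum_i u i n) @[n --> \oo] --> \sum_i l i.
Proof.
move=> ul; elim: (index_enum I) => [|i s ih].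
  under eq_fun do rewrite big_nil; rewrite big_nil; exact: cvg_cst.
under eq_fun do rewrite big_cons; rewrite big_cons; exact: cvgD.
Qed.

Lemma posdef_unitmx (R : realFieldType) n (G : 'M[R]_n) :
  (forall c : 'cV_n, c != 0 -> 0 < (c^T *m G *m c) 0 0) -> G \in unitmx.
Proof.
move=> G0; rewrite -row_free_unit -kermx_eq0; apply/negPn/negP => /rowV0Pn[v].
move=> /sub_kermxP vG v0; have := G0 v^T; rewrite trmx_eq0 trmxK vG mul0mx mxE.
by move=> /(_ v0); rewrite ltxx.
Qed.

(** Completing the square: the gap is the form at [c - invmx G *m b]. *)
Lemma quadratic_form_min (R : realFieldType) n (G : 'M[R]_n) (b c : 'cV[R]_n) :
  G^T = G -> (forall c : 'cV_n, c != 0 -> 0 < (c^T *m G *m c) 0 0) ->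
  - (b^T *m invmx G *m b) 0 0 <= (c^T *m G *m c) 0 0 - 2 * (c^T *m b) 0 0.
Proof.
move=> Gs G0; have Gu := posdef_unitmx G0.
have iGs : (invmx G)^T = invmx G by rewrite trmx_inv Gs.
pose d := c - invmx G *m b.
have d0 : 0 <= (d^T *m G *m d) 0 0.
  have [->|/G0/ltW//] := eqVneq d 0; by rewrite mulmx0 mxE.
have bc : b^T *m c = c^T *m b.
  apply/matrixP => i j; rewrite !mxE ord1 (ord1 j); apply: eq_bigr => l _.
  by rewrite !mxE mulrC.
have dE : d^T *m G *m d = c^T *m G *m c - (c^T *m b + c^T *m b)
    + b^T *m invmx G *m b.
  have dT : d^T = c^T - b^T *m invmx G by rewrite /d linearB/= trmx_mul iGs.
  rewrite dT /d !mulmxBl !mulmxBr !mulmxA mulmxKV// mulmxK// bc.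
  by rewrite opprB opprD !addrA addrAC -!addrA; congr (_ + _); rewrite addrC addrA.
by move: d0; rewrite dE !mxE; lra.
Qed.

Lemma quadratic_form_min_eq (R : realFieldType) n (G : 'M[R]_n) (b : 'cV[R]_n) :
  G^T = G -> G \in unitmx -> let c := invmx G *m b in
  (c^T *m G *m c) 0 0 - 2 * (c^T *m b) 0 0 = - (b^T *m invmx G *m b) 0 0.
Proof.
move=> Gs Gu /=; rewrite trmx_mul trmx_inv Gs mulmxKV//.
by rewrite mulmxA; ring.
Qed.

(** * The posterior as the solution of a minimization problem *)

Lemma exp_decay_fourier R (g : R) (mu : nat -> R) x : 0 < g -> exp_decay g mu ->
  exp_decay (g / 2) (fun i => mu i * fourier i x).
Proof.
by move=> g0 mug; under eq_fun do rewrite -dfourier0; exact: exp_decay_dfourier.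
Qed.

Lemma kernel_of_tseriesl R (mu : nat -> R) x :
  (fun u => kernel_of mu u x) = tseries (fun i => mu i * fourier i x) 0.
Proof.
apply/funext => u; rewrite /kernel_of /tseries; congr (limn _).
apply/funext => n; apply: eq_bigr => i _.
by rewrite dfourier0 mulrAC.
Qed.

Lemma kernel_of_tseriesr R (mu : nat -> R) x :
  kernel_of mu x = tseries (fun i => mu i * fourier i x) 0.
Proof.
apply/funext => u; rewrite /kernel_of /tseries; congr (limn _).
by apply/funext => n; apply: eq_bigr => i _; rewrite dfourier0.
Qed.

Lemma K0kE R (g : R) (mu : nat -> R) k n (x : 'cV[R]_n) t i :
  0 < g -> exp_decay g mu ->
  K0k (kernel_of mu) k x t i 0 = tseries (fun l => mu l * fourier l (x i 0)) k t.
Proof.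
move=> g0 mug; rewrite mxE kernel_of_tseriesr (@derive1n_tseries _ (g / 2))//.
  by rewrite divr_gt0.
exact: exp_decay_fourier.
Qed.

Lemma Kk0E R (mu : nat -> R) k n (x : 'cV[R]_n) t :
  Kk0 (kernel_of mu) k t x = (K0k (kernel_of mu) k x t)^T.
Proof.
apply/matrixP => i j; rewrite !mxE; congr (derive1n k _ t).
by rewrite kernel_of_tseriesl kernel_of_tseriesr.
Qed.

Lemma KkkE R (g : R) (mu : nat -> R) k t t' : 0 < g -> exp_decay g mu ->
  Kkk (kernel_of mu) k t t' = tseries (fun l => mu l * dfourier k l t') k t.
Proof.
move=> g0 mug; have g20 : 0 < g / 2 by rewrite divr_gt0.
rewrite /Kkk -(@derive1n_tseries _ (g / 2))//; last exact: exp_decay_dfourier.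
congr (derive1n k _ t); apply/funext => u.
rewrite kernel_of_tseriesr (@derive1n_tseries _ (g / 2))//.
  rewrite /tseries; congr (limn _).
  by apply/funext => n; apply: eq_bigr => i _; rewrite dfourier0 mulrAC.
exact: exp_decay_fourier.
Qed.

(** The [l]-th Fourier coordinate of the functional
    [f |-> f^(k)(t) - \sum_j c_j f(x_j)]. *)
Definition residual R k n (x c : 'cV[R]_n) t (l : nat) : R :=
  dfourier k l t - \sum_j c j 0 * fourier l (x j 0).

(** The squared norm of the functional with coordinates [residual], in the
    dual of the RKHS, where the coordinate [l] has weight [mu l], penalized
    by [r] times the squared length of the weights. *)
Definition energy R (mu : nat -> R) k n (r : R) (x c : 'cV[R]_n) t : R :=
  limn (fun N => \sum_(1 <= l < N) mu l * residual k x c t l ^+ 2) +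
  r * \sum_j c j 0 ^+ 2.

Lemma kernel_of_cvg R (g : R) (mu : nat -> R) x y :
  0 < g -> exp_decay g mu ->
  (\sum_(1 <= l < N) mu l * fourier l x * fourier l y) @[N --> \oo]
  --> kernel_of mu x y.
Proof.
move=> g0 mug; apply: (@exp_decay_cvg _ (g / 2 / 2)); first by rewrite !divr_gt0.
apply: exp_decay_fourier; first by rewrite divr_gt0.
exact: exp_decay_fourier.
Qed.

Lemma gram_form_cvg R (g : R) (mu : nat -> R) n (x c : 'cV[R]_n) :
  0 < g -> exp_decay g mu ->
  (\sum_(1 <= l < N) mu l * (\sum_j c j 0 * fourier l (x j 0)) ^+ 2) @[N --> \oo]
  --> (c^T *m (\matrix_(i, j) kernel_of mu (x i 0) (x j 0)) *m c) 0 0.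
Proof.
move=> g0 mug; have g20 : 0 < g / 2 by rewrite divr_gt0.
have -> : (c^T *m (\matrix_(i, j) kernel_of mu (x i 0) (x j 0)) *m c) 0 0 =
    \sum_j \sum_i c i 0 * c j 0 * kernel_of mu (x i 0) (x j 0).
  rewrite mxE; apply: eq_bigr => j _; rewrite mxE mulr_suml.
  by apply: eq_bigr => i _; rewrite !mxE mulrAC.
have h i j : (c i 0 * c j 0 * \sum_(1 <= l < N)
    mu l * fourier l (x i 0) * fourier l (x j 0)) @[N --> \oo] -->
    c i 0 * c j 0 * kernel_of mu (x i 0) (x j 0).
  by apply: cvgM; [exact: cvg_cst|exact: kernel_of_cvg g0 mug].
have {h} := cvgn_sum (fun j => cvgn_sum (fun i => h i j)).
apply: cvg_trans; apply: near_eq_cvg; near=> N.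
under eq_bigr do under eq_bigr do rewrite mulr_sumr.
under eq_bigr do rewrite exchange_big/=.
rewrite exchange_big/=; apply: eq_bigr => l _.
rewrite expr2 mulr_suml mulr_sumr; apply: eq_bigr => j _.
rewrite !mulr_sumr; apply: eq_bigr => i _; ring.
Unshelve. all: by end_near. Qed.

Lemma functional_cvg R (g : R) (mu : nat -> R) k n (x c : 'cV[R]_n) t :
  0 < g -> exp_decay g mu ->
  (\sum_(1 <= l < N) mu l * dfourier k l t *
     (\sum_j c j 0 * fourier l (x j 0))) @[N --> \oo]
  --> (c^T *m K0k (kernel_of mu) k x t) 0 0.
Proof.
move=> g0 mug; have g20 : 0 < g / 2 by rewrite divr_gt0.
rewrite mxE.
have h j : (c j 0 * \sum_(1 <= l < N)
    mu l * fourier l (x j 0) * dfourier k l t) @[N --> \oo] -->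
    c^T 0 j * K0k (kernel_of mu) k x t j 0.
  rewrite (K0kE _ _ _ _ g0 mug) mxE; apply: cvgM; first exact: cvg_cst.
  exact: tseries_cvg g20 (exp_decay_fourier (x j 0) g0 mug).
have {h} := cvgn_sum h.
apply: cvg_trans; apply: near_eq_cvg; near=> N.
under eq_bigr do rewrite mulr_sumr.
rewrite exchange_big/=; apply: eq_bigr => l _.
rewrite mulr_sumr; apply: eq_bigr => j _; ring.
Unshelve. all: by end_near. Qed.

Lemma residual_cvg R (g : R) (mu : nat -> R) k n (x c : 'cV[R]_n) t :
  0 < g -> exp_decay g mu ->
  (\sum_(1 <= l < N) mu l * residual k x c t l ^+ 2) @[N --> \oo] -->
  Kkk (kernel_of mu) k t t - 2 * (c^T *m K0k (kernel_of mu) k x t) 0 0 +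
  (c^T *m (\matrix_(i, j) kernel_of mu (x i 0) (x j 0)) *m c) 0 0.
Proof.
move=> g0 mug; have g20 : 0 < g / 2 by rewrite divr_gt0.
rewrite (KkkE _ _ _ g0 mug).
have h1 := @tseries_cvg _ _ _ k t g20 (exp_decay_dfourier k t g0 mug).
have h2 : (2 * \sum_(1 <= l < N) mu l * dfourier k l t *
    (\sum_j c j 0 * fourier l (x j 0))) @[N --> \oo]
    --> 2 * (c^T *m K0k (kernel_of mu) k x t) 0 0.
  by apply: cvgM; [exact: cvg_cst|exact: functional_cvg g0 mug].
have /(_ _ _) := cvgD (cvgB h1 h2) (@gram_form_cvg _ _ _ _ x c g0 mug).
apply: cvg_trans; apply: near_eq_cvg; near=> N.
rewrite !fctE /= mulr_sumr -sumrB -big_split/=; apply: eq_bigr => l _.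
rewrite /residual; ring.
Unshelve. all: by end_near. Qed.

Lemma regularized_gram_formE R (mu : nat -> R) n (lam : R) (x c : 'cV[R]_n) :
  (c^T *m regularized_gram (kernel_of mu) lam x *m c) 0 0 =
  (c^T *m (\matrix_(i, j) kernel_of mu (x i 0) (x j 0)) *m c) 0 0 +
  n%:R * lam * \sum_j c j 0 ^+ 2.
Proof.
rewrite /regularized_gram mulmxDr mulmxDl mxE; congr (_ + _).
rewrite mul_mx_scalar -scalemxAl mxE; congr (_ * _).
by rewrite mxE; apply: eq_bigr => j _; rewrite mxE expr2.
Qed.

(** Expanding the squares turns the series into kernel evaluations, so that
    the energy is quadratic in the weights, with the regularized Gram matrix
    as its quadratic part. *)
Lemma energyE R (g : R) (mu : nat -> R) k n (lam : R) (x c : 'cV[R]_n) t :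
  0 < g -> exp_decay g mu ->
  energy mu k (n%:R * lam) x c t =
  Kkk (kernel_of mu) k t t - 2 * (c^T *m K0k (kernel_of mu) k x t) 0 0 +
  (c^T *m regularized_gram (kernel_of mu) lam x *m c) 0 0.
Proof.
move=> g0 mug; rewrite /energy (cvg_lim (@Rhausdorff R) (@residual_cvg _ _ _ k _ x c t g0 mug)).
by rewrite regularized_gram_formE; ring.
Qed.

Lemma sum_sqr_gt0 R n (c : 'cV[R]_n) : c != 0 -> 0 < \sum_j c j 0 ^+ 2.
Proof.
move=> c0; rewrite lt_neqAle sumr_ge0 ?andbT; last by move=> *; exact: sqr_ge0.
rewrite eq_sym; apply: contra c0; rewrite psumr_eq0; last by move=> *; exact: sqr_ge0.
move=> /allP cj; apply/eqP/matrixP => i j; rewrite mxE ord1; apply/eqP.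
by have := cj i (mem_index_enum _); rewrite sqrf_eq0.
Qed.

Lemma regularized_gram_posdef R (g : R) (mu : nat -> R) n (lam : R) (x c : 'cV[R]_n) :
  0 < g -> exp_decay g mu -> (forall i, (1 <= i)%N -> 0 < mu i) ->
  0 < lam -> c != 0 ->
  0 < (c^T *m regularized_gram (kernel_of mu) lam x *m c) 0 0.
Proof.
move=> g0 mug mu0 lam0 c0.
have n0 : (0 < n)%N by case: n x c c0 => // x c; rewrite flatmx0 eqxx.
rewrite regularized_gram_formE ltr_wpDl//; last first.
  by rewrite mulr_gt0 ?sum_sqr_gt0// mulr_gt0// ltr0n.
rewrite -oppr_le0; apply: (cvgn_le (cvgN (@gram_form_cvg _ _ _ _ x c g0 mug))) => N.
rewrite oppr_le0 big_nat; apply: sumr_ge0 => l /andP[l1 _].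
by rewrite mulr_ge0 ?sqr_ge0// ltW// mu0.
Qed.

Lemma kernel_of_sym R (mu : nat -> R) x y : kernel_of mu x y = kernel_of mu y x.
Proof. by rewrite kernel_of_tseriesr -kernel_of_tseriesl. Qed.

Lemma regularized_gram_sym R (mu : nat -> R) n (lam : R) (x : 'cV[R]_n) :
  (regularized_gram (kernel_of mu) lam x)^T = regularized_gram (kernel_of mu) lam x.
Proof.
rewrite /regularized_gram linearD/= tr_scalar_mx; congr (_ + _).
by apply/matrixP => i j; rewrite !mxE kernel_of_sym.
Qed.

Definition krr_weights R (mu : nat -> R) k n (lam : R) (x : 'cV[R]_n) t : 'cV[R]_n :=
  invmx (regularized_gram (kernel_of mu) lam x) *m K0k (kernel_of mu) k x t.

Lemma posterior_meanE R (mu : nat -> R) k n (lam : R) (x y : 'cV[R]_n) t :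
  posterior_mean (kernel_of mu) k lam x y t =
  \sum_j krr_weights mu k lam x t j 0 * y j 0.
Proof.
rewrite /posterior_mean Kk0E -[invmx _]trmxK trmx_inv regularized_gram_sym.
by rewrite -trmx_mul mxE; apply: eq_bigr => j _; rewrite mxE.
Qed.

(** The Schur complement in the posterior variance is the minimum of the
    energy over the weights. *)
Lemma posterior_covE R (g : R) (mu : nat -> R) sigma k n (lam : R) (x : 'cV[R]_n) t :
  0 < g -> exp_decay g mu -> (forall i, (1 <= i)%N -> 0 < mu i) -> 0 < lam ->
  posterior_cov (kernel_of mu) sigma k lam x t t =
  sigma ^+ 2 / (n%:R * lam) *
    energy mu k (n%:R * lam) x (krr_weights mu k lam x t) t.
Proof.
move=> g0 mug mu0 lam0; rewrite /posterior_cov (energyE _ _ _ _ _ g0 mug) Kk0E.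
have Gp := fun c => @regularized_gram_posdef R g mu n lam x c g0 mug mu0 lam0.
have := quadratic_form_min_eq (K0k (kernel_of mu) k x t)
  (regularized_gram_sym mu lam x) (posdef_unitmx Gp).
rewrite -/(krr_weights mu k lam x t) /= => e; congr (_ * _).
by rewrite -addrA [- _ + _ in RHS]addrC e.
Qed.

Lemma energy_min R (g : R) (mu : nat -> R) k n (lam : R) (x c : 'cV[R]_n) t :
  0 < g -> exp_decay g mu -> (forall i, (1 <= i)%N -> 0 < mu i) -> 0 < lam ->
  energy mu k (n%:R * lam) x (krr_weights mu k lam x t) t <=
  energy mu k (n%:R * lam) x c t.
Proof.
move=> g0 mug mu0 lam0; rewrite !(energyE _ _ _ _ _ g0 mug).
have Gp := fun c => @regularized_gram_posdef R g mu n lam x c g0 mug mu0 lam0.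
have Gs := regularized_gram_sym mu lam x.
have := quadratic_form_min (K0k (kernel_of mu) k x t) c Gs Gp.
have := quadratic_form_min_eq (K0k (kernel_of mu) k x t) Gs (posdef_unitmx Gp).
rewrite -/(krr_weights mu k lam x t) /=; lra.
Qed.

(** * Polynomials separating two halves of the unit interval *)

Lemma bernoulli_le R (a : R) n : 0 <= a <= 1 -> 1 - n%:R * a <= (1 - a) ^+ n.
Proof.
move=> /andP[a0 a1]; elim: n => [|n ih]; first by rewrite mul0r subr0 expr0.
have a10 : 0 <= 1 - a by rewrite subr_ge0.
rewrite exprS (le_trans _ (ler_wpM2l a10 ih))//.
rewrite -natr1 mulrDl mul1r.
have : 0 <= n%:R * a * a by rewrite !mulr_ge0.
by nra.
Qed.

(** By Bernoulli's inequality this polynomial in [y] tends to 1 below 1/2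
    and to 0 above. Composed with a trigonometric polynomial it approaches
    the indicator of an interval and stays a trigonometric polynomial. *)
Definition separator R (y : R) (N : nat) : R := (1 - y ^+ N) ^+ (2 ^ N).

Lemma separator_itv R (y : R) N : 0 <= y <= 1 -> 0 <= separator y N <= 1.
Proof.
move=> /andP[y0 y1]; rewrite /separator.
have y01 : 0 <= 1 - y ^+ N <= 1.
  by rewrite subr_ge0 exprn_ile1//= gerBl exprn_ge0.
by case/andP: y01 => *; rewrite exprn_ge0// exprn_ile1.
Qed.

(** Bernoulli's inequality bounds the separator below by [1 - (2 y) ^ N]. *)
Lemma separator_cvg1 R (y : R) : 0 <= y < 2^-1 -> separator y N @[N --> \oo] --> (1 : R).
Proof.
move=> /andP[y0 y12]; have y1 : y <= 1 by lra.
apply: (@squeeze_cvgr _ _ _ _ (fun N => 1 - (2 * y) ^+ N) (cst 1)); last 2 first.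
- rewrite -[X in _ --> X]subr0; apply: cvgB; first exact: cvg_cst.
  by apply: cvg_expr; rewrite ger0_norm; lra.
- exact: cvg_cst.
near=> N; have /andP[_ ->] : 0 <= separator y N <= 1.
  by apply: separator_itv; rewrite y0.
rewrite andbT exprMn -natrX; apply: bernoulli_le.
by rewrite exprn_ge0// exprn_ile1.
Unshelve. all: by end_near. Qed.

(** Bernoulli's inequality gives [(2 y) ^ N <= (1 + y ^ N) ^ (2 ^ N)], and
    the product of the right-hand side with the separator is at most 1. *)
Lemma separator_cvg0 R (y : R) : 2^-1 < y <= 1 -> separator y N @[N --> \oo] --> (0 : R).
Proof.
move=> /andP[y12 y1]; have y0 : 0 < y by lra.
have yy : 0 < 2 * y by lra.
apply: (@squeeze_cvgr _ _ _ _ (cst 0) (fun N => (2 * y)^-1 ^+ N)); last 2 first.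
- exact: cvg_cst.
- apply: cvg_expr; rewrite ger0_norm ?invr_ge0 ?(ltW yy)//.
  by rewrite invf_lt1//; lra.
near=> N; have /andP[-> _] : 0 <= separator y N <= 1.
  by apply: separator_itv; rewrite ltW.
rewrite /= exprVn -[leRHS]div1r ler_pdivlMr ?exprn_gt0//.
have yN0 : 0 <= y ^+ N by rewrite exprn_ge0// ltW.
have yN1 : y ^+ N <= 1 by rewrite exprn_ile1// ltW.
have -> : (2 * y) ^+ N = (2 ^ N)%:R * y ^+ N by rewrite exprMn natrX.
have b : 1 + (2 ^ N)%:R * y ^+ N <= (1 + y ^+ N) ^+ (2 ^ N).
  elim: (2 ^ N)%N => [|m ih]; first by rewrite mul0r addr0 expr0.
  rewrite exprS (le_trans _ (ler_wpM2l _ ih)) ?addr_ge0//.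
  rewrite -natr1 mulrDl mul1r.
  have : 0 <= m%:R * y ^+ N * y ^+ N by rewrite !mulr_ge0.
  by nra.
apply: (@le_trans _ _ (separator y N * (1 + y ^+ N) ^+ (2 ^ N))).
  rewrite ler_wpM2l//; last by rewrite (le_trans _ b)// lerDr.
  by rewrite exprn_ge0// subr_ge0.
rewrite /separator -exprMn exprn_ile1//.
  by apply: mulr_ge0; [rewrite subr_ge0|rewrite addr_ge0].
by have : 0 <= y ^+ N * y ^+ N; [rewrite mulr_ge0|nra].
Unshelve. all: by end_near. Qed.

(** * Functions orthogonal to all waves *)

Definition bounded_measurable d (T : measurableType d) R (q : T -> R) :=
  measurable_fun setT q /\ exists B : R, forall x, `|q x| <= B.

Lemma bounded_measurableM d (T : measurableType d) R (p q : T -> R) :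
  bounded_measurable p -> bounded_measurable q ->
  bounded_measurable (fun x => p x * q x).
Proof.
move=> [mp [A pA]] [mq [B qB]]; split; first exact: measurable_funM.
by exists (A * B) => x; rewrite normrM ler_pM.
Qed.

Lemma bounded_measurableD d (T : measurableType d) R (p q : T -> R) :
  bounded_measurable p -> bounded_measurable q ->
  bounded_measurable (fun x => p x + q x).
Proof.
move=> [mp [A pA]] [mq [B qB]]; split; first exact: measurable_funD.
by exists (A + B) => x; rewrite (le_trans (ler_normD _ _))// lerD.
Qed.

Lemma bounded_measurable_cst d (T : measurableType d) R (a : R) :
  bounded_measurable (fun _ : T => a).
Proof. by split; [exact: measurable_cst|exists `|a|]. Qed.

Lemma bounded_measurableB d (T : measurableType d) R (p q : T -> R) :
  bounded_measurable p -> bounded_measurable q ->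
  bounded_measurable (fun x => p x - q x).
Proof.
move=> [mp [A pA]] [mq [B qB]]; split; first exact: measurable_funB.
by exists (A + B) => x; rewrite (le_trans (ler_normB _ _))// lerD.
Qed.

Lemma bounded_measurable_sum d (T : measurableType d) R (I : Type) (s : seq I)
    (q : I -> T -> R) : (forall i, bounded_measurable (q i)) ->
  bounded_measurable (fun x => \sum_(i <- s) q i x).
Proof.
move=> mq; elim: s => [|i s ih].
  by under eq_fun do rewrite big_nil; exact: bounded_measurable_cst.
by under eq_fun do rewrite big_cons; exact: bounded_measurableD.
Qed.

Lemma integrable_mul_bounded d (T : measurableType d) R
    (m : {measure set T -> \bar R}) (D : set T) (h q : T -> R) :
  measurable D -> m.-integrable D (EFin \o h) -> bounded_measurable q ->
  m.-integrable D (EFin \o (fun x => h x * q x)).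
Proof.
move=> mD ih [mq [B qB]].
apply: (@integrableMl _ _ _ m D mD (EFin \o h) q) => //.
  exact: measurable_funTS.
by exists B; split; [exact: num_real|move=> x Bx y _ /=; rewrite (le_trans (qB y))// ltW].
Qed.

Lemma integrable01_mul_bounded R (h q : R -> R) :
  lebesgue_measure.-integrable `[0, 1] (EFin \o h) -> bounded_measurable q ->
  lebesgue_measure.-integrable `[0, 1] (EFin \o (fun x : R => h x * q x)).
Proof.
move=> ih bq.
exact: (@integrable_mul_bounded _ _ _ lebesgue_measure `[0, 1]%classic h q
  (measurable_itv _) ih bq).
Qed.

Definition wave R (j : nat) (a x : R) : R := cos (2 * pi * j%:R * x + a).

Lemma bounded_measurable_wave R j (a : R) : bounded_measurable (wave j a).
Proof.
split; last by exists 1 => x; exact: cos_max.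
apply: continuous_measurable_fun => x; apply: continuous_comp; last exact: continuous_cos.
by apply: cvgD; [apply: cvgM; [exact: cvg_cst|exact: cvg_id]|exact: cvg_cst].
Qed.

Lemma waveM R i j (a b x : R) :
  wave i a x * wave j b x =
  2^-1 * (wave (i + j) (a + b) x +
   (if (j <= i)%N then wave (i - j) (a - b) x else wave (j - i) (b - a) x)).
Proof.
have e : cos (2 * pi * i%:R * x + a - (2 * pi * j%:R * x + b)) =
   (if (j <= i)%N then wave (i - j) (a - b) x else wave (j - i) (b - a) x).
  rewrite /wave; case: leqP => ij; last first.
    by rewrite -cosN natrB ?(ltnW ij)//; congr cos; ring.
  by rewrite natrB//; congr cos; ring.
rewrite -e /wave.
have -> : 2 * pi * (i + j)%:R * x + (a + b) =
   (2 * pi * i%:R * x + a) + (2 * pi * j%:R * x + b) by rewrite natrD; ring.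
set u := _ + a; set v := _ + b; rewrite (cosD u v) (cosB u v); lra.
Qed.

Definition wave_orthogonal R (h q : R -> R) := bounded_measurable q /\
  forall j a, (\int[lebesgue_measure]_(x in `[0, 1]) (h x * (q x * wave j a x)) = 0).

(** These multipliers form an algebra, which contains the waves by the
    product-to-sum formula; hence it contains every trigonometric
    polynomial. *)
Definition preserves_orthogonal R (h s : R -> R) :=
  forall q, wave_orthogonal h q -> wave_orthogonal h (fun x => s x * q x).

Section preserves.
Variables (R : realType) (h : R -> R).
Hypothesis ih : lebesgue_measure.-integrable `[0, 1] (EFin \o h).

Let ihq (q : R -> R) : bounded_measurable q ->
  lebesgue_measure.-integrable `[0, 1] (EFin \o (fun x => h x * q x)).
Proof. exact: integrable01_mul_bounded. Qed.

Let ihqw (q : R -> R) j a : bounded_measurable q ->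
  lebesgue_measure.-integrable `[0, 1] (EFin \o (fun x => h x * (q x * wave j a x))).
Proof.
move=> bq; apply: ihq; apply: bounded_measurableM => //.
exact: bounded_measurable_wave.
Qed.

Lemma preserves_orthogonal_cst a : preserves_orthogonal h (fun=> a).
Proof.
move=> q [bq oq]; split.
  by apply: bounded_measurableM => //; exact: bounded_measurable_cst.
move=> j b; under eq_Rintegral do rewrite -mulrA mulrCA.
by rewrite RintegralZl//= ?oq ?mulr0//; exact: ihqw.
Qed.

Lemma preserves_orthogonalB s u : preserves_orthogonal h s ->
  preserves_orthogonal h u -> preserves_orthogonal h (fun x => s x - u x).
Proof.
move=> hs hu q oq; have [bs os] := hs q oq; have [bu ou] := hu q oq; split.
  by under eq_fun do rewrite mulrBl; exact: bounded_measurableB.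
move=> j b; under eq_Rintegral do rewrite mulrBl mulrBl mulrBr.
by rewrite RintegralB ?os ?ou ?subrr//=; exact: ihqw.
Qed.

Lemma preserves_orthogonalM s u : preserves_orthogonal h s ->
  preserves_orthogonal h u -> preserves_orthogonal h (fun x => s x * u x).
Proof.
by move=> hs hu q oq; under eq_fun do rewrite -mulrA; exact/hs/hu.
Qed.

Lemma preserves_orthogonalX s n : preserves_orthogonal h s ->
  preserves_orthogonal h (fun x => s x ^+ n).
Proof.
move=> hs; elim: n => [|n ihn].
  by under eq_fun do rewrite expr0; exact: preserves_orthogonal_cst.
by under eq_fun do rewrite exprS; exact: preserves_orthogonalM.
Qed.

Lemma preserves_orthogonal_wave i a : preserves_orthogonal h (wave i a).
Proof.
move=> q [bq oq]; split.
  by apply: bounded_measurableM => //; exact: bounded_measurable_wave.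
move=> j b.
have ow l c : \int[lebesgue_measure]_(x in `[0, 1])
    (h x * (q x * wave l c x)) = 0 by exact: oq.
pose l := if (j <= i)%N then (i - j)%N else (j - i)%N.
pose c := if (j <= i)%N then a - b else b - a.
rewrite (_ : \int[_]_(x in _) _ = \int[lebesgue_measure]_(x in `[0, 1])
    (2^-1 * (h x * (q x * wave (i + j) (a + b) x) + h x * (q x * wave l c x)))).
  rewrite RintegralZl//=; last first.
    have := integrableD _ (ihqw (i + j) (a + b) bq) (ihqw l c bq).
    exact.
  by rewrite RintegralD//= ?ow ?addr0 ?mulr0//; exact: ihqw.
apply: eq_Rintegral => x _.
transitivity (h x * q x * (wave i a x * wave j b x)); first by ring.
by rewrite waveM /l /c; case: ifP => _; ring.
Qed.

End preserves.

Lemma ae_neq R (r : R) : {ae lebesgue_measure, forall x : R, x != r}.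
Proof.
exists [set r]; split; [exact: measurable_set1|exact: lebesgue_measure_set1|].
by move=> x /= /negP; rewrite negbK => /eqP.
Qed.

Lemma cos_lt_norm R (u v : R) : `|u| < v -> v <= pi -> cos v < cos u.
Proof.
move=> uv vp; have u0 := normr_ge0 u.
have -> : cos u = cos `|u| by case: (ger0P u); rewrite ?cosN.
rewrite ltr_cos// in_itv/=; apply/andP; split; lra.
Qed.

(** A trigonometric polynomial of degree one with values in [0, 1], below 1/2 on
    ]0, b[ and above 1/2 on ]b, 1[: the cosine centred at [b / 2] takes the value
    [cos (pi b)] at both ends of this arc. *)
Definition arc R (b x : R) : R := 2^-1 - 4^-1 * (wave 1 (- (pi * b)) x - cos (pi * b)).

Lemma arc_itv R (b x : R) : 0 <= arc b x <= 1.
Proof.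
have := @cos_max R (pi * b); have := @cos_max R (2 * pi * 1 * x + - (pi * b)).
rewrite !ler_norml /arc /wave => /andP[? ?] /andP[? ?]; apply/andP; split; lra.
Qed.

Lemma arc_lt R (b x : R) : 0 < x < b -> b < 1 -> arc b x < 2^-1.
Proof.
move=> /andP[x0 xb] b1; have pi0 := pi_gt0 R.
suff : cos (pi * b) < wave 1 (- (pi * b)) x by rewrite /arc; lra.
apply: cos_lt_norm; last by nra.
by rewrite mulr1 ltr_norml; apply/andP; split; nra.
Qed.

Lemma arc_gt R (b x : R) : 0 < b < x -> x < 1 -> 2^-1 < arc b x.
Proof.
move=> /andP[b0 bx] x1; have pi0 := pi_gt0 R.
suff : wave 1 (- (pi * b)) x < cos (pi * b) by rewrite /arc; lra.
rewrite /wave mulr1; set y := _ + _.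
have := @cos_lt_norm R (y - pi) (pi - pi * b).
have -> : cos (y - pi) = - cos y by rewrite -[in RHS](subrK pi y) cosDpi opprK.
have -> : cos (pi - pi * b) = - cos (pi * b) by rewrite addrC cosDpi cosN.
rewrite ltrN2; apply; last by nra.
by rewrite ltr_norml /y; apply/andP; split; nra.
Qed.

Lemma preserves_orthogonal_separator R (h : R -> R) (b : R) N :
  lebesgue_measure.-integrable `[0, 1] (EFin \o h) ->
  preserves_orthogonal h (fun x => separator (arc b x) N).
Proof.
move=> ih; have pc a := preserves_orthogonal_cst ih a.
apply: (preserves_orthogonalX ih); apply: (preserves_orthogonalB ih) => //.
apply: (preserves_orthogonalX ih); apply: (preserves_orthogonalB ih) => //.
apply: preserves_orthogonalM => //; apply: (preserves_orthogonalB ih) => //.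
exact: preserves_orthogonal_wave.
Qed.

(** The separators of [arc b] integrate to 0 against [h] and tend boundedly
    to the indicator of ]0, b[. *)
Lemma wave_orthogonal_integral0 R (h : R -> R) (b : R) :
  lebesgue_measure.-integrable `[0, 1] (EFin \o h) ->
  wave_orthogonal h (cst 1) -> 0 < b < 1 ->
  \int[lebesgue_measure]_(x in `[0, b]) h x = 0.
Proof.
move=> ih h1 /andP[b0 b1].
have oN N : (\int[lebesgue_measure]_(x in `[0, 1]) (h x * separator (arc b x) N) = 0).
  have [_ /(_ 0 0)] := preserves_orthogonal_separator b N ih h1.
  move=> o0; rewrite -[RHS]o0; apply: eq_Rintegral => x _.
  by rewrite /wave mulr0 mul0r addr0 cos0 !mulr1.
have bs N : bounded_measurable (fun x : R => separator (arc b x) N).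
  have [+ _] := preserves_orthogonal_separator b N ih h1.
  by under eq_fun do rewrite mulr1.
have m01 : measurable (`[0%R, 1%R]%classic : set R) by exact: measurable_itv.
have ihb : lebesgue_measure.-integrable `[0, 1] (EFin \o (h \_ `[0, b[)).
  rewrite -restrict_EFin; apply/integrable_restrict => //.
  apply: integrableS ih => //; exact: measurableI.
pose fN N x := (h x * separator (arc b x) N)%:E.
have [//|||||_ _ +] := @dominated_convergence _ _ R lebesgue_measure `[0, 1]%classic
    m01 fN (EFin \o (h \_ `[0, b[)) (abse \o (EFin \o h)).
- move=> N; exact: (measurable_int lebesgue_measure (integrable01_mul_bounded ih (bs N))).
- exact: (measurable_int _ ihb).
- have := @ae_neq R 0; have := @ae_neq R b; have := @ae_neq R 1.
  apply: filterS3; first exact: (ae_filter_ringOfSetsType lebesgue_measure).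
  move=> x x1 xb x0; rewrite /= in_itv/= => /andP[x0' x1'].
  rewrite /fN /patch; apply: cvg_EFin; first by near=> N.
  have x00 : 0 < x by rewrite lt_neqAle eq_sym x0.
  have x11 : x < 1 by rewrite lt_neqAle x1.
  rewrite mem_setE in_itv/= x0' /=; case: ltP => xb'.
    rewrite -[X in _ --> X]mulr1; apply: cvgM; first exact: cvg_cst.
    apply: separator_cvg1; have /andP[-> _]/= := arc_itv b x.
    by apply: arc_lt => //; rewrite x00.
  rewrite -[X in _ --> X](mulr0 (h x)); apply: cvgM; first exact: cvg_cst.
  apply: separator_cvg0; have /andP[_ ->]/= := arc_itv b x.
  by rewrite andbT; apply: arc_gt => //; rewrite b0 lt_neqAle eq_sym xb.
- exact: integrable_abse.
- apply: aeW => x N _; rewrite /fN /= lee_fin normrM ler_piMr//.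
  have /andP[s0 s1] := separator_itv N (arc_itv b x).
  by rewrite ger0_norm.
have -> : (fun N => \int[lebesgue_measure]_(x in `[0%R, 1%R]) fN N x)%E = cst 0%E.
  apply/funext => N; have := oN N; rewrite /Rintegral => /eqP.
  rewrite fine_eq0; first by move/eqP.
  have := integrable01_mul_bounded ih (bs N).
  exact: (@integrable_fin_num _ _ _ lebesgue_measure _ m01).
move=> /(cvg_unique (@ereal_hausdorff R) (cvg_cst _ (F := \oo))) e.
have ib : lebesgue_measure.-integrable `[0, b[ (EFin \o h).
  apply: integrableS ih => //.
  by apply: subset_itvl; rewrite bnd_simp ltW.
rewrite -Rintegral_itv_bndo_bndc//.
have -> : (`[0, b[%classic : set R) = `[0, 1] `&` `[0, b[.
  by rewrite setIidr//; apply: subset_itvl; rewrite bnd_simp ltW.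
by rewrite Rintegral_mkcondr /Rintegral -e.
Unshelve. all: by end_near. Qed.

(** * Completeness of the Fourier basis *)

(** The addition formula for the cosine. *)
Lemma wave_fourier R j (a : R) : exists i1 i2 c1 c2,
  [/\ (1 <= i1)%N, (1 <= i2)%N &
    wave j a = fun x => c1 * fourier i1 x + c2 * fourier i2 x].
Proof.
case: j => [|j].
  exists 1%N, 1%N, (cos a), 0; split => //; apply/funext => x.
  by rewrite /wave mulr0 mul0r add0r mul0r addr0 /fourier mulr1.
exists j.+1.*2, j.+1.*2.+1, (cos a / Num.sqrt 2), (- (sin a / Num.sqrt 2)).
split => //; apply/funext => x.
have s2 : Num.sqrt 2 != 0 :> R by rewrite gt_eqF// sqrtr_gt0.
have -> : fourier j.+1.*2 x = Num.sqrt 2 * cos (2 * pi * j.+1%:R * x).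
  by rewrite /fourier odd_double doubleK doubleS.
have -> : fourier j.+1.*2.+1 x = Num.sqrt 2 * sin (2 * pi * j.+1%:R * x).
  have e : j.+1.*2.+1./2 = j.+1 by rewrite -[RHS]uphalf_double.
  by rewrite /fourier oddS odd_double e doubleS.
by rewrite /wave cosD; field.
Qed.

Lemma bounded_measurable_dfourier R k i : bounded_measurable (@dfourier R k i).
Proof.
split; first by apply: continuous_measurable_fun; exact: continuous_dfourier.
by exists (dfourier_bound R k i) => x; exact: dfourier_le.
Qed.

Lemma bounded_measurable_fourier R i : bounded_measurable (@fourier R i).
Proof. by rewrite -dfourier0; exact: bounded_measurable_dfourier. Qed.

Lemma fourier_orthogonal_wave R (h : R -> R) :
  lebesgue_measure.-integrable `[0, 1] (EFin \o h) ->
  (forall i, (1 <= i)%N ->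
    \int[lebesgue_measure]_(x in `[0, 1]) (h x * fourier i x) = 0) ->
  wave_orthogonal h (cst 1).
Proof.
move=> ih h0; split; first exact: bounded_measurable_cst.
move=> j a; have [i1 [i2 [c1 [c2 [i10 i20 ->]]]]] := wave_fourier j a.
have ihf i := integrable01_mul_bounded ih (@bounded_measurable_fourier R i).
have bc c i : bounded_measurable (fun x => c * @fourier R i x).
  apply: bounded_measurableM; first exact: bounded_measurable_cst.
  exact: bounded_measurable_fourier.
under eq_Rintegral do rewrite mul1r mulrDr.
rewrite RintegralD//=; try exact: integrable01_mul_bounded.
under eq_Rintegral do rewrite mulrCA.
under [X in _ + X]eq_Rintegral do rewrite mulrCA.
rewrite RintegralZl//= ?h0// ?RintegralZl//= ?h0// ?mulr0 ?addr0//; exact: ihf.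
Qed.

(** An integrable function with vanishing Fourier coefficients has a
    vanishing primitive, so it is zero by Lebesgue's differentiation
    theorem. *)
Lemma fourier_complete R (h : R -> R) :
  lebesgue_measure.-integrable `[0, 1] (EFin \o h) ->
  (forall i, (1 <= i)%N ->
    \int[lebesgue_measure]_(x in `[0, 1]) (h x * fourier i x) = 0) ->
  {ae lebesgue_measure, forall x, x \in `[0, 1] -> h x = 0}.
Proof.
move=> ih /(fourier_orthogonal_wave ih) ho.
pose g := h \_ `[0, 1].
have m01 : measurable (`[0%R, 1%R]%classic : set R) by exact: measurable_itv.
have ig : lebesgue_measure.-integrable [set: R] (EFin \o g).
  by rewrite /g -restrict_EFin; apply/integrable_restrict => //; rewrite setTI.
have ig' y : lebesgue_measure.-integrable [set` Interval (BLeft 0) (BRight y)] (EFin \o g).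
  exact: integrableS ig.
have lg : locally_integrable [set: R] g by exact: integrable_locally.
have := @FTC1 R g (BLeft 0) ig' lg.
have := @ae_neq R 0; have := @ae_neq R 1.
apply: filterS3; first exact: (ae_filter_ringOfSetsType lebesgue_measure).
move=> x x1 x0 Dg; rewrite in_itv/= => /andP[x0' x1'].
have {}x0 : 0 < x by rewrite lt_neqAle eq_sym x0.
have {}x1 : x < 1 by rewrite lt_neqAle x1.
have [|dg g'] := Dg; first by rewrite /= lte_fin.
have gh : g x = h x by rewrite /g patchE mem_setE in_itv/= x0' x1'.
rewrite -gh -g' derive1E.
rewrite (@near_eq_derive _ _ _ _ (cst 0) x 1) ?derive_cst//.
near=> y; have /andP[y0 y1] : 0 < y < 1.
  by near: y; apply: near_in_itvoo; rewrite in_itv/= x0.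
transitivity (\int[lebesgue_measure]_(z in `[0, y]) h z); last first.
  by apply: wave_orthogonal_integral0 => //; rewrite y0.
apply: eq_Rintegral => z; rewrite inE/= in_itv/= => /andP[z0 zy].
by rewrite /g patchE mem_setE in_itv/= z0 (le_trans zy (ltW y1)).
Unshelve. all: by end_near. Qed.

(** * Orthonormality of the Fourier basis *)

Lemma integrable01_bounded R (q : R -> R) : bounded_measurable q ->
  lebesgue_measure.-integrable `[0, 1] (EFin \o q).
Proof.
move=> [mq [B qB]].
apply: (@measurable_bounded_integrable _ _ _ lebesgue_measure) => //.
- by rewrite /= lebesgue_measure_itv/= lte_fin ltr01 -EFinB ltry.
- exact: measurable_funTS.
- by exists B; split; [exact: num_real|move=> x Bx y _ /=; rewrite (le_trans (qB y))// ltW].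
Qed.

Lemma integral_wave R j (a : R) :
  \int[lebesgue_measure]_(x in `[0, 1]) wave j a x = (j == 0%N)%:R * cos a.
Proof.
case: j => [|j].
  rewrite mul1r (@eq_Rintegral _ _ _ _ _ (fun=> cos a)); last first.
    by move=> x _; rewrite /wave mulr0 mul0r add0r.
  rewrite Rintegral_cst//= lebesgue_measure_itv/= lte_fin ltr01 -EFinB/=.
  by rewrite subr0 mulr1.
rewrite mul0r; pose w : R := 2 * pi * j.+1%:R.
have w0 : w != 0 by rewrite /w !mulf_neq0// gt_eqF// pi_gt0.
pose F x := w^-1 * sin (w * x + a).
have dF (x : R) : is_derive x 1 F (wave j.+1 a x).
  apply: is_derive_eq; rewrite /wave -/w /GRing.scale/=.
  by field.
rewrite /Rintegral (@continuous_FTC2 _ _ F)//.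
- rewrite /F mulr1 mulr0 add0r.
  suff -> : sin (w + a) = sin a by rewrite subee.
  rewrite /w; elim: j.+1 => [|n ih]; first by rewrite mulr0 add0r.
  have -> : 2 * pi * n.+1%:R + a = 2 * pi * n%:R + a + pi *+ 2.
    by rewrite -natr1 -mulr_natl; ring.
  by rewrite sinD2pi.
- apply: continuous_subspaceT => x; apply: differentiable_continuous.
  apply/derivable1_diffP; rewrite /wave.
  by apply: ex_derive.
- split.
  + by move=> x _; have [] := dF x.
  + apply: cvg_at_right_filter; apply: differentiable_continuous.
    by apply/derivable1_diffP; have [] := dF 0.
  + apply: cvg_at_left_filter; apply: differentiable_continuous.
    by apply/derivable1_diffP; have [] := dF 1.
- by move=> x _; rewrite derive1E; have [_ ->] := dF x.
Qed.

Lemma fourier_waveE R i : @fourier R i = fun x => amplitude R i * wave i./2 (phase R i) x.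
Proof.
rewrite -dfourier0; apply/funext => x.
by rewrite /dfourier expr0 mulr1 mul0r addr0.
Qed.

Lemma fourier_orthonormal R i l : (1 <= i)%N -> (1 <= l)%N ->
  \int[lebesgue_measure]_(x in `[0, 1]) (@fourier R i x * fourier l x) = (i == l)%:R.
Proof.
move=> i1 l1; rewrite !fourier_waveE.
set A := amplitude R i; set B := amplitude R l; set a := phase R i; set b := phase R l.
pose m := (if (l./2 <= i./2)%N then (i./2 - l./2)%N else (l./2 - i./2)%N).
pose c := if (l./2 <= i./2)%N then a - b else b - a.
have iw j d : lebesgue_measure.-integrable `[0, 1] (EFin \o (@wave R j d)).
  exact/integrable01_bounded/bounded_measurable_wave.
have -> : \int[lebesgue_measure]_(x in `[0, 1])
      (A * wave i./2 a x * (B * wave l./2 b x)) =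
    A * B / 2 * ((i./2 + l./2 == 0)%N%:R * cos (a + b) + (m == 0)%N%:R * cos c).
  rewrite -!integral_wave -RintegralD// -RintegralZl//=; last first.
    exact: (integrableD _ (iw _ _) (iw _ _)).
  apply: eq_Rintegral => x _.
  rewrite mulrACA waveM /m /c; case: ifP => _; ring.
have cE : cos c = cos (a - b) by rewrite /c; case: ifP => // _; rewrite -opprB cosN.
have mE : (m == 0)%N = (i./2 == l./2).
  by rewrite /m; case: leqP => ?; rewrite subn_eq0 eqn_leq; lia.
rewrite {}cE {}mE.
have [e|ne] := eqVneq i./2 l./2; last first.
  rewrite mul0r addr0 (_ : (_ + _ == 0)%N = false) ?mul0r ?mulr0; last first.
    by rewrite addn_eq0; apply: contra_neqF ne => /andP[/eqP-> /eqP->].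
  by rewrite (_ : (i == l) = false)//; apply: contra_neqF ne => /eqP ->.
rewrite mul1r e addn_eq0 andbb.
have [i2|i2] := leqP i 1.
  have {i2}i1' : i = 1%N by lia.
  have l1' : l = 1%N.
    move: e; rewrite i1'/= => /esym/eqP; rewrite -leqn0 => l0.
    have := odd_double_half l; case: (odd l) => /=; lia.
  rewrite /A /B /a /b i1' l1' /amplitude /phase/= subr0 addr0 cos0; lra.
have l2 : (1 < l)%N.
  have := odd_double_half l; have := odd_double_half i; rewrite e.
  case: (odd l); case: (odd i) => /=; lia.
rewrite (_ : (l./2 == 0)%N = false); last first.
  have := odd_double_half l; case: (odd l) => /=; lia.
rewrite mul0r add0r /A /B /amplitude leqNgt i2 leqNgt l2/= -expr2 sqr_sqrtr//.
rewrite divff// mul1r /a /b /phase i2 l2/=.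
have -> : (i == l) = (odd i == odd l).
  have := odd_double_half l; have := odd_double_half i; rewrite e.
  case: (odd l); case: (odd i) => /=; lia.
case: (odd i); case: (odd l) => /=; rewrite ?subrr ?subr0 ?sub0r ?opprK ?cosN ?cos0//;
  by rewrite cos_pihalf.
Qed.

(** * Integrals of sums, limits and densities *)

Lemma Rintegral_sum d (T : measurableType d) R (m : {measure set T -> \bar R})
    (D : set T) (I : Type) (s : seq I) (f : I -> T -> R) :
  measurable D -> (forall i, m.-integrable D (EFin \o f i)) ->
  m.-integrable D (fun w => (\sum_(i <- s) f i w)%:E) /\
  \int[m]_(w in D) (\sum_(i <- s) f i w) = \sum_(i <- s) \int[m]_(w in D) f i w.
Proof.
move=> mD fi; elim: s => [|i s [ih1 ih2]].
  under eq_fun do rewrite big_nil; split; first exact: integrable0.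
  under eq_Rintegral do rewrite big_nil.
  by rewrite /Rintegral integral0 big_nil.
split.
  under eq_fun do rewrite big_cons EFinD.
  exact: (integrableD mD (fi i) ih1).
under eq_Rintegral do rewrite big_cons.
by rewrite RintegralD// ih2 big_cons.
Qed.

(** Fatou's lemma, in the form that passes from truncated to full series. *)
Lemma integral_cvg_le d (T : measurableType d) R (m : {measure set T -> \bar R})
    (D : set T) (f_ : nat -> T -> \bar R) (f : T -> \bar R) (b : \bar R) :
  measurable D -> (forall n, measurable_fun D (f_ n)) ->
  (forall n x, D x -> (0 <= f_ n x)%E) ->
  (forall x, D x -> f_ n x @[n --> \oo] --> f x) ->
  (forall n, (\int[m]_(x in D) f_ n x <= b)%E) ->
  (\int[m]_(x in D) f x <= b)%E.
Proof.
move=> mD mf f0 ff fb.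
rewrite (eq_integral (fun x => limn_einf (f_ ^~ x))); last first.
  by move=> x; rewrite inE => Dx; rewrite (cvg_limn_einf_sup (ff x Dx)).1.
apply: (le_trans (fatou m mD mf f0)).
rewrite limn_einf_lim; apply: lime_le; first exact: is_cvg_einfs.
near=> n; apply: (le_trans _ (fb n)).
by rewrite /einfs; apply: ereal_inf_lbound; exists n => /=.
Unshelve. all: by end_near. Qed.

Section density.
Import HBNNSimple.
Context d (T : measurableType d) (R : realType).
Variables (m nu : {measure set T -> \bar R}) (g : T -> R).
Hypotheses (mg : measurable_fun setT g) (g0 : forall x, 0 <= g x).
Hypothesis nuE : forall A, measurable A -> nu A = (\int[m]_(x in A) (g x)%:E)%E.

Let density_nnsfun (f : {nnsfun T >-> R}) :
  (\int[nu]_x (f x)%:E = \int[m]_x ((f x)%:E * (g x)%:E))%E.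
Proof.
have fE x : ((f x)%:E  * (g x)%:E = \sum_(r \in range f)
    (r%:E * ((\1_(f @^-1` [set r]) x)%:E * (g x)%:E)))%E.
  rewrite fimfunE -fsumEFin// ge0_mule_fsuml.
    by apply: eq_fsbigr => r _; rewrite EFinM muleA.
  by move=> r; exact: nnfun_muleindic_ge0.
under [RHS]eq_integral do rewrite fE.
rewrite [RHS]ge0_integral_fsum//; last 2 first.
- move=> r; apply: measurable_funeM; apply: emeasurable_funM => //; exact/measurable_EFinP.
- move=> r x _; rewrite muleA mule_ge0 ?lee_fin//; exact: nnfun_muleindic_ge0.
under [LHS]eq_integral do rewrite fimfunE -fsumEFin//.
rewrite [LHS]ge0_integral_fsum//; last 2 first.
- by move=> r; exact/measurable_EFinP/measurableT_comp.
- by move=> n x _; rewrite EFinM nnfun_muleindic_ge0.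
apply: eq_fsbigr => r _.
under [LHS]eq_integral do rewrite EFinM.
rewrite integralZl_indic_nnsfun//= integral_indic// setIT nuE//.
have [r0|r0] := ltP r 0.
  rewrite preimage_nnfun0// integral_set0 mule0 integral0_eq// => x _.
  by rewrite indicE in_set0 mul0e mule0.
rewrite ge0_integralZl//; last 2 first.
- apply: emeasurable_funM => //; exact/measurable_EFinP.
- by move=> x _; rewrite mule_ge0 ?lee_fin.
congr (_ * _)%E; rewrite integral_mkcond; apply: eq_integral => x _.
by rewrite patchE indicE; case: ifPn => _; rewrite ?mul1e ?mul0e.
Qed.

(** Monotone approximation by simple functions, for which the identity is
    the definition of a density. *)
Lemma ge0_integral_density (f : T -> \bar R) :
  measurable_fun setT f -> (forall x, (0 <= f x)%E) ->
  (\int[nu]_x f x = \int[m]_x (f x * (g x)%:E))%E.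
Proof.
move=> mf f0; pose f_ := nnsfun_approx measurableT mf.
have cf x : (f_ n x)%:E @[n --> \oo] --> f x by exact: cvg_nnsfun_approx.
transitivity (limn (fun n => \int[nu]_x (f_ n x)%:E)%E).
  rewrite -monotone_convergence//=.
  - by apply: eq_integral => x _; apply/esym/cvg_lim.
  - by move=> n; exact/measurable_EFinP.
  - by move=> n x _; rewrite lee_fin.
  - by move=> x _ a b ab; rewrite lee_fin; exact/lefP/nd_nnsfun_approx.
under eq_fun do rewrite density_nnsfun.
rewrite -monotone_convergence//=.
- apply: eq_integral => x _; apply/cvg_lim => //.
  by rewrite muleC; under eq_fun do rewrite muleC; exact: cvgeZl.
- by move=> n; apply: emeasurable_funM => //; exact/measurable_EFinP.
- by move=> n x _; rewrite mule_ge0 ?lee_fin.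
- move=> x _ a b ab; rewrite lee_wpmul2r ?lee_fin//.
  exact/lefP/nd_nnsfun_approx.
Qed.

End density.

(** * Moments of normal laws *)

Section normal_moments.
Variables (R : realType) (m s : R).
Hypothesis s0 : s != 0.
Let f := normal_pdf m s.
Let V x := (x - m) ^+ 2 * f x.

Let mf : measurable_fun setT f. Proof. exact: measurable_normal_pdf. Qed.
Let f0 x : 0 <= f x. Proof. exact: normal_pdf_ge0. Qed.
Let cf : continuous f. Proof. exact: continuous_normal_pdf. Qed.

Lemma ge0_integral_normal_prob (g : R -> \bar R) :
  measurable_fun setT g -> (forall x, (0 <= g x)%E) ->
  (\int[normal_prob m s]_x g x =
   \int[lebesgue_measure]_x (g x * (f x)%:E))%E.
Proof.
exact: (@ge0_integral_density _ _ R lebesgue_measure (normal_prob m s) f mf f0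
  (fun _ _ => erefl)).
Qed.

Let df (x : R) : is_derive x 1 f (- ((x - m) / s ^+ 2) * f x).
Proof.
have -> : f = fun x => normal_peak s * expR (- (x - m) ^+ 2 / (s ^+ 2 *+ 2)).
  by rewrite /f normal_pdfE.
apply: is_derive_eq; rewrite /GRing.scale/=.
set e := expR _; by rewrite -[s ^+ 2 *+ 2]mulr_natl; field.
Qed.

Let F x := - s ^+ 2 * (x - m) * f x.
Let dF (x : R) : is_derive x 1 F (V x - s ^+ 2 * f x).
Proof.
have := df x => d; apply: is_derive_eq.
by rewrite /V /GRing.scale/=; field.
Qed.

Let cV : continuous V.
Proof.
move=> x; apply: cvgM; last exact: cf.
by apply: (@cvgM _ _ _ _ _ (fun y => y - m)); apply: cvgB; (exact: cvg_id || exact: cvg_cst).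
Qed.

Let m_itv (n : nat) : measurable (`[m - n.+1%:R, m + n.+1%:R]%classic : set R).
Proof. exact: measurable_itv. Qed.

(** With [f] the density, [F x = - s ^+ 2 * (x - m) * f x] is a primitive of
    [(x - m) ^+ 2 * f x - s ^+ 2 * f x]. It is nonpositive to the right of
    [m] and nonnegative to the left, so on an interval around [m] the second
    moment is at most [s ^+ 2] times the mass. *)
Lemma normal_second_moment :
  (\int[normal_prob m s]_x ((x - m) ^+ 2)%:E <= (s ^+ 2)%:E)%E.
Proof.
rewrite ge0_integral_normal_prob; last 2 first.
- apply/measurable_EFinP; apply: continuous_measurable_fun => x.
  by apply: (@cvgM _ _ _ _ _ (fun y => y - m)); apply: cvgB; (exact: cvg_id || exact: cvg_cst).
- by move=> x; rewrite lee_fin sqr_ge0.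
under eq_integral do rewrite -EFinM.
pose I n : set R := `[m - n.+1%:R, m + n.+1%:R]%classic.
have mVI n : measurable_fun [set: R] (fun x => ((V \_ (I n)) x)%:E).
  apply/measurable_EFinP; apply/(measurable_restrictT _ (m_itv n)); apply: measurable_funTS.
  exact: continuous_measurable_fun.
apply: (@integral_cvg_le _ _ R lebesgue_measure setT (fun n x => (V \_ (I n) x)%:E)
  (fun x => (V x)%:E)) => //.
- move=> n x _; rewrite lee_fin patchE; case: ifP => // _.
  by rewrite mulr_ge0// sqr_ge0.
- move=> x _; apply: cvg_near_cst; near=> n.
  rewrite patchE mem_set// /I/= in_itv/= -ler_distlC.
  by apply: (@le_trans _ _ n%:R); [near: n; exact: nbhs_infty_ger|rewrite ler_nat].
move=> n; rewrite (_ : (fun x => ((V \_ (I n)) x)%:E) = (EFin \o V) \_ (I n)); last first.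
  by rewrite restrict_EFin.
rewrite -integral_mkcond.
have ab : m - n.+1%:R < m + n.+1%:R :> R by have := ltr0Sn R n; lra.
have ifI : lebesgue_measure.-integrable (I n) (EFin \o f).
  apply: integrableS (integrable_normal_pdf m s) => //; exact: m_itv.
have cD : continuous (fun x => V x - s ^+ 2 * f x).
  by move=> x; apply: cvgB; [exact: cV|apply: cvgM; [exact: cvg_cst|exact: cf]].
have : (\int[lebesgue_measure]_(x in I n) (V x - s ^+ 2 * f x)%:E =
    (F (m + n.+1%:R))%:E - (F (m - n.+1%:R))%:E)%E.
  apply: continuous_FTC2 => //.
  - exact: continuous_subspaceT.
  - split.
    + by move=> x _; have [] := dF x.
    + apply: cvg_at_right_filter; apply: differentiable_continuous.
      by apply/derivable1_diffP; have [] := dF (m - n.+1%:R).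
    + apply: cvg_at_left_filter; apply: differentiable_continuous.
      by apply/derivable1_diffP; have [] := dF (m + n.+1%:R).
  - by move=> x _; rewrite derive1E; have [_ ->] := dF x.
move=> FTC.
have iD : lebesgue_measure.-integrable (I n) (EFin \o (fun x => V x - s ^+ 2 * f x)).
  apply: continuous_compact_integrable; first exact: segment_compact.
  exact: continuous_subspaceT.
have isf : lebesgue_measure.-integrable (I n) (EFin \o (fun x => s ^+ 2 * f x)).
  apply: continuous_compact_integrable; first exact: segment_compact.
  by apply: continuous_subspaceT => x; apply: cvgM; [exact: cvg_cst|exact: cf].
have -> : (\int[lebesgue_measure]_(x in I n) (EFin \o V) x =
    \int[lebesgue_measure]_(x in I n) (V x - s ^+ 2 * f x)%:E +
    \int[lebesgue_measure]_(x in I n) (s ^+ 2 * f x)%:E)%E.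
  have := @integralD_EFin _ _ R lebesgue_measure (I n) (m_itv n) _ _ iD isf.
  move=> <-; congr integral; apply/funext => x /=.
  by rewrite -EFinD subrK.
rewrite FTC.
have i1 : (\int[lebesgue_measure]_(x in I n) (f x)%:E <= 1)%E.
  rewrite -(integral_normal_pdf m s); apply: ge0_subset_integral => //.
  - exact: m_itv.
  - exact/measurable_EFinP.
  - by move=> x _; rewrite lee_fin.
have -> : (\int[lebesgue_measure]_(x in I n) (s ^+ 2 * f x)%:E =
    (s ^+ 2)%:E * \int[lebesgue_measure]_(x in I n) (f x)%:E)%E.
  exact: (@integralZl _ _ _ lebesgue_measure (I n) (m_itv n) _ ifI (s ^+ 2)).
rewrite -[(s ^+ 2)%:E in leRHS]add0e; apply: leeD.
  rewrite -EFinB lee_fin /F (addrC m) addrK (addrC m) addrK.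
  have := f0 (n.+1%:R + m); have := f0 (- n.+1%:R + m); have := sqr_ge0 s.
  have := ltr0Sn R n; set a := f _; set b := f _; set N := n.+1%:R => N0 s20 a0 b0.
  have : 0 <= s ^+ 2 * N * (a + b) by apply: mulr_ge0; [apply: mulr_ge0 => //; exact: ltW|exact: addr_ge0].
  lra.
by rewrite -[leRHS]mule1 lee_wpmul2l ?lee_fin ?sqr_ge0.
Unshelve. all: by end_near. Qed.

Lemma integrable_normal_prob : (normal_prob m s).-integrable setT (@EFin R).
Proof.
have mE : measurable_fun [set: R] (@EFin R) by exact/measurable_EFinP.
have msq : measurable_fun [set: R] (fun x => ((x - m) ^+ 2)%:E).
  apply/measurable_EFinP; apply: continuous_measurable_fun => x.
  by apply: (@cvgM _ _ _ _ _ (fun y => y - m)); apply: cvgB; (exact: cvg_id || exact: cvg_cst).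
apply/integrableP; split => //.
apply: (@le_lt_trans _ _
    (\int[normal_prob m s]_x ((`|m| + 1)%:E + ((x - m) ^+ 2)%:E))%E).
  apply: ge0_le_integral => //.
  - exact: measurableT_comp.
  - by apply: emeasurable_funD => //; exact: measurable_cst.
  - move=> x _; rewrite -EFinD lee_fin.
    have h : `|x| <= `|x - m| + `|m| by rewrite -{1}(subrK m x) ler_normD.
    have -> : (x - m) ^+ 2 = `|x - m| ^+ 2 by rewrite real_normK ?num_real.
    have := normr_ge0 (x - m); have := normr_ge0 m; nra.
rewrite ge0_integralD//; last by move=> x _; rewrite lee_fin sqr_ge0.
rewrite integral_cst//= probability_setT mule1.
by rewrite (le_lt_trans (leeD (lexx _) normal_second_moment))// -EFinD ltry.
Qed.

(** The positive and negative parts have the same integral, by the symmetry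
    of the density. *)
Lemma normal_prob_mean0 : m = 0 -> (\int[normal_prob m s]_x x%:E = 0)%E.
Proof.
move=> m0; rewrite integralE.
have mE : measurable_fun [set: R] (@EFin R) by exact/measurable_EFinP.
rewrite !ge0_integral_normal_prob//; last 2 first.
- exact: measurable_funeneg.
- exact: measurable_funepos.
have fN x : f (- x) = f x.
  by rewrite /f normal_pdfE// m0 /normal_fun !subr0 sqrrN.
pose h x := x * f x.
have ch : continuous h by move=> x; apply: cvgM; [exact: cvg_id|exact: cf].
have pE : (\int[lebesgue_measure]_x (EFin^\+ x * (f x)%:E) =
    \int[lebesgue_measure]_(x in `[0%R, +oo[) (h x)%:E)%E.
  rewrite [RHS]integral_mkcond; apply: eq_integral => x _.
  rewrite patchE mem_setE in_itv/= andbT funeposE -EFin_max -EFinM /h.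
  by case: (lerP 0 x) => x0; rewrite ?mul0r.
rewrite pE.
have -> : (\int[lebesgue_measure]_x (EFin^\- x * (f x)%:E) =
    \int[lebesgue_measure]_(x in `]-oo, (- 0)%R]) (- h x)%:E)%E.
  rewrite oppr0 [RHS]integral_mkcond; apply: eq_integral => x _.
  rewrite patchE mem_setE in_itv/= funenegE -EFinN -EFin_max -EFinM /h.
  have [x0|x0] := ltrP 0 x.
    by rewrite max_r ?mul0r// oppr_le0 ltW.
  by rewrite max_l ?mulNr// oppr_ge0.
rewrite ge0_integration_by_substitutionNy; last 2 first.
- by apply: continuous_subspaceT => x; apply: cvgN; exact: ch.
- move=> x; rewrite in_itv/= oppr0 => x0.
  by rewrite oppr_ge0 /h mulr_le0_ge0// ltW.
rewrite (_ : (fun x => (((\- h) \o -%R) x)%:E) = (fun x => (h x)%:E)); last first.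
  by apply/funext => x /=; rewrite /h fN mulNr opprK.
rewrite subee//.
have := integrable_pos_fin_num measurableT integrable_normal_prob.
by rewrite ge0_integral_normal_prob//; [rewrite pE|exact: measurable_funepos].
Qed.

End normal_moments.

Lemma ge0_integral_law d (T : measurableType d) R (P : {measure set T -> \bar R})
    (X : T -> R) (nu : {measure set (measurableTypeR R) -> \bar R})
    (f : R -> \bar R) :
  measurable_fun setT X ->
  (forall A : set R, measurable A -> P (X @^-1` A) = nu A) ->
  measurable_fun [set: R] f -> (forall x, (0 <= f x)%E) ->
  (\int[P]_w f (X w) = \int[nu]_x f x)%E.
Proof.
move=> mX XE mf f0.
pose X' : {mfun T >-> measurableTypeR R} := HB.pack (X : T -> measurableTypeR R)
  (isMeasurableFun.Build _ _ _ _ (X : T -> measurableTypeR R) mX).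
transitivity (\int[pushforward P X']_x f x)%E.
  by rewrite [RHS]ge0_integral_pushforward//; exact: mX.
by apply: eq_measure_integral => A mA _; exact: XE.
Qed.

Lemma integral_law d (T : measurableType d) R (P : {measure set T -> \bar R})
    (X : T -> R) (nu : {measure set (measurableTypeR R) -> \bar R})
    (f : R -> \bar R) :
  measurable_fun setT X ->
  (forall A : set R, measurable A -> P (X @^-1` A) = nu A) ->
  measurable_fun [set: R] f ->
  (\int[P]_w f (X w) = \int[nu]_x f x)%E.
Proof.
move=> mX XE mf; rewrite integralE [RHS]integralE.
rewrite -(ge0_integral_law mX XE (measurable_funepos mf))//.
rewrite -(ge0_integral_law mX XE (measurable_funeneg mf))//.
by congr (_ - _)%E; apply: eq_integral => w _; rewrite ?funeposE ?funenegE.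
Qed.

Lemma integrable_law d (T : measurableType d) R (P : {measure set T -> \bar R})
    (X : T -> R) (nu : {measure set (measurableTypeR R) -> \bar R})
    (f : R -> \bar R) :
  measurable_fun setT X ->
  (forall A : set R, measurable A -> P (X @^-1` A) = nu A) ->
  nu.-integrable setT f -> P.-integrable setT (f \o X).
Proof.
move=> mX XE /integrableP[mf foo]; apply/integrableP; split.
  exact: measurableT_comp.
rewrite (ge0_integral_law (f := fun x => `|f x|%E) mX XE)//.
exact: measurableT_comp.
Qed.

(** Centre at the mean, with [(x - a)^2 <= 2 (x - m)^2 + 2 (m - a)^2]; the
    second moment about the mean is at most [v] for the point mass and the
    nondegenerate law alike. *)
Lemma normal_law_second_moment d (T : measurableType d) R (P : probability T R)
    (X : T -> R) (m v a : R) : 0 <= v -> measurable_fun setT X ->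
  (forall A, measurable A -> P (X @^-1` A) = normal_law m v A) ->
  (\int[P]_w ((X w - a) ^+ 2)%:E <= (2 * (v + (m - a) ^+ 2))%:E)%E.
Proof.
move=> v0 mX' XE.
have msq c : measurable_fun [set: R] (fun x => ((x - c) ^+ 2)%:E).
  apply/measurable_EFinP; apply: continuous_measurable_fun => x.
  by apply: (@cvgM _ _ _ _ _ (fun y => y - c)); apply: cvgB; (exact: cvg_id || exact: cvg_cst).
have mX c : measurable_fun [set: T] (fun w => ((X w - c) ^+ 2)%:E).
  exact: (measurableT_comp (msq c)).
have vm : (\int[P]_w ((X w - m) ^+ 2)%:E <= v%:E)%E.
  have [v00|vn0] := eqVneq v 0.
    rewrite (ge0_integral_law (X := X) (nu := dirac (m : measurableTypeR R)) (f := fun x => ((x - m) ^+ 2)%:E))//.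
    - have -> := @integral_dirac _ (measurableTypeR R) m R setT measurableT _ (msq m).
      by rewrite diracT mul1e subrr expr0n/= lee_fin.
    - by move=> A mA; transitivity (normal_law m v A); [exact: XE|rewrite /normal_law v00 eqxx].
    - by move=> x; rewrite lee_fin sqr_ge0.
  rewrite (ge0_integral_law (X := X) (nu := normal_prob m (Num.sqrt v))
    (f := fun x => ((x - m) ^+ 2)%:E))//.
  - have sv0 : Num.sqrt v != 0 by rewrite gt_eqF// sqrtr_gt0 lt_neqAle eq_sym vn0.
    by rewrite (le_trans (normal_second_moment m sv0))// sqr_sqrtr.
  - by move=> A mA; transitivity (normal_law m v A); [exact: XE|rewrite /normal_law (negbTE vn0)].
  - by move=> x; rewrite lee_fin sqr_ge0.
apply: (@le_trans _ _ (\int[P]_w (2%:E * ((X w - m) ^+ 2)%:E + (2 * (m - a) ^+ 2)%:E))%E).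
  apply: ge0_le_integral => //.
  - by move=> x _; rewrite lee_fin sqr_ge0.
  - by apply: emeasurable_funD; [exact: measurable_funeM|exact: measurable_cst].
  - move=> x _; rewrite -EFinM -EFinD lee_fin.
    have := sqr_ge0 ((X x - m) - (m - a)); nra.
rewrite ge0_integralD//; last 3 first.
- by move=> x _; rewrite -EFinM lee_fin mulr_ge0// sqr_ge0.
- exact: measurable_funeM.
- by move=> x _; rewrite lee_fin mulr_ge0// sqr_ge0.
rewrite ge0_integralZl//; last by move=> x _; rewrite lee_fin sqr_ge0.
rewrite integral_cst//= probability_setT mule1 mulrDr [leRHS]EFinD.
by apply: leeD => //; rewrite [leRHS]EFinM lee_wpmul2l// lee_fin.
Qed.

(** * Independent sigma-algebras *)

(** Intersecting with [B] and multiplying by [P B] define two measures that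
    agree on a pi-system, hence on the sigma-algebra that it generates. *)
Lemma independent_sigma_algebra d (T : measurableType d) R (P : probability T R)
    (G : set (set T)) (B A : set T) :
  measurable B -> G `<=` measurable -> setI_closed G ->
  (forall A, G A -> P (A `&` B) = (P A * P B)%E) ->
  <<s G>> A -> P (A `&` B) = (P A * P B)%E.
Proof.
move=> mB mG GI GE GA.
pose m1 : {measure set T -> \bar R} := mrestr P mB.
have PB : P B \is a fin_num by exact: fin_num_measure.
have PB0 : 0 <= fine (P B) by exact: fine_ge0.
pose m2 : {measure set T -> \bar R} := mscale (NngNum PB0) P.
have m2E C : m2 C = (P C * P B)%E by rewrite /m2 /= /mscale/= fineK// muleC.
have GT : [set X | G X /\ X `<=` [set: T]] = G.
  by apply/seteqP; split => [X []//|X GX]; split.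
rewrite -m2E; change (m1 A = m2 A).
apply: (@g_sigma_algebra_measure_unique_trace d R T G setT measurableT) => //.
- by rewrite GT.
- by rewrite GT.
- by rewrite m2E /m1 /= /mrestr setTI probability_setT mul1e.
- by move=> C; rewrite GT => GC; rewrite m2E /m1 /= /mrestr GE.
- by rewrite /m1 /= /mrestr setTI ltey_eq PB.
- by rewrite GT.
Qed.

Lemma independent_sigma_algebras d (T : measurableType d) R (P : probability T R)
    (G H : set (set T)) (A B : set T) :
  G `<=` measurable -> setI_closed G -> H `<=` measurable -> setI_closed H ->
  (forall A B, G A -> H B -> P (A `&` B) = (P A * P B)%E) ->
  <<s G>> A -> <<s H>> B -> P (A `&` B) = (P A * P B)%E.
Proof.
move=> mG GI mH HI GH GA HB.
have mA : measurable A.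
  by move: A GA; apply: smallest_sub => //; exact: sigma_algebra_measurable.
rewrite setIC muleC; apply: (independent_sigma_algebra mA mH HI) HB => C HC.
rewrite setIC muleC; apply: (independent_sigma_algebra _ mG GI) GA => //.
  exact: mH.
by move=> D GD; exact: GH.
Qed.

(** By independence the joint law is the product of the marginals, and
    Fubini's theorem splits the integral. *)
Lemma independent_pair_integral d d1 d2 (T : measurableType d)
    (T1 : measurableType d1) (T2 : measurableType d2) R (P : probability T R)
    (U : T -> T1) (V : T -> T2) (f : T1 -> R) (g : T2 -> R) :
  measurable_fun setT U -> measurable_fun setT V ->
  independent_pair P U V ->
  measurable_fun setT f -> measurable_fun setT g ->
  P.-integrable setT (EFin \o (f \o U)) -> P.-integrable setT (EFin \o (g \o V)) ->
  P.-integrable setT (fun w => (f (U w) * g (V w))%:E) /\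
  \int[P]_w (f (U w) * g (V w)) =
    (\int[P]_w f (U w)) * (\int[P]_w g (V w)).
Proof.
move=> mU mV UV mf mg ifU igV.
pose U' : {mfun T >-> T1} := HB.pack U (isMeasurableFun.Build _ _ _ _ U mU).
pose V' : {mfun T >-> T2} := HB.pack V (isMeasurableFun.Build _ _ _ _ V mV).
have mUV : measurable_fun setT (fun w => (U w, V w)) by exact: measurable_fun_pair.
pose W : {mfun T >-> (T1 * T2)%type} :=
  HB.pack (fun w => (U w, V w)) (isMeasurableFun.Build _ _ _ _ _ mUV).
pose m1 := distribution P U'; pose m2 := distribution P V'.
have WE : forall X : set (T1 * T2), measurable X ->
    (m1 \x m2)%E X = distribution P W X.
  by apply: product_measure_unique => A B mA mB; exact: UV.
pose h (z : T1 * T2) := f z.1 * g z.2.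
have mh : measurable_fun setT h.
  apply: measurable_funM.
    by apply: measurableT_comp => //; exact: measurable_fst.
  by apply: measurableT_comp => //; exact: measurable_snd.
have mEh : measurable_fun setT (EFin \o h) by exact/measurable_EFinP.
have if1 : m1.-integrable setT (EFin \o f).
  apply/integrableP; split; first exact/measurable_EFinP.
  rewrite ge0_integral_distribution//; last by do 2 apply: measurableT_comp => //.
  by have /integrableP[] := ifU.
have ig2 : m2.-integrable setT (EFin \o g).
  apply/integrableP; split; first exact/measurable_EFinP.
  rewrite ge0_integral_distribution//; last by do 2 apply: measurableT_comp => //.
  by have /integrableP[] := igV.
have ih : (m1 \x m2)%E.-integrable setT (EFin \o h).
  apply/(integrable12ltyP _ _ mEh); rewrite /= /h.
  have mag : measurable_fun setT (fun y => `|(g y)%:E|%E).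
    by apply: measurableT_comp => //; exact/measurable_EFinP.
  have maf : measurable_fun setT (fun y => `|(f y)%:E|%E).
    by apply: measurableT_comp => //; exact/measurable_EFinP.
  have /integrableP[_ foo] := if1; have /integrableP[_ goo] := ig2.
  rewrite (_ : (fun x => _) = (fun x =>
      `|(f x)%:E| * \int[m2]_y `|(g y)%:E|)%E); last first.
    apply/funext => x; rewrite -ge0_integralZl//.
    by apply: eq_integral => y _; rewrite normrM EFinM.
  rewrite ge0_integralZr//; last exact: integral_ge0.
  by rewrite lte_mul_pinfty// ?integral_ge0// ge0_fin_numE ?integral_ge0.
have hW : (EFin \o h) \o W = (fun w => (f (U w) * g (V w))%:E) by [].
have ihW : (distribution P W).-integrable setT (EFin \o h).
  apply/integrableP; split => //.
  rewrite (eq_measure_integral (m1 \x m2)%E); last by move=> A mA _; exact/esym/WE.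
  by have /integrableP[] := ih.
have iP : P.-integrable setT (fun w => (f (U w) * g (V w))%:E).
  apply/integrableP; split; first by rewrite -hW; exact: measurableT_comp.
  have /integrableP[_] := ihW; rewrite ge0_integral_distribution//.
  exact: measurableT_comp.
split => //; rewrite /Rintegral.
have e1 : (\int[P]_w (f (U w))%:E = \int[m1]_x (f x)%:E)%E.
  exact/esym/(integral_distribution (X := U') (measurable_int m1 if1) ifU).
have e2 : (\int[P]_w (g (V w))%:E = \int[m2]_x (g x)%:E)%E.
  exact/esym/(integral_distribution (X := V') (measurable_int m2 ig2) igV).
have e3 : (\int[P]_w (f (U w) * g (V w))%:E = \int[(m1 \x m2)%E]_z (h z)%:E)%E.
  transitivity (\int[distribution P W]_z (h z)%:E)%E.
    exact/esym/(integral_distribution (X := W) mEh iP).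
  by apply: eq_measure_integral => A mA _; exact/esym/WE.
rewrite e1 e2 e3 -(integral12_prod_meas1 ih) /fubini_F.
have f2 : (\int[m2]_y (g y)%:E)%E \is a fin_num by exact: (integrable_fin_num _ ig2).
have f1 : (\int[m1]_y (f y)%:E)%E \is a fin_num by exact: (integrable_fin_num _ if1).
rewrite -fineM//; congr fine.
transitivity (\int[m1]_x ((f x)%:E * \int[m2]_y (g y)%:E))%E.
  apply: eq_integral => x _.
  by rewrite -[RHS](integralZl measurableT ig2).
by rewrite -(fineK f2) integralZr.
Qed.

(** * Independence of design and noise *)

(** The rectangles in the first [n] variables: a pi-system that generates
    their sigma-algebra. *)
Definition cylinder d (T : measurableType d) R (U : nat -> T -> R) (n : nat) :
    set (set T) :=
  [set A | exists2 B : nat -> set R, (forall i, measurable (B i)) &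
    A = \bigcap_(i in [set` iota 0 n]) (U i @^-1` B i)].

Lemma cylinder_setI d (T : measurableType d) R (U : nat -> T -> R) n :
  setI_closed (cylinder U n).
Proof.
move=> _ _ [B mB ->] [C mC ->]; exists (fun i => B i `&` C i).
  by move=> i; exact: measurableI.
by rewrite -bigcapI; apply: eq_bigcapr => i _; rewrite preimage_setI.
Qed.

Lemma cylinder_measurable d (T : measurableType d) R (U : nat -> T -> R) n :
  (forall i, measurable_fun setT (U i)) -> cylinder U n `<=` measurable.
Proof.
move=> mU _ [B mB ->]; rewrite bigcap_seq; apply: bigsetI_measurable => i _.
by rewrite -[_ @^-1` _]setTI; exact: mU.
Qed.

(** The sample space with the sigma-algebra of the first [n] variables. A
    function measurable on it depends on these variables only. *)
Definition cylinderType d (T : measurableType d) R (U : nat -> T -> R) n :=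
  g_sigma_algebraType (cylinder U n).

Lemma measurable_cylinder_proj d (T : measurableType d) R (U : nat -> T -> R) n i :
  (i < n)%N -> measurable_fun setT (U i : cylinderType U n -> R).
Proof.
move=> ni _ B mB; apply: sub_sigma_algebra; rewrite setTI.
exists (fun j => if j == i then B else setT).
  by move=> j; case: ifP.
apply/seteqP; split => [w /= Bw j _ /=|w /= /(_ i)].
  by case: eqP => // ->.
by rewrite eqxx; apply; rewrite /= mem_iota.
Qed.

Lemma measurable_cylinder_id d (T : measurableType d) R (U : nat -> T -> R) n :
  (forall i, measurable_fun setT (U i)) ->
  measurable_fun setT (id : T -> cylinderType U n).
Proof.
move=> mU _ B mB; rewrite setTI preimage_id.
by move: B mB; apply: smallest_sub; [exact: sigma_algebra_measurable|exact: (cylinder_measurable mU)].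
Qed.

Section regression.
Context d (T : measurableType d) (R : realType) (P : probability T R).
Variables (sigma : R) (X eps : nat -> {RV P >-> R}).
Hypothesis s0 : 0 < sigma.
Hypothesis model : regression_model sigma X eps.

Let mX i : measurable_fun setT (X i : T -> R). Proof. exact: measurable_funP. Qed.
Let me i : measurable_fun setT (eps i : T -> R). Proof. exact: measurable_funP. Qed.

(** Independence across the pairs, followed by independence within each
    pair. *)
Lemma rectangle_prob (J : seq nat) (A B : nat -> set R) : uniq J ->
  (forall i, measurable (A i)) -> (forall i, measurable (B i)) ->
  P (\bigcap_(i in [set` J]) (X i @^-1` A i) `&` \bigcap_(i in [set` J]) (eps i @^-1` B i)) =
  ((\prod_(i <- J) P (X i @^-1` A i)) * (\prod_(i <- J) P (eps i @^-1` B i)))%E.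
Proof.
move=> uJ mA mB; rewrite -big_split/=.
have := observations_independent model (B := fun i => A i `*` B i) uJ.
move=> h.
have -> : \bigcap_(i in [set` J]) (X i @^-1` A i) `&`
    \bigcap_(i in [set` J]) (eps i @^-1` B i) =
  \bigcap_(i in [set` J]) ((fun w => (X i w, eps i w)) @^-1` (A i `*` B i)).
  by rewrite -bigcapI; apply: eq_bigcapr.
rewrite h; last by move=> i; exact: measurableX.
apply: eq_bigr => i _.
exact: (design_noise_independent model).
Qed.

Lemma noise_design_independent n (A B : set T) :
  <<s cylinder X n>> A -> <<s cylinder eps n>> B -> P (A `&` B) = (P A * P B)%E.
Proof.
apply: independent_sigma_algebras.
- exact: cylinder_measurable.
- exact: cylinder_setI.
- exact: cylinder_measurable.
- exact: cylinder_setI.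
move=> {}A {}B [A' mA ->] [B' mB ->].
have uJ : uniq (iota 0 n) by exact: iota_uniq.
rewrite rectangle_prob//; congr (_ * _)%E.
- have := rectangle_prob uJ mA (B := fun=> setT) (fun=> measurableT).
  rewrite [X in _ `&` X](_ : _ = setT) ?setIT; last first.
    by apply/seteqP; split.
  move=> ->; rewrite [X in (_ * X)%E]big1 ?mule1// => i _.
  by rewrite preimage_setT probability_setT.
- have := rectangle_prob uJ (A := fun=> setT) (fun=> measurableT) mB.
  rewrite [X in X `&` _](_ : _ = setT) ?setTI; last first.
    by apply/seteqP; split.
  move=> ->; rewrite [X in (X * _)%E]big1 ?mul1e// => i _.
  by rewrite preimage_setT probability_setT.
Qed.

Lemma design_pairwise_independent i j : i != j -> independent_pair P (X i) (X j).
Proof.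
move=> ij A B mA mB.
have uJ : uniq [:: i; j] by rewrite /= inE ij.
have := rectangle_prob uJ (A := fun l => if l == i then A else B)
  (B := fun=> setT) _ (fun=> measurableT).
have -> : \bigcap_(l in [set` [:: i; j]]) (eps l @^-1` setT) = setT.
  by apply/seteqP; split.
rewrite setIT bigcap_seq !big_cons !big_nil eqxx eq_sym (negbTE ij).
rewrite !preimage_setT probability_setT !mule1 setIT; apply.
by move=> l; case: ifP.
Qed.

Lemma noise_pairwise_independent i j : i != j -> independent_pair P (eps i) (eps j).
Proof.
move=> ij A B mA mB.
have uJ : uniq [:: i; j] by rewrite /= inE ij.
have := rectangle_prob uJ (B := fun l => if l == i then A else B)
  (A := fun=> setT) (fun=> measurableT).
have -> : \bigcap_(l in [set` [:: i; j]]) (X l @^-1` setT) = setT.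
  by apply/seteqP; split.
rewrite setTI bigcap_seq !big_cons !big_nil eqxx eq_sym (negbTE ij).
rewrite !preimage_setT probability_setT !mule1 !mul1e setIT; apply.
by move=> l; case: ifP.
Qed.

(** * Second moments of noise sums and design averages *)

Lemma noise_integrable i : P.-integrable setT (EFin \o eps i).
Proof.
apply: (integrable_law (nu := normal_prob 0 sigma) (f := @EFin R)) => //.
- exact: (noise_normal model).
- by apply: integrable_normal_prob; rewrite gt_eqF.
Qed.

Lemma noise_mean i : \int[P]_w eps i w = 0.
Proof.
rewrite /Rintegral (integral_law (P := P) (X := eps i) (nu := normal_prob 0 sigma)
  (f := @EFin R))//.
- by rewrite normal_prob_mean0// gt_eqF.
- exact: (noise_normal model).
Qed.

Let sqr_noise_le i : (\int[P]_w (eps i w * eps i w)%:E <= (sigma ^+ 2)%:E)%E.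
Proof.
have msq : measurable_fun [set: R] (fun x => (x * x)%:E).
  by apply/measurable_EFinP; exact: measurable_funM.
rewrite (ge0_integral_law (P := P) (X := eps i) (nu := normal_prob 0 sigma)
  (f := fun x => (x * x)%:E))//.
- have := @normal_second_moment R 0 sigma; rewrite gt_eqF// => /(_ isT).
  by under eq_integral do rewrite subr0 expr2.
- exact: (noise_normal model).
- by move=> x; rewrite lee_fin -expr2 sqr_ge0.
Qed.

Let sqr_noise_integrable i : P.-integrable setT (fun w => (eps i w * eps i w)%:E).
Proof.
apply/integrableP; split.
  by apply/measurable_EFinP; exact: measurable_funM.
under eq_integral do rewrite gee0_abs ?lee_fin -?expr2 ?sqr_ge0// expr2.
by rewrite (le_lt_trans (sqr_noise_le i))// ltry.
Qed.

Lemma noise_variance i : \int[P]_w (eps i w * eps i w) <= sigma ^+ 2.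
Proof.
rewrite -lee_fin /Rintegral fineK//.
exact: (integrable_fin_num _ (sqr_noise_integrable i)).
Qed.

Lemma noise_product i j :
  P.-integrable setT (fun w => (eps i w * eps j w)%:E) /\
  (i != j -> \int[P]_w (eps i w * eps j w) = 0).
Proof.
have [<-//|ij] := eqVneq i j.
have [h1 h2] := independent_pair_integral (me i) (me j)
  (noise_pairwise_independent ij) (@measurable_id _ _ setT) (@measurable_id _ _ setT)
  (noise_integrable i) (noise_integrable j).
by split => // _; rewrite h2 noise_mean mul0r.
Qed.

Lemma independent_design_noise_product n (i j : 'I_n) :
  independent_pair P (id : T -> cylinderType X n) (fun w => eps i w * eps j w).
Proof.
move=> A B mA mB; rewrite preimage_id; apply: (@noise_design_independent n) => //.
have mij : measurable_fun setT (fun w : cylinderType eps n => eps i w * eps j w).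
  by apply: measurable_funM; exact: measurable_cylinder_proj.
by have := mij measurableT B mB; rewrite setTI.
Qed.

Lemma integral_Rintegral (f : T -> R) : P.-integrable setT (EFin \o f) ->
  (\int[P]_w (f w)%:E)%E = (\int[P]_w f w)%:E.
Proof. by move=> fi; rewrite /Rintegral fineK//; exact: (integrable_fin_num _ fi). Qed.

Lemma bounded_measurable_integrable (f : T -> R) :
  bounded_measurable f -> P.-integrable setT (EFin \o f).
Proof.
move=> [mf [B fB]]; apply: measurable_bounded_integrable => //.
  by rewrite ltey_eq fin_num_measure.
by exists B; split; [exact: num_real|move=> x Bx y _ /=; rewrite (le_trans (fB y))// ltW].
Qed.

(** Expand the square. The products [g i * g j] are functions of the design,
    hence independent of [eps i * eps j], whose mean vanishes off the
    diagonal. *)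
Lemma noise_combination_le n (g : 'I_n -> T -> R) :
  (forall i, measurable_fun setT (g i : cylinderType X n -> R)) ->
  (forall i, exists B : R, forall w, `|g i w| <= B) ->
  (\int[P]_w ((\sum_i g i w * eps i w) ^+ 2)%:E <=
   (sigma ^+ 2 * \int[P]_w (\sum_i g i w ^+ 2))%:E)%E.
Proof.
move=> mg bg.
have bg' i : bounded_measurable (g i).
  split => //; have mid := @measurable_cylinder_id _ _ _ X n mX.
  exact: (measurableT_comp (mg i) mid).
have bgg i j : bounded_measurable (fun w => g i w * g j w).
  exact: bounded_measurableM.
have ggee i j : P.-integrable setT (fun w => ((g i w * g j w) * (eps i w * eps j w))%:E) /\
    \int[P]_w ((g i w * g j w) * (eps i w * eps j w)) =
    \int[P]_w (g i w * g j w) * \int[P]_w (eps i w * eps j w).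
  have [eei _] := noise_product i j.
  have mgg : measurable_fun setT (fun w : cylinderType X n => g i w * g j w).
    exact: measurable_funM.
  have mee : measurable_fun setT (fun w : T => eps i w * eps j w).
    exact: measurable_funM.
  exact: (independent_pair_integral (@measurable_cylinder_id _ _ _ X n mX) mee
    (independent_design_noise_product i j) mgg (@measurable_id _ _ setT)
    (bounded_measurable_integrable (bgg i j)) eei).
have sumE w : (\sum_i g i w * eps i w) ^+ 2 =
    \sum_i \sum_j (g i w * g j w) * (eps i w * eps j w).
  rewrite expr2 mulr_suml; apply: eq_bigr => i _; rewrite mulr_sumr.
  by apply: eq_bigr => j _; rewrite mulrACA.
have hi i := Rintegral_sum (index_enum 'I_n) measurableT (fun j => (ggee i j).1).
have [h1 h2] := Rintegral_sum (index_enum 'I_n) measurableT (fun i => (hi i).1).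
under eq_integral do rewrite sumE.
rewrite (integral_Rintegral h1) lee_fin h2.
have [g1 g2] := Rintegral_sum (index_enum 'I_n) measurableT
  (fun i => bounded_measurable_integrable (bgg i i)).
under [X in _ <= _ * X]eq_Rintegral do under eq_bigr do rewrite expr2.
rewrite g2 mulr_sumr; apply: ler_sum => i _; rewrite (hi i).2 (bigD1 i)//=.
rewrite [X in _ + X]big1 ?addr0; last first.
  move=> j ji; rewrite (ggee i j).2 (noise_product i j).2 ?mulr0//.
  by rewrite eq_sym.
rewrite (ggee i i).2 mulrC ler_wpM2r ?noise_variance//.
by apply: Rintegral_ge0 => w _; rewrite -expr2 sqr_ge0.
Qed.

Lemma design_integral i (h : R -> R) : measurable_fun [set: R] h ->
  (\int[P]_w (h (X i w))%:E = \int[lebesgue_measure]_(x in `[0%R, 1%R]) (h x)%:E)%E.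
Proof.
move=> mh; have mEh : measurable_fun [set: R] (EFin \o h) by exact/measurable_EFinP.
rewrite (integral_law (P := P) (X := X i) (nu := uniform_prob (@ltr01 R))
  (f := EFin \o h))//; last exact: (design_uniform model).
rewrite integralE [RHS]integralE !integral_uniform//.
- by rewrite subr0 invr1 !mul1e.
- exact: measurable_funeneg.
- exact: measurable_funepos.
Qed.

(** Expand the square: the off-diagonal terms factor into squares of the
    mean, and the [n] diagonal terms give the error of order 1/n. *)
Lemma design_mean_square n (h : R -> R) : (0 < n)%N -> bounded_measurable h ->
  (\int[P]_w ((n%:R^-1 * \sum_(i < n) h (X i w)) ^+ 2)%:E <=
   ((\int[lebesgue_measure]_(x in `[0, 1]) h x) ^+ 2 +
    (\int[lebesgue_measure]_(x in `[0, 1]) (h x ^+ 2)) / n%:R)%:E)%E.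
Proof.
move=> n0 bh; have [mh _] := bh.
set a := (X in X ^+ 2 + _); set b := (X in X / _).
have hX i : bounded_measurable (fun w => h (X i w)).
  split; first exact: measurableT_comp.
  by have [_ [B hB]] := bh; exists B.
have hint i : P.-integrable setT (EFin \o (fun w => h (X i w))).
  exact: bounded_measurable_integrable.
have hh i j : P.-integrable setT (EFin \o (fun w => h (X i w) * h (X j w))).
  exact/bounded_measurable_integrable/bounded_measurableM.
have Ea i : \int[P]_w h (X i w) = a by rewrite /Rintegral design_integral.
have Eb i : \int[P]_w (h (X i w) * h (X i w)) = b.
  rewrite /Rintegral (@design_integral i (fun x => h x * h x)); last exact: measurable_funM.
  by under eq_integral do rewrite -expr2.
have b0 : 0 <= b by apply: Rintegral_ge0 => x _; exact: sqr_ge0.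
have Eab (i j : 'I_n) : \int[P]_w (h (X i w) * h (X j w)) <= (i == j)%:R * b + a ^+ 2.
  have [<-|ij] := eqVneq i j; first by rewrite Eb mul1r lerDl sqr_ge0.
  rewrite mul0r add0r.
  have [_ ->] := independent_pair_integral (mX i) (mX j)
    (@design_pairwise_independent i j ij) mh mh (hint i) (hint j).
  by rewrite !Ea expr2.
have sumE w : (n%:R^-1 * \sum_(i < n) h (X i w)) ^+ 2 =
    n%:R^-1 ^+ 2 * \sum_(i < n) \sum_(j < n) (h (X i w) * h (X j w)).
  rewrite exprMn; congr (_ * _); rewrite expr2 mulr_suml.
  by apply: eq_bigr => i _; rewrite mulr_sumr.
have hi (i : 'I_n) := Rintegral_sum (index_enum 'I_n) measurableT (fun j => hh i j).
have [h1 h2] := Rintegral_sum (index_enum 'I_n) measurableT (fun i => (hi i).1).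
under eq_integral do rewrite sumE EFinM.
rewrite integralZl// (integral_Rintegral h1) h2 -EFinM lee_fin.
have nn : n%:R != 0 :> R by rewrite pnatr_eq0 -lt0n.
have -> : a ^+ 2 + b / n%:R = n%:R^-1 ^+ 2 * (n%:R * b + n%:R * (n%:R * a ^+ 2)).
  by field.
apply: ler_wpM2l; first exact: sqr_ge0.
apply: (@le_trans _ _ (\sum_(i < n) \sum_(j < n) ((i == j)%:R * b + a ^+ 2))).
  by apply: ler_sum => i _; rewrite (hi i).2; apply: ler_sum => j _; exact: Eab.
rewrite le_eqVlt; apply/orP; left; apply/eqP.
under eq_bigr do rewrite big_split/= sumr_const card_ord.
rewrite big_split/= sumr_const card_ord !mulr_natl; congr (_ + _).
rewrite (eq_bigr (fun=> b)); first by rewrite sumr_const card_ord.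
move=> i _; rewrite (bigD1 i)//= eqxx mul1r big1 ?addr0// => j ji.
by rewrite eq_sym (negbTE ji) mul0r.
Qed.

End regression.

(** * Bias *)

Lemma cvgn_ge_le R (u v : nat -> R) (l l' : R) :
  u n @[n --> \oo] --> l -> v n @[n --> \oo] --> l' ->
  (forall n, u n <= v n) -> l <= l'.
Proof.
move=> ul vl uv; rewrite -subr_le0; apply: (cvgn_le (cvgB ul vl)) => n.
by rewrite subr_le0; exact: uv.
Qed.

(** The sum of [(m l * r l - z * a l) ^+ 2 / m l] is nonnegative; the best
    [z] is the left-hand sum over [H]. *)
Lemma sum_cauchy_schwarz R (s : seq nat) (a m r : nat -> R) (H : R) :
  0 < H -> (forall l, l \in s -> 0 < m l) ->
  \sum_(l <- s) a l ^+ 2 / m l <= H ->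
  (\sum_(l <- s) a l * r l) ^+ 2 <= H * \sum_(l <- s) m l * r l ^+ 2.
Proof.
move=> H0 m0 aH; set S := \sum_(l <- s) a l * r l; set V := \sum_(l <- s) m l * _.
pose z := S / H.
have h : 0 <= V - 2 * z * S + z ^+ 2 * (\sum_(l <- s) a l ^+ 2 / m l).
  rewrite /V /S !mulr_sumr -sumrB -big_split/= big_seq; apply: sumr_ge0 => l ls.
  have ml := m0 _ ls; have mn : m l != 0 by rewrite gt_eqF.
  have -> : m l * r l ^+ 2 - 2 * z * (a l * r l) + z ^+ 2 * (a l ^+ 2 / m l) =
      (m l * r l - z * a l) ^+ 2 / m l by field.
  by rewrite divr_ge0 ?sqr_ge0// ltW.
have := ler_wpM2l (sqr_ge0 z) aH => h2.
have : 0 <= V - 2 * z * S + z ^+ 2 * H by lra.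
have Hn : H != 0 by rewrite gt_eqF.
have -> : V - 2 * z * S + z ^+ 2 * H = (H * V - S ^+ 2) / H by rewrite /z; field.
by rewrite ler_pdivlMr// mul0r subr_ge0.
Qed.

Lemma energy_lim_cvg R (g : R) (mu : nat -> R) k n (x c : 'cV[R]_n) t :
  0 < g -> exp_decay g mu ->
  (\sum_(1 <= l < N) mu l * residual k x c t l ^+ 2) @[N --> \oo] -->
  limn (fun N => \sum_(1 <= l < N) mu l * residual k x c t l ^+ 2).
Proof.
move=> g0 mug; have h := @residual_cvg _ _ _ k _ x c t g0 mug.
by rewrite (cvg_lim (@Rhausdorff R) h).
Qed.

Lemma energy_ge R (g : R) (mu : nat -> R) k n (r : R) (x c : 'cV[R]_n) t :
  0 < g -> exp_decay g mu -> (forall i, (1 <= i)%N -> 0 < mu i) ->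
  r * \sum_j c j 0 ^+ 2 <= energy mu k r x c t.
Proof.
move=> g0 mug mu0; rewrite /energy lerDr -oppr_le0.
apply: (cvgn_le (cvgN (@energy_lim_cvg _ _ _ k _ x c t g0 mug))) => N.
rewrite oppr_le0 big_nat; apply: sumr_ge0 => l /andP[l1 _].
by rewrite mulr_ge0 ?sqr_ge0// ltW// mu0.
Qed.

(** The bias pairs the coefficients [a] with the residuals. Here [H] bounds
    the squared RKHS norm of the function with coefficients [a], and
    Cauchy-Schwarz applies with the weights [mu]. *)
Lemma bias_le_energy R (g h : R) (mu a : nat -> R) (H : R) k n (r : R)
    (x c : 'cV[R]_n) t :
  0 < g -> exp_decay g mu -> (forall i, (1 <= i)%N -> 0 < mu i) ->
  0 < h -> exp_decay h a -> 0 < H ->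
  (forall N, \sum_(1 <= l < N) a l ^+ 2 / mu l <= H) -> 0 <= r ->
  (tseries a k t - \sum_j c j 0 * tseries a 0 (x j 0)) ^+ 2 <=
  H * energy mu k r x c t.
Proof.
move=> g0 mug mu0 h0 ah H0 aH r0.
have cv : (\sum_(1 <= l < N) a l * residual k x c t l) @[N --> \oo] -->
    tseries a k t - \sum_j c j 0 * tseries a 0 (x j 0).
  have c1 : (\sum_j c j 0 * \sum_(1 <= l < N) a l * dfourier 0 l (x j 0))
      @[N --> \oo] --> \sum_j c j 0 * tseries a 0 (x j 0).
    apply: (@cvgn_sum _ _ (fun j N => c j 0 * \sum_(1 <= l < N) a l * dfourier 0 l (x j 0))).
    move=> j; apply: cvgM; first exact: cvg_cst.
    exact: tseries_cvg h0 ah.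
  have /(_ _) := cvgB (@tseries_cvg _ _ _ k t h0 ah) c1.
  apply: cvg_trans; apply: near_eq_cvg; near=> N.
  rewrite !fctE /= /residual.
  under [X in _ - X = _]eq_bigr do rewrite mulr_sumr.
  rewrite exchange_big/= -sumrB; apply: eq_bigr => l _.
  rewrite mulrBr mulr_sumr; congr (_ - _); apply: eq_bigr => j _.
  by rewrite dfourier0; ring.
have cv2 : (H * \sum_(1 <= l < N) mu l * residual k x c t l ^+ 2) @[N --> \oo] -->
    H * limn (fun N => \sum_(1 <= l < N) mu l * residual k x c t l ^+ 2).
  by apply: cvgM; [exact: cvg_cst|exact: energy_lim_cvg g0 mug].
apply: (@le_trans _ _ (H * limn (fun N => \sum_(1 <= l < N) mu l * residual k x c t l ^+ 2))).
  have cvcv := cvgM cv cv; rewrite expr2; apply: (cvgn_ge_le (cvcv _) cv2) => N.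
  rewrite /= -expr2; apply: sum_cauchy_schwarz => // l.
  by rewrite mem_index_iota => /andP[l1 _]; exact: mu0.
rewrite ler_wpM2l// ?(ltW H0)// /energy lerDl mulr_ge0// sumr_ge0// => j _.
exact: sqr_ge0.
Unshelve. all: by end_near. Qed.

(** * Plug-in weights *)

Lemma Rintegral01_sum R (I : Type) (s : seq I) (f : I -> R -> R) :
  (forall i, lebesgue_measure.-integrable `[0, 1] (EFin \o f i)) ->
  \int[lebesgue_measure]_(x in `[0, 1]) (\sum_(i <- s) f i x) =
  \sum_(i <- s) \int[lebesgue_measure]_(x in `[0, 1]) f i x.
Proof.
move=> fi; have m01 : measurable (`[0%R, 1%R]%classic : set (measurableTypeR R)).
  exact: measurable_itv.
exact: (Rintegral_sum s m01 fi).2.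
Qed.

(** The integral kernel of the map that truncates the Fourier series of a
    function below frequency index [m] and evaluates its [k]-th derivative
    at [t]. *)
Definition projection_kernel R (m k : nat) (t x : R) : R :=
  \sum_(1 <= i < m) dfourier k i t * fourier i x.

(** The empirical version of [projection_kernel]: a competitor for the
    minimal energy that is explicit enough to compute expectations. *)
Definition plugin_weights R (m k n : nat) (x : 'cV[R]_n) (t : R) : 'cV[R]_n :=
  \col_j (n%:R^-1 * projection_kernel m k t (x j 0)).

Lemma bounded_measurable_projection_kernel R m k (t : R) :
  bounded_measurable (projection_kernel m k t).
Proof.
apply: bounded_measurable_sum => i; apply: bounded_measurableM.
  exact: bounded_measurable_cst.
exact: bounded_measurable_fourier.
Qed.

Lemma projection_kernel_integral R m k (t : R) l : (1 <= l)%N ->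
  \int[lebesgue_measure]_(x in `[0, 1]) (projection_kernel m k t x * fourier l x) =
  (l < m)%N%:R * dfourier k l t.
Proof.
move=> l1; under eq_Rintegral do rewrite /projection_kernel mulr_suml.
have ii i : lebesgue_measure.-integrable `[0, 1]
    (EFin \o (fun x => dfourier k i t * @fourier R i x * fourier l x)).
  apply: integrable01_bounded; apply: bounded_measurableM.
    apply: bounded_measurableM; first exact: bounded_measurable_cst.
    exact: bounded_measurable_fourier.
  exact: bounded_measurable_fourier.
rewrite (Rintegral01_sum _ ii).
rewrite big_seq (eq_bigr (fun i => dfourier k i t * (i == l)%:R)); last first.
  move=> i; rewrite mem_index_iota => /andP[i1 _].
  under eq_Rintegral do rewrite -mulrA.
  rewrite RintegralZl ?fourier_orthonormal//.
  apply: integrable01_bounded; apply: bounded_measurableM; exact: bounded_measurable_fourier.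
rewrite -big_seq; have [lm|ml] := ltnP l m.
  rewrite (bigD1_seq l)//= ?mem_index_iota ?l1 ?iota_uniq// eqxx mulr1 mul1r.
  by rewrite big1 ?addr0// => i il; rewrite (negbTE il) mulr0.
rewrite mul0r big_seq big1// => i; rewrite mem_index_iota => /andP[_ im].
by rewrite (_ : (i == l) = false) ?mulr0//; lia.
Qed.

Lemma projection_kernel_sqr_integral R m k (t : R) :
  \int[lebesgue_measure]_(x in `[0, 1]) (projection_kernel m k t x ^+ 2) =
  \sum_(1 <= i < m) dfourier k i t ^+ 2.
Proof.
under eq_Rintegral do rewrite expr2 {2}/projection_kernel mulr_sumr.
have ii i : lebesgue_measure.-integrable `[0, 1]
    (EFin \o (fun x => projection_kernel m k t x * (dfourier k i t * fourier i x))).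
  apply: integrable01_bounded; apply: bounded_measurableM.
    exact: bounded_measurable_projection_kernel.
  apply: bounded_measurableM; first exact: bounded_measurable_cst.
  exact: bounded_measurable_fourier.
rewrite (Rintegral01_sum _ ii).
rewrite big_seq [RHS]big_seq; apply: eq_bigr => i; rewrite mem_index_iota => /andP[i1 im].
under eq_Rintegral do rewrite mulrCA.
rewrite RintegralZl ?projection_kernel_integral// ?im ?mul1r ?expr2//.
apply: integrable01_bounded; apply: bounded_measurableM.
  exact: bounded_measurable_projection_kernel.
exact: bounded_measurable_fourier.
Qed.

Lemma fourier_sqr_le R i (x : R) : fourier i x ^+ 2 <= 4.
Proof.
have := dfourier_le 0 i x; rewrite dfourier0 /dfourier_bound expr0 mulr1 => h.
by rewrite -real_normK ?num_real//; have := normr_ge0 (fourier i x); nra.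
Qed.

Lemma residual_plugin R m k n (x : 'cV[R]_n) t l : (0 < n)%N ->
  residual k x (plugin_weights m k x t) t l =
  n%:R^-1 * \sum_j (dfourier k l t - projection_kernel m k t (x j 0) * fourier l (x j 0)).
Proof.
move=> n0; rewrite /residual sumrB mulrBr; congr (_ - _).
  by rewrite sumr_const card_ord -[dfourier _ _ _ *+ _]mulr_natl mulKf// pnatr_eq0 -lt0n.
by rewrite mulr_sumr; apply: eq_bigr => j _; rewrite mxE mulrA.
Qed.

Section expected_energy.
Context d (T : measurableType d) (R : realType) (P : probability T R).
Variables (sigma : R) (X eps : nat -> {RV P >-> R}).
Hypothesis model : regression_model sigma X eps.

(** The residual is an average over the design of bounded functions, whose
    mean is 0 at the indices below [m] and [dfourier k l t] at the others. *)
Lemma expected_residual_le m k n t l : (0 < n)%N -> (1 <= l)%N ->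
  (\int[P]_w (residual k (\col_(i < n) X i w)
      (plugin_weights m k (\col_i X i w) t) t l ^+ 2)%:E <=
   ((m <= l)%N%:R * dfourier_bound R k l ^+ 2 +
    (2 * dfourier_bound R k l ^+ 2 + 8 * \sum_(1 <= i < m) dfourier k i t ^+ 2) / n%:R)%:E)%E.
Proof.
move=> n0 l1; pose h (x : R) := dfourier k l t - projection_kernel m k t x * fourier l x.
have bq := @bounded_measurable_projection_kernel R m k t.
have bql : bounded_measurable (fun x => projection_kernel m k t x * fourier l x).
  by apply: bounded_measurableM => //; exact: bounded_measurable_fourier.
have bh : bounded_measurable h.
  by apply: bounded_measurableB => //; exact: bounded_measurable_cst.
under eq_integral do rewrite residual_plugin//.
have -> : (fun w => ((n%:R^-1 * \sum_(j < n) (dfourier k l t -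
    projection_kernel m k t ((\col_i X i w) j 0) * fourier l ((\col_i X i w) j 0))) ^+ 2)%:E) =
    (fun w => ((n%:R^-1 * \sum_(j < n) h (X j w)) ^+ 2)%:E).
  by apply/funext => w; congr ((_ * _) ^+ 2)%:E; apply: eq_bigr => j _; rewrite mxE.
apply: (le_trans (design_mean_square model n0 bh)); rewrite lee_fin.
have D2 : dfourier k l t ^+ 2 <= dfourier_bound R k l ^+ 2.
  rewrite -real_normK ?num_real//; apply: lerXn2r; rewrite ?nnegrE//.
    exact: dfourier_bound_ge0.
  exact: dfourier_le.
have ic (c : R) : \int[lebesgue_measure]_(x in `[0, 1]) (fun=> c) x = c.
  rewrite Rintegral_cst//= lebesgue_measure_itv/= lte_fin ltr01 -EFinB/=.
  by rewrite subr0 mulr1.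
have icst (c : R) : lebesgue_measure.-integrable `[0, 1] (EFin \o (fun=> c : R)).
  by apply: integrable01_bounded; exact: bounded_measurable_cst.
apply: lerD.
  rewrite RintegralB//=; last exact: integrable01_bounded.
  rewrite projection_kernel_integral// (ic (dfourier k l t)).
  case: ltnP => _; rewrite ?mul1r ?subrr ?expr0n/= ?mul0r//.
  by rewrite subr0.
rewrite ler_wpM2r ?invr_ge0//.
apply: (@le_trans _ _ (\int[lebesgue_measure]_(x in `[0, 1])
    (2 * dfourier_bound R k l ^+ 2 + 8 * projection_kernel m k t x ^+ 2))).
  apply: le_Rintegral => //.
  - apply: integrable01_bounded; under eq_fun do rewrite expr2.
    exact: bounded_measurableM.
  - apply: integrable01_bounded; apply: bounded_measurableD.
      exact: bounded_measurable_cst.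
    apply: bounded_measurableM; first exact: bounded_measurable_cst.
    by under eq_fun do rewrite expr2; exact: bounded_measurableM.
  - move=> x _; rewrite /h.
    have f4 := fourier_sqr_le l x.
    have := ler_wpM2l (sqr_ge0 (projection_kernel m k t x)) f4.
    have := sqr_ge0 (dfourier k l t + projection_kernel m k t x * fourier l x).
    move: D2; rewrite !sqrrD sqrrN exprMn; lra.
rewrite RintegralD//=; last first.
  apply: integrable01_bounded; apply: bounded_measurableM; first exact: bounded_measurable_cst.
  by under eq_fun do rewrite expr2; exact: bounded_measurableM.
rewrite (ic (2 * dfourier_bound R k l ^+ 2)) RintegralZl//=.
  by rewrite projection_kernel_sqr_integral.
apply: integrable01_bounded; under eq_fun do rewrite expr2; exact: bounded_measurableM.
Qed.

(** * Measurability in the design and the evaluation point *)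

End expected_energy.

Definition measurable_mx d (D : measurableType d) R p q (A : D -> 'M[R]_(p, q)) :=
  forall i j, measurable_fun setT (fun z => A z i j).

Section measurability.
Context d (D : measurableType d) (R : realType).

Lemma measurable_col n (f : 'I_n -> D -> R) :
  (forall i, measurable_fun setT (f i)) -> measurable_mx (fun z => \col_i f i z).
Proof. by move=> mf i j; under eq_fun do rewrite mxE; exact: mf. Qed.

Lemma measurable_dfourier k l (t : D -> R) : measurable_fun setT t ->
  measurable_fun setT (fun z => dfourier k l (t z)).
Proof.
by move=> mt; apply: (measurableT_comp (@bounded_measurable_dfourier R k l).1).
Qed.

Lemma measurable_fourier l (t : D -> R) : measurable_fun setT t ->
  measurable_fun setT (fun z => fourier l (t z)).
Proof.
by move=> mt; apply: (measurableT_comp (@bounded_measurable_fourier R l).1).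
Qed.

Lemma measurable_residual k n l (x c : D -> 'cV[R]_n) (t : D -> R) :
  measurable_mx x -> measurable_mx c -> measurable_fun setT t ->
  measurable_fun setT (fun z => residual k (x z) (c z) (t z) l).
Proof.
move=> mx mc mt; apply: measurable_funB; first exact: measurable_dfourier.
apply: measurable_sum => j; apply: measurable_funM; first exact: mc.
by apply: measurable_fourier; exact: mx.
Qed.

Lemma measurable_sum_sqr n (c : D -> 'cV[R]_n) : measurable_mx c ->
  measurable_fun setT (fun z => \sum_j c z j 0 ^+ 2).
Proof.
by move=> mc; apply: measurable_sum => j; apply: measurable_funX; exact: mc.
Qed.

Lemma measurable_energy (g : R) (mu : nat -> R) k n r (x c : D -> 'cV[R]_n) (t : D -> R) :
  0 < g -> exp_decay g mu ->
  measurable_mx x -> measurable_mx c -> measurable_fun setT t ->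
  measurable_fun setT (fun z => energy mu k r (x z) (c z) (t z)).
Proof.
move=> g0 mug mx mc mt; apply: measurable_funD; last first.
  by apply: measurable_funM; [exact: measurable_cst|exact: measurable_sum_sqr].
apply: (@measurable_fun_cvg _ D R setT
  (fun N z => \sum_(1 <= l < N) mu l * residual k (x z) (c z) (t z) l ^+ 2)).
  move=> N; apply: measurable_sum => l; apply: measurable_funM; first exact: measurable_cst.
  by apply: measurable_funX; exact: measurable_residual.
by move=> z _; exact: energy_lim_cvg g0 mug.
Qed.

Lemma measurable_plugin_weights m k n (x : D -> 'cV[R]_n) (t : D -> R) :
  measurable_mx x -> measurable_fun setT t ->
  measurable_mx (fun z => plugin_weights m k (x z) (t z)).
Proof.
move=> mx mt i j; under eq_fun do rewrite mxE.
apply: measurable_funM; first exact: measurable_cst.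
apply: measurable_sum => l; apply: measurable_funM; first exact: measurable_dfourier.
by apply: measurable_fourier; exact: mx.
Qed.

Lemma measurable_mulmx p q r (A : D -> 'M[R]_(p, q)) (B : D -> 'M[R]_(q, r)) :
  measurable_mx A -> measurable_mx B -> measurable_mx (fun z => A z *m B z).
Proof.
move=> mA mB i j; under eq_fun do rewrite mxE.
by apply: measurable_sum => l; apply: measurable_funM; [exact: mA|exact: mB].
Qed.

Lemma measurable_det n (A : D -> 'M[R]_n) : measurable_mx A ->
  measurable_fun setT (fun z => \det (A z)).
Proof.
move=> mA; apply: measurable_sum => s; apply: measurable_funM; first exact: measurable_cst.
by apply: measurable_prod => i _; exact: mA.
Qed.

Lemma measurable_invr (f : D -> R) : measurable_fun setT f -> (forall z, f z != 0) ->
  measurable_fun setT (fun z => (f z)^-1).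
Proof.
move=> mf f0; have mV : measurable_fun [set~ (0 : R)] (@GRing.inv R).
  apply: open_continuous_measurable_fun; first by apply: closed_openC; exact: closed_eq.
  by move=> x /set_mem /eqP x0; exact: inv_continuous.
apply: (measurable_comp (F := [set~ (0 : R)]) _ _ mV mf).
- by apply: measurableC; exact: measurable_set1.
- by move=> _ [z _ <-] /= /eqP; rewrite (negbTE (f0 z)).
Qed.

(** By Cramer's formula. *)
Lemma measurable_invmx n (A : D -> 'M[R]_n) : measurable_mx A ->
  (forall z, A z \in unitmx) -> measurable_mx (fun z => invmx (A z)).
Proof.
move=> mA uA i j; rewrite (_ : (fun z => invmx (A z) i j) =
    (fun z => (\det (A z))^-1 * cofactor (A z) j i)); last first.
  by apply/funext => z; rewrite /invmx uA !mxE.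
apply: measurable_funM.
  apply: measurable_invr; first exact: measurable_det.
  by move=> z; have := uA z; rewrite unitmxE unitfE.
apply: measurable_funM; first exact: measurable_cst.
apply: measurable_det => p q; under eq_fun do rewrite !mxE; exact: mA.
Qed.

Lemma measurable_K0k (g : R) (mu : nat -> R) k n (x : D -> 'cV[R]_n) (t : D -> R) :
  0 < g -> exp_decay g mu -> measurable_mx x -> measurable_fun setT t ->
  measurable_mx (fun z => K0k (kernel_of mu) k (x z) (t z)).
Proof.
move=> g0 mug mx mt i j; rewrite ord1; under eq_fun do rewrite (K0kE _ _ _ _ g0 mug).
apply: (@measurable_fun_cvg _ D R setT (fun N z =>
    \sum_(1 <= l < N) mu l * fourier l (x z i 0) * dfourier k l (t z))).
  move=> N; apply: measurable_sum => l; apply: measurable_funM; last exact: measurable_dfourier.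
  by apply: measurable_funM; [exact: measurable_cst|apply: measurable_fourier; exact: mx].
move=> z _; have g20 : 0 < g / 2 by rewrite divr_gt0.
exact: tseries_cvg g20 (exp_decay_fourier (x z i 0) g0 mug).
Qed.

Lemma measurable_regularized_gram (g : R) (mu : nat -> R) n lam (x : D -> 'cV[R]_n) :
  0 < g -> exp_decay g mu -> measurable_mx x ->
  measurable_mx (fun z => regularized_gram (kernel_of mu) lam (x z)).
Proof.
move=> g0 mug mx i j; under eq_fun do rewrite !mxE.
apply: measurable_funD; last exact: measurable_cst.
apply: (@measurable_fun_cvg _ D R setT (fun N z =>
    \sum_(1 <= l < N) mu l * fourier l (x z i 0) * fourier l (x z j 0))).
  move=> N; apply: measurable_sum => l; apply: measurable_funM.
    by apply: measurable_funM; [exact: measurable_cst|apply: measurable_fourier; exact: mx].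
  by apply: measurable_fourier; exact: mx.
by move=> z _; exact: kernel_of_cvg g0 mug.
Qed.

Lemma measurable_krr_weights (g : R) (mu : nat -> R) k n lam
    (x : D -> 'cV[R]_n) (t : D -> R) :
  0 < g -> exp_decay g mu -> (forall i, (1 <= i)%N -> 0 < mu i) -> 0 < lam ->
  measurable_mx x -> measurable_fun setT t ->
  measurable_mx (fun z => krr_weights mu k lam (x z) (t z)).
Proof.
move=> g0 mug mu0 lam0 mx mt; apply: measurable_mulmx.
  apply: measurable_invmx; first exact: measurable_regularized_gram g0 mug mx.
  move=> z; apply: posdef_unitmx => c.
  exact: (regularized_gram_posdef (x z) g0 mug mu0 lam0).
exact: measurable_K0k g0 mug mx mt.
Qed.

End measurability.

(** * Expected energy of the plug-in weights *)

(** The sums that enter the expected energy: a tail, two convergent series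
    and a power sum. Out of the decay rate [g = 1 + 2 e], one [e] absorbs
    the powers of the index and another makes the tail summable; the
    remaining rate 1 gives the factor [exp (- m)]. *)
Lemma plugin_constants R (g : R) (mu : nat -> R) k : 1 < g -> exp_decay g mu ->
  exists2 C : R, 0 <= C & forall m N, (1 <= m)%N ->
  [/\ \sum_(1 <= l < N) `|mu l| * ((m <= l)%N%:R * dfourier_bound R k l ^+ 2) <=
        C * expR (- m%:R),
      \sum_(1 <= l < N) `|mu l| * dfourier_bound R k l ^+ 2 <= C,
      \sum_(1 <= l < N) `|mu l| <= C &
      \sum_(1 <= i < m) dfourier_bound R k i ^+ 2 <= C * m%:R ^+ (k.*2).+1].
Proof.
move=> g1 mug; pose e := (g - 1) / 2; have e0 : 0 < e by rewrite /e; lra.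
have g0 : 0 < g by lra.
have bE l : dfourier_bound R k l ^+ 2 = 4 * pi ^+ (k.*2) * l%:R ^+ (k.*2).
  rewrite /dfourier_bound exprMn -exprM muln2 [(_ * _) ^+ _]exprMn mulrA.
  by congr (_ * _ * _); ring.
have p0 : 0 <= 4 * pi ^+ (k.*2) :> R by rewrite mulr_ge0// exprn_ge0// pi_ge0.
have [A A0 mA] := exp_decay_ge0 (exp_decayM mug (natr_exp_decay (k.*2) e0)).
have [C3 C30 mC3] := exp_decay_sum_le g0 mug.
pose A' := 4 * pi ^+ (k.*2) * A.
have A'0 : 0 <= A' by rewrite mulr_ge0.
have ge1 : g + - e = 1 + e by rewrite /e; lra.
have muB l : (1 <= l)%N ->
    `|mu l| * dfourier_bound R k l ^+ 2 <= A' * expR (- ((1 + e) * l%:R)).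
  move=> l1; have := mA l l1; rewrite ge1 normrM (ger0_norm (exprn_ge0 _ _))// => h.
  by rewrite bE mulrCA /A' -[leRHS]mulrA; apply: ler_wpM2l.
have e1 : 0 < 1 + e by lra.
exists (A' / e + A' / (1 + e) + C3 + 4 * pi ^+ (k.*2)).
  by rewrite !addr_ge0// divr_ge0// ltW.
move=> m N m1; have q1 : 0 <= A' / e by rewrite divr_ge0// ltW.
have q2 : 0 <= A' / (1 + e) by rewrite divr_ge0// ltW.
have em0 := expR_ge0 (- m%:R : R).
split.
- apply: (@le_trans _ _ (A' / e * expR (- m%:R))); last first.
    by rewrite ler_wpM2r//; lra.
  apply: (@le_trans _ _ (\sum_(1 <= l < N) (A' * expR (- m%:R)) * expR (- (e * l%:R)))).
    rewrite !big_nat; apply: ler_sum => l /andP[l1 _].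
    case: leqP => ml; last first.
      by rewrite mul0r mulr0; exact: mulr_ge0 (mulr_ge0 A'0 em0) (expR_ge0 _).
    rewrite mul1r (le_trans (muB l l1))// -mulrA ler_wpM2l// -expRD ler_expR.
    rewrite mulrDl mul1r opprD lerD2r lerN2 ler_nat//.
  rewrite -mulr_sumr [leRHS]mulrAC.
  apply: ler_wpM2l; first exact: mulr_ge0 A'0 em0.
  exact: sum_expR_le.
- apply: (@le_trans _ _ (A' / (1 + e))); last by lra.
  apply: (@le_trans _ _ (\sum_(1 <= l < N) A' * expR (- ((1 + e) * l%:R)))).
    by rewrite !big_nat; apply: ler_sum => l /andP[l1 _]; exact: muB.
  by rewrite -mulr_sumr ler_wpM2l// sum_expR_le.
- by rewrite (le_trans (mC3 N))//; lra.
- apply: (@le_trans _ _ (4 * pi ^+ (k.*2) * m%:R ^+ (k.*2).+1)); last first.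
    by rewrite ler_wpM2r// ?exprn_ge0//; lra.
  apply: (@le_trans _ _ (\sum_(1 <= i < m) 4 * pi ^+ (k.*2) * m%:R ^+ (k.*2))).
    rewrite !big_nat; apply: ler_sum => i /andP[_ im].
    rewrite bE ler_wpM2l//; apply: lerXn2r; rewrite ?nnegrE// ler_nat ltnW//.
  rewrite sumr_const_nat -[leLHS]mulr_natr exprSr mulrA; apply: ler_wpM2l.
    by rewrite mulr_ge0// exprn_ge0.
  by rewrite ler_nat leq_subr.
Qed.

Section expected_energy_bound.
Context d (T : measurableType d) (R : realType) (P : probability T R).
Variables (sigma : R) (X eps : nat -> {RV P >-> R}).
Hypothesis model : regression_model sigma X eps.

Lemma measurable_design n : measurable_mx (fun w => \col_(i < n) X i w).
Proof. by apply: measurable_col => i; exact: measurable_funPT. Qed.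

Lemma measurable_design_plugin m k n t :
  measurable_mx (fun w => plugin_weights m k (\col_(i < n) X i w) t).
Proof.
by apply: measurable_plugin_weights; [exact: measurable_design|exact: measurable_cst].
Qed.

Lemma expected_plugin_sum_sqr m k n t : (0 < n)%N ->
  (\int[P]_w (\sum_j plugin_weights m k (\col_(i < n) X i w) t j 0 ^+ 2)%:E =
   ((\sum_(1 <= i < m) dfourier k i t ^+ 2) / n%:R)%:E)%E.
Proof.
move=> n0; pose q := projection_kernel m k t.
have bq : bounded_measurable q by exact: bounded_measurable_projection_kernel.
have bq2 : bounded_measurable (fun x => q x ^+ 2).
  by under eq_fun do rewrite expr2; exact: bounded_measurableM.
have -> : (fun w => (\sum_j plugin_weights m k (\col_(i < n) X i w) t j 0 ^+ 2)%:E) =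
    (fun w => \sum_(j < n) ((n%:R^-1 ^+ 2 * q (X j w) ^+ 2)%:E))%E.
  by apply/funext => w; rewrite sumEFin; congr EFin; apply: eq_bigr => j _; rewrite !mxE exprMn.
have mq (j : 'I_n) : measurable_fun setT (fun w => (n%:R^-1 ^+ 2 * q (X j w) ^+ 2)%:E).
  apply/measurable_EFinP; apply: measurable_funM; first exact: measurable_cst.
  exact: (measurableT_comp bq2.1 (@measurable_funPT _ _ _ _ (X j))).
rewrite (ge0_integral_sum P measurableT mq); last first.
  by move=> j w _; rewrite lee_fin mulr_ge0 ?sqr_ge0.
have -> : (\sum_(j < n) \int[P]_w ((n%:R^-1 ^+ 2 * q (X j w) ^+ 2)%:E) =
    \sum_(j < n) (n%:R^-1 ^+ 2 * \sum_(1 <= i < m) dfourier k i t ^+ 2)%:E)%E.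
  apply: eq_bigr => j _; under eq_integral do rewrite EFinM.
  rewrite ge0_integralZl_EFin ?sqr_ge0//; last 2 first.
  - by move=> w _; rewrite lee_fin sqr_ge0.
  - by apply/measurable_EFinP; exact: (measurableT_comp bq2.1 (@measurable_funPT _ _ _ _ (X j))).
  rewrite (design_integral model j bq2.1) -projection_kernel_sqr_integral [RHS]EFinM.
  congr (_ * _)%E; rewrite /Rintegral fineK//.
  by apply: integrable_fin_num => //; exact: integrable01_bounded.
rewrite sumEFin sumr_const card_ord; congr EFin.
rewrite -[LHS]mulr_natl mulrA expr2 mulrA divff ?mul1r; first by rewrite mulrC.
by rewrite pnatr_eq0 -lt0n.
Qed.

(** Truncation at index [m] leaves the tail of the kernel series, of order
    [exp (- m)]. Estimating the coefficients below [m] costs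
    [m ^ (2k+1) / n], once for the variance of the residuals and [r] times
    for the penalty. *)
Lemma expected_energy_le (g : R) (mu : nat -> R) k : 1 < g -> exp_decay g mu ->
  (forall i, (1 <= i)%N -> 0 < mu i) ->
  exists2 C : R, 0 <= C & forall n m r t, (0 < n)%N -> (1 <= m)%N -> 0 <= r ->
    (\int[P]_w (energy mu k r (\col_(i < n) X i w)
       (plugin_weights m k (\col_(i < n) X i w) t) t)%:E <=
     (C * (expR (- m%:R) + (1 + r) * m%:R ^+ (k.*2).+1 / n%:R))%:E)%E.
Proof.
move=> g1 mug mu0; have g0 : 0 < g by lra.
have [C C0 hC] := plugin_constants k g1 mug.
exists (3 * C + 8 * C ^+ 2); first by have := sqr_ge0 C; lra.
move=> n m r t n0 m1 r0; set D := m%:R ^+ _.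
have D1 : 1 <= D by rewrite /D exprn_ege1// ler1n.
have n1 : 0 < n%:R^-1 :> R by rewrite invr_gt0 ltr0n.
set S := \sum_(1 <= i < m) dfourier k i t ^+ 2.
have S0 : 0 <= S by apply: sumr_ge0 => i _; exact: sqr_ge0.
have SD : S <= C * D.
  have [_ _ _ h] := hC m 0%N m1; apply: le_trans h; apply: ler_sum => i _.
  rewrite -real_normK ?num_real//; apply: lerXn2r; rewrite ?nnegrE//.
    exact: dfourier_bound_ge0.
  exact: dfourier_le.
pose x w := \col_(i < n) X i w; pose c w := plugin_weights m k (x w) t.
have mx : measurable_mx x by exact: measurable_design.
have mc : measurable_mx c by exact: measurable_design_plugin.
have mt : measurable_fun setT (fun _ : T => t) by exact: measurable_cst.
pose L w := limn (fun N => \sum_(1 <= l < N) mu l * residual k (x w) (c w) t l ^+ 2).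
have mpart N : measurable_fun setT (fun w => \sum_(1 <= l < N) mu l * residual k (x w) (c w) t l ^+ 2).
  apply: measurable_sum => l; apply: measurable_funM; first exact: measurable_cst.
  by apply: measurable_funX; exact: measurable_residual.
have mL : measurable_fun setT L.
  apply: (@measurable_fun_cvg _ _ R setT
    (fun N w => \sum_(1 <= l < N) mu l * residual k (x w) (c w) t l ^+ 2)) => //.
  by move=> w _; exact: energy_lim_cvg g0 mug.
have p0 N w : 0 <= \sum_(1 <= l < N) mu l * residual k (x w) (c w) t l ^+ 2.
  rewrite big_nat; apply: sumr_ge0 => l /andP[l1 _].
  by rewrite mulr_ge0 ?sqr_ge0// ltW// mu0.
have L0 w : 0 <= L w.
  rewrite -oppr_le0; apply: (cvgn_le (cvgN (@energy_lim_cvg _ _ _ k _ (x w) (c w) t g0 mug))) => N.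
  by rewrite oppr_le0.
have -> : (\int[P]_w (energy mu k r (x w) (c w) t)%:E =
    \int[P]_w (L w)%:E + \int[P]_w (r * \sum_j c w j 0 ^+ 2)%:E)%E.
  under eq_integral do rewrite /energy EFinD.
  rewrite ge0_integralD//.
  - by move=> w _; rewrite lee_fin; exact: L0.
  - by apply/measurable_EFinP; exact: mL.
  - by move=> w _; rewrite lee_fin mulr_ge0// sumr_ge0// => j _; exact: sqr_ge0.
  - apply/measurable_EFinP; apply: measurable_funM; first exact: measurable_cst.
    exact: measurable_sum_sqr.
have -> : (\int[P]_w (r * \sum_j c w j 0 ^+ 2)%:E = (r * (S / n%:R))%:E)%E.
  under eq_integral do rewrite EFinM.
  rewrite ge0_integralZl_EFin//.
  - by rewrite expected_plugin_sum_sqr.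
  - by move=> w _; rewrite lee_fin sumr_ge0// => j _; exact: sqr_ge0.
  - by apply/measurable_EFinP; exact: measurable_sum_sqr.
have hL : (\int[P]_w (L w)%:E <=
    (C * expR (- m%:R) + (2 * C + 8 * C * S) / n%:R)%:E)%E.
  apply: (@integral_cvg_le _ _ _ P setT
    (fun N w => (\sum_(1 <= l < N) mu l * residual k (x w) (c w) t l ^+ 2)%:E)).
  - exact: measurableT.
  - by move=> N; exact/measurable_EFinP.
  - by move=> N w _; rewrite lee_fin.
  - move=> w _; apply: cvg_EFin; first by near=> N.
    exact: energy_lim_cvg g0 mug.
  - move=> N.
    (* Absolute values make all terms nonnegative, [l = 0] included. *)
    have -> : (fun w => (\sum_(1 <= l < N) mu l * residual k (x w) (c w) t l ^+ 2)%:E) =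
        (fun w => \sum_(1 <= l < N) (`|mu l| * residual k (x w) (c w) t l ^+ 2)%:E)%E.
      apply/funext => w; rewrite sumEFin; congr EFin.
      by apply: eq_big_nat => l /andP[l1 _]; rewrite gtr0_norm// mu0.
    have mres l : measurable_fun setT (fun w => (residual k (x w) (c w) t l ^+ 2)%:E).
      by apply/measurable_EFinP; apply: measurable_funX; exact: measurable_residual.
    have mabs l : measurable_fun setT (fun w => (`|mu l| * residual k (x w) (c w) t l ^+ 2)%:E).
      by under eq_fun do rewrite EFinM; exact: measurable_funeM.
    rewrite (ge0_integral_sum P measurableT mabs); last first.
      by move=> l w _; rewrite lee_fin mulr_ge0// sqr_ge0.
    pose b l := (m <= l)%N%:R * dfourier_bound R k l ^+ 2 +
      (2 * dfourier_bound R k l ^+ 2 + 8 * S) / n%:R.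
    apply: (@le_trans _ _ (\sum_(1 <= l < N) (`|mu l| * b l)%:E)%E).
      rewrite big_seq [leRHS]big_seq; apply: lee_sum => l.
      rewrite mem_index_iota => /andP[l1 _]; under eq_integral do rewrite EFinM.
      rewrite ge0_integralZl_EFin//; last by move=> w _; rewrite lee_fin sqr_ge0.
      by rewrite EFinM lee_wpmul2l ?lee_fin//; exact: (expected_residual_le model).
    rewrite sumEFin lee_fin.
    have -> : \sum_(1 <= l < N) `|mu l| * b l =
        \sum_(1 <= l < N) `|mu l| * ((m <= l)%N%:R * dfourier_bound R k l ^+ 2) +
        (2 * (\sum_(1 <= l < N) `|mu l| * dfourier_bound R k l ^+ 2) +
         8 * (\sum_(1 <= l < N) `|mu l|) * S) / n%:R.
      rewrite [8 * _]mulr_sumr [_ * S]mulr_suml [2 * _]mulr_sumr -big_split/= mulr_suml -big_split/=.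
      by apply: eq_bigr => l _; rewrite /b; ring.
    have [h1 h2 h3 _] := hC m N m1.
    apply: lerD => //; apply: ler_wpM2r; first exact: ltW.
    apply: lerD; first by rewrite ler_wpM2l.
    by rewrite ler_wpM2r// ler_wpM2l.
apply: (le_trans (leeD2r _ hL)); rewrite -EFinD lee_fin.
have e0 : 0 <= expR (- m%:R) :> R by exact: expR_ge0.
move: (expR _) e0 => e e0.
have : (2 * C + 8 * C * S + r * S) / n%:R <=
    (3 * C + 8 * C ^+ 2) * ((1 + r) * D) / n%:R.
  apply: ler_wpM2r; first exact: ltW.
  have CS : C * S <= C * (C * D) by rewrite ler_wpM2l.
  have rS : r * S <= r * (C * D) by rewrite ler_wpM2l.
  have CD : C <= C * D by rewrite ler_peMr.
  have CD0 : 0 <= C * (C * D) by rewrite mulr_ge0// (le_trans C0).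
  have rCD0 : 0 <= r * (C * D) by rewrite mulr_ge0// (le_trans C0).
  have rCD1 : 0 <= r * (C * (C * D)) by rewrite mulr_ge0.
  nra.
have Ce : 0 <= C ^+ 2 * e by rewrite mulr_ge0// sqr_ge0.
have Ce1 : 0 <= C * e by rewrite mulr_ge0.
move=> h.
have -> : C * e + (2 * C + 8 * C * S) / n%:R + r * (S / n%:R) =
  C * e + (2 * C + 8 * C * S + r * S) / n%:R by ring.
have -> : (3 * C + 8 * C ^+ 2) * (e + (1 + r) * D / n%:R) =
  (3 * C + 8 * C ^+ 2) * e + (3 * C + 8 * C ^+ 2) * ((1 + r) * D) / n%:R by ring.
by apply: lerD => //; lra.
Unshelve. all: by end_near. Qed.

End expected_energy_bound.

(** * Expected posterior risk *)

Section regression_error.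
Context d (T : measurableType d) (R : realType) (P : probability T R).
Variables (sigma : R) (X eps : nat -> {RV P >-> R}).
Hypothesis s0 : 0 < sigma.
Hypothesis model : regression_model sigma X eps.
Variables (g : R) (mu : nat -> R) (k : nat).
Hypothesis g1 : 1 < g.
Hypothesis mug : exp_decay g mu.
Hypothesis mu0 : forall i, (1 <= i)%N -> 0 < mu i.

Let g0 : 0 < g. Proof. by rewrite (lt_trans ltr01). Qed.

(** With zero weights the design drops out; this gives a bound on the
    minimal energy that is uniform in the design. *)
Lemma energy_weights0 n r (x : 'cV[R]_n) t : energy mu k r x 0 t = energy mu k r 0 (0 : 'cV[R]_n) t.
Proof.
have e : residual k x 0 t = residual k 0 (0 : 'cV[R]_n) t.
  apply/funext => l; congr (_ - _).
  by apply: eq_bigr => j _; rewrite !mxE !mul0r.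
by rewrite /energy e.
Qed.

Lemma energy_ge0 n r (x c : 'cV[R]_n) t : 0 <= r -> 0 <= energy mu k r x c t.
Proof.
move=> r0; apply: le_trans (energy_ge k r x c t g0 mug mu0).
by rewrite mulr_ge0// sumr_ge0// => j _; exact: sqr_ge0.
Qed.

Lemma krr_weights_sum_sqr_le n lam (x c : 'cV[R]_n) t : (0 < n)%N -> 0 < lam ->
  \sum_j krr_weights mu k lam x t j 0 ^+ 2 <=
  (n%:R * lam)^-1 * energy mu k (n%:R * lam) x c t.
Proof.
move=> n0 l0; have r0 : 0 < n%:R * lam by rewrite mulr_gt0// ltr0n.
rewrite mulrC ler_pdivlMr// mulrC.
exact: le_trans (energy_ge k _ x _ t g0 mug mu0) (energy_min k x c t g0 mug mu0 l0).
Qed.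

(** Given the design, the noise term has variance [sigma ^+ 2] times the
    squared length of the weights, which the penalty controls by the energy. *)
Lemma noise_error_le n lam m t (x := fun w => \col_(i < n) X i w) :
  (0 < n)%N -> 0 < lam ->
  (\int[P]_w ((\sum_i krr_weights mu k lam (x w) t i 0 * eps i w) ^+ 2)%:E <=
   (sigma ^+ 2 / (n%:R * lam))%:E *
   \int[P]_w (energy mu k (n%:R * lam) (x w) (plugin_weights m k (x w) t) t)%:E)%E.
Proof.
move=> n0 l0; set r := n%:R * lam; have r0 : 0 < r by rewrite mulr_gt0// ltr0n.
pose c w := krr_weights mu k lam (x w) t.
have mc : measurable_mx (c : cylinderType X n -> _).
  apply: (measurable_krr_weights k g0 mug mu0 l0); last exact: measurable_cst.
  by apply: measurable_col => i; exact: measurable_cylinder_proj.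
have mcT : measurable_mx c.
  apply: (measurable_krr_weights k g0 mug mu0 l0); last exact: measurable_cst.
  exact: measurable_design.
pose B := r^-1 * energy mu k r 0 (0 : 'cV[R]_n) t.
have cB w : \sum_j c w j 0 ^+ 2 <= B.
  by rewrite /B -(energy_weights0 r (x w)); exact: krr_weights_sum_sqr_le.
have ciB i w : c w i 0 ^+ 2 <= B.
  by rewrite (le_trans _ (cB w))// (bigD1 i)//= lerDl sumr_ge0// => j _; exact: sqr_ge0.
have cib i : exists B' : R, forall w, `|c w i 0| <= B'.
  exists (1 + B) => w; have := ciB i w; rewrite -real_normK ?num_real// => h.
  by have := normr_ge0 (c w i 0); nra.
apply: (le_trans (noise_combination_le s0 model (fun i => mc i 0) cib)).
have bs : bounded_measurable (fun w => \sum_i c w i 0 ^+ 2).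
  split; first exact: measurable_sum_sqr.
  exists B => w; rewrite ger0_norm//; apply: sumr_ge0 => j _; exact: sqr_ge0.
rewrite EFinM -integral_Rintegral; last exact: bounded_measurable_integrable.
rewrite (EFinM (sigma ^+ 2) r^-1) -muleA lee_wpmul2l ?lee_fin ?sqr_ge0//.
rewrite -ge0_integralZl_EFin//; last 3 first.
- by move=> w _; rewrite lee_fin; exact: energy_ge0 (ltW r0).
- apply/measurable_EFinP; apply: (measurable_energy k r g0 mug); last exact: measurable_cst.
    exact: measurable_design.
  exact: measurable_design_plugin.
- by rewrite invr_ge0 ltW.
apply: ge0_le_integral => //.
- by move=> w _; rewrite lee_fin sumr_ge0// => j _; exact: sqr_ge0.
- by apply/measurable_EFinP; exact: bs.1.
- apply/measurable_EFinP; apply: measurable_funM; first exact: measurable_cst.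
  apply: (measurable_energy k r g0 mug); last exact: measurable_cst.
    exact: measurable_design.
  exact: measurable_design_plugin.
- by move=> w _; rewrite lee_fin; exact: krr_weights_sum_sqr_le.
Qed.

Variables (h H : R) (a : nat -> R).
Hypothesis h0 : 0 < h.
Hypothesis ah : exp_decay h a.
Hypothesis H0 : 0 < H.
Hypothesis aH : forall N, \sum_(1 <= l < N) a l ^+ 2 / mu l <= H.

(** Replacing the optimal weights by the plug-in weights bounds the variance
    and the bias by an explicit energy; only the noise term keeps the
    optimal weights, since its expectation is bounded directly. The factors
    2 and 4 come from splitting squares of sums twice. *)
Definition risk_majorant m n lam t w : R :=
  let x := \col_(i < n) X i w in
  (2 * sigma ^+ 2 / (n%:R * lam) + 4 * H) *
    energy mu k (n%:R * lam) x (plugin_weights m k x t) t +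
  4 * (\sum_i krr_weights mu k lam x t i 0 * eps i w) ^+ 2.

Lemma risk_majorant_ge0 m n lam t w : 0 < lam -> 0 <= risk_majorant m n lam t w.
Proof.
move=> l0; have r0 : 0 <= n%:R * lam by rewrite mulr_ge0// ltW.
rewrite addr_ge0//; last by rewrite mulr_ge0// sqr_ge0.
rewrite mulr_ge0 ?energy_ge0// addr_ge0//; last by rewrite mulr_ge0// ltW.
by rewrite divr_ge0// mulr_ge0// sqr_ge0.
Qed.

Lemma posterior_risk_le m n lam t w (x := \col_(i < n) X i w) (y : 'cV[R]_n) :
  0 < lam -> (forall i, y i 0 = tseries a 0 (X i w) + eps i w) ->
  2 * (posterior_cov (kernel_of mu) sigma k lam x t t +
       (posterior_mean (kernel_of mu) k lam x y t - tseries a k t) ^+ 2) <=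
  risk_majorant m n lam t w.
Proof.
move=> l0 yE; have r0 : 0 <= n%:R * lam by rewrite mulr_ge0// ltW.
rewrite (posterior_covE _ _ _ _ g0 mug mu0 l0) posterior_meanE /risk_majorant -/x.
set c := krr_weights mu k lam x t; set N := \sum_i c i 0 * eps i w.
set E := energy mu k _ x c t; set E0 := energy mu k _ x _ t.
have EE0 : E <= E0 by exact: (energy_min k x _ t g0 mug mu0 l0).
have EB := bias_le_energy k x c t g0 mug mu0 h0 ah H0 aH r0.
rewrite -/E in EB; set b := tseries a k t - _ in EB.
have -> : \sum_j c j 0 * y j 0 - tseries a k t = N - b.
  rewrite /N /b opprB addrA -big_split/=; congr (_ - _); apply: eq_bigr => j _.
  by rewrite yE mulrDr addrC [x j 0]mxE.
have s2 : 0 <= sigma ^+ 2 / (n%:R * lam) by rewrite divr_ge0// sqr_ge0.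
have h1 : sigma ^+ 2 / (n%:R * lam) * E <= sigma ^+ 2 / (n%:R * lam) * E0 by exact: ler_wpM2l.
have h2 : H * E <= H * E0 by rewrite ler_wpM2l// ltW.
have h3 : (N - b) ^+ 2 <= 2 * N ^+ 2 + 2 * b ^+ 2 by have := sqr_ge0 (N + b); nra.
rewrite -[2 * sigma ^+ 2 / _]mulrA; nra.
Qed.

Lemma measurable_risk_majorant m n lam : 0 < lam ->
  measurable_fun [set: T * R] (fun z => risk_majorant m n lam z.2 z.1).
Proof.
move=> l0.
have mX : measurable_mx (fun z : T * R => \col_(i < n) X i z.1).
  by apply: measurable_col => i; apply: measurableT_comp; [exact: measurable_funPT|exact: measurable_fst].
have mt : measurable_fun [set: T * R] (snd : T * R -> R) by exact: measurable_snd.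
apply: measurable_funD; (apply: measurable_funM; first exact: measurable_cst).
  apply: (measurable_energy k _ g0 mug) => //.
  exact: measurable_plugin_weights.
apply: measurable_funX; apply: measurable_sum => i; apply: measurable_funM.
  exact: (measurable_krr_weights k g0 mug mu0 l0).
by apply: measurableT_comp; [exact: measurable_funPT|exact: measurable_fst].
Qed.

(** The constant is uniform in [t], so that the bound can be integrated over
    [0, 1]. *)
Lemma expected_risk_le : exists2 C : R, 0 <= C & forall m n lam t,
  (0 < n)%N -> (1 <= m)%N -> 0 < lam ->
  (\int[P]_w (risk_majorant m n lam t w)%:E <=
   (C * ((n%:R * lam)^-1 + 1) *
     (expR (- m%:R) + (1 + n%:R * lam) * m%:R ^+ (k.*2).+1 / n%:R))%:E)%E.
Proof.
have [C C0 hC] := expected_energy_le model k g1 mug mu0.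
pose s2 := sigma ^+ 2; have s20 : 0 <= s2 by exact: sqr_ge0.
have Hp := ltW H0.
exists ((6 * s2 + 4 * H) * C); first by rewrite mulr_ge0//; lra.
move=> m n lam t n0 m1 l0; set r := n%:R * lam.
have r0 : 0 < r by rewrite mulr_gt0// ltr0n.
pose x w := \col_(i < n) X i w; pose E0 w := energy mu k r (x w) (plugin_weights m k (x w) t) t.
pose N w := \sum_i krr_weights mu k lam (x w) t i 0 * eps i w.
set A := expR _ + _; have hE : (\int[P]_w (E0 w)%:E <= (C * A)%:E)%E by exact: hC (ltW r0).
have A0 : 0 <= A.
  rewrite addr_ge0 ?expR_ge0// mulr_ge0 ?invr_ge0// mulr_ge0 ?exprn_ge0//.
  by rewrite addr_ge0// ltW.
have mE0 : measurable_fun setT E0.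
  apply: (measurable_energy k r g0 mug); last exact: measurable_cst.
    exact: measurable_design.
  exact: measurable_design_plugin.
have mN : measurable_fun setT (fun w => N w ^+ 2).
  apply: measurable_funX; apply: measurable_sum => i; apply: measurable_funM.
    apply: (measurable_krr_weights k g0 mug mu0 l0); last exact: measurable_cst.
    exact: measurable_design.
  exact: measurable_funPT.
have hN : (\int[P]_w (N w ^+ 2)%:E <= (s2 / r * (C * A))%:E)%E.
  apply: (le_trans (noise_error_le m t n0 l0)); rewrite [leRHS]EFinM -/r.
  by rewrite lee_wpmul2l// lee_fin divr_ge0// ltW.
have K0 : 0 <= 2 * s2 / r + 4 * H by rewrite addr_ge0 ?mulr_ge0 ?invr_ge0// ltW.
have -> : (\int[P]_w (risk_majorant m n lam t w)%:E =
   (2 * s2 / r + 4 * H)%:E * \int[P]_w (E0 w)%:E + 4%:E * \int[P]_w (N w ^+ 2)%:E)%E.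
  rewrite -ge0_integralZl_EFin//; last 2 first.
  - by move=> w _; rewrite lee_fin; exact: energy_ge0 (ltW r0).
  - exact/measurable_EFinP.
  rewrite -ge0_integralZl_EFin//; last 2 first.
  - by move=> w _; rewrite lee_fin sqr_ge0.
  - exact/measurable_EFinP.
  rewrite -ge0_integralD//.
  - by move=> w _; rewrite -EFinM lee_fin mulr_ge0//; exact: energy_ge0 (ltW r0).
  - by apply: measurable_funeM; exact/measurable_EFinP.
  - by move=> w _; rewrite -EFinM lee_fin mulr_ge0// sqr_ge0.
  - by apply: measurable_funeM; exact/measurable_EFinP.
apply: (@le_trans _ _ ((2 * s2 / r + 4 * H)%:E * (C * A)%:E + 4%:E * (s2 / r * (C * A))%:E)%E).
  by apply: leeD; rewrite lee_wpmul2l.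
rewrite -!EFinM -EFinD lee_fin.
have ri : 0 < r^-1 by rewrite invr_gt0.
have CA : 0 <= C * A by rewrite mulr_ge0.
have -> : (2 * s2 / r + 4 * H) * (C * A) + 4 * (s2 / r * (C * A)) =
  (6 * s2 * r^-1 + 4 * H) * (C * A) by ring.
have -> : (6 * s2 + 4 * H) * C * (r^-1 + 1) * A =
  ((6 * s2 + 4 * H) * (r^-1 + 1)) * (C * A) by ring.
apply: ler_wpM2r => //; have : 0 <= H * r^-1 by rewrite mulr_ge0// ltW.
lra.
Qed.
End regression_error.

(** * Tails of the L2 distance *)

Lemma L2normE R (f : R -> R) :
  L2norm f = ((\int[lebesgue_measure]_(x in `[0%R, 1%R]) (f x ^+ 2)%:E) `^ 2^-1)%E.
Proof.
rewrite /L2norm unlock /=.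
have -> : (fun x => (`|((EFin \o f) \_ `[0%R, 1%R]) x| `^ 2)%E) =
    (fun x => (f x ^+ 2)%:E) \_ `[0%R, 1%R].
  apply/funext => x; rewrite !patchE; case: ifPn => _ /=; last first.
    by rewrite normr0 powR0.
  by rewrite powR_mulrn// real_normK ?num_real.
by rewrite -integral_mkcond.
Qed.

Lemma L2norm_gtE R (f : R -> R) (b : R) : 0 <= b ->
  (b%:E < L2norm f)%E =
  ((b ^+ 2)%:E < \int[lebesgue_measure]_(x in `[0%R, 1%R]) (f x ^+ 2)%:E)%E.
Proof.
move=> b0; rewrite L2normE; set I := (\int[_]_(x in _) _)%E.
have I0 : (0 <= I)%E by apply: integral_ge0 => x _; rewrite lee_fin sqr_ge0.
have nn (x : \bar R) : (0 <= x)%E -> x \in `[0%E, +oo%E] by move=> x0; rewrite in_itv/= x0 leey.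
apply/idP/idP; apply: contraLR; rewrite -!leNgt => h.
  have := gt0_ler_poweR (ltW (_ : 0 < 2^-1 :> R)) (nn _ I0) (nn (b ^+ 2)%:E _) h.
  rewrite poweR_EFin -powR_mulrn// -powRrM mulfV// powRr1//; apply.
    by rewrite invr_gt0.
  by rewrite lee_fin powR_ge0.
have := @gt0_ler_poweR R 2 _ _ _ (nn (I `^ 2^-1)%E _) (nn b%:E _) h.
rewrite -poweRrM mulVf// poweRe1// poweR_EFin powR_mulrn//.
by apply=> //; exact: poweR_ge0.
Qed.

Lemma markov_gt d (T : measurableType d) R (m : {measure set T -> \bar R})
    (f : T -> \bar R) (a : R) : 0 < a -> measurable_fun setT f ->
  (forall x, (0 <= f x)%E) ->
  (a%:E * m [set x | (a%:E < f x)%E] <= \int[m]_x f x)%E.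
Proof.
move=> a0 mf f0.
have := @le_integral_comp_abse _ _ _ m setT measurableT f a id (@measurable_id _ _ _)
  (fun _ h => h) (fun _ _ _ _ h => h) mf a0.
rewrite setTI; under eq_integral do rewrite gee0_abs//.
apply: le_trans; rewrite lee_wpmul2l ?lee_fin ?(ltW a0)//.
apply: le_measure; rewrite ?inE.
- by rewrite -[X in measurable X]setTI; exact: emeasurable_fun_o_infty.
- rewrite -[X in measurable X]setTI; apply: emeasurable_fun_c_infty => //.
  exact: measurableT_comp.
- by move=> x /= /ltW; rewrite gee0_abs.
Qed.

(** Markov's inequality for the squared L2 distance, whose mean is an
    integral of second moments of one-point marginals by Tonelli's theorem. *)
Lemma gaussian_process_tail_le d (S : measurableType d) R (Q : probability S R)
    (path : S -> R -> R) (m G f B : R -> R) (V : R -> R -> R) (b : R) :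
  gaussian_process Q path m V -> measurable_fun setT G -> measurable_fun setT B ->
  (forall t, 0 < t < 1 -> f t = G t) ->
  (forall t, 0 < t < 1 -> 2 * (V t t + (m t - G t) ^+ 2) <= B t) -> 0 < b ->
  ((b ^+ 2)%:E * Q [set s | (b%:E < L2norm (fun t => (path s t - f t)%R))%E] <=
   \int[lebesgue_measure]_(t in `]0%R, 1%R[) (B t)%:E)%E.
Proof.
move=> [mpath gp] mG mB fG VB b0.
have oo01E (x : R) : (x \in `]0%R, 1%R[%classic) = (0 < x < 1).
  by apply/idP/idP; rewrite inE/= in_itv.
pose F (z : S * measurableTypeR R) := if 0 < z.2 < 1 then ((path z.1 z.2 - G z.2) ^+ 2)%:E else 0%E.
have F0 z : (0 <= F z)%E by rewrite /F; case: ifP => // _; rewrite lee_fin sqr_ge0.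
have mpt (t : R) : 0 < t < 1 -> measurable_fun setT (fun s => path s t).
  move=> /andP[t0 t1]; apply: (measurable_comp (F := [set: S] `*` (`[0, 1] : set R)) (g := fun s => (s, t)) _ _ mpath).
  - by apply: measurableX => //; exact: measurable_itv.
  - by move=> _ [s _ <-]; split => //=; rewrite in_itv/= !ltW.
  - by apply: measurable_fun_pair; [exact: measurable_id|exact: measurable_cst].
have mF : measurable_fun setT F.
  suff : measurable_fun setT (F : S * R -> \bar R) by [].
  have mI : measurable (`]0%R, 1%R[%classic : set R) by exact: measurable_itv.
  have mI1 : measurable (`[0%R, 1%R]%classic : set R) by exact: measurable_itv.
  have -> : F = (fun z => ((path z.1 z.2 - G z.2) ^+ 2)%:E) \_ ([set: S] `*` `]0%R, 1%R[).
    apply/funext => z; rewrite patchE /F; case: ifPn => h.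
      by rewrite mem_set//; split => //=; rewrite in_itv.
    by rewrite memNset// => -[_] /=; rewrite in_itv/= (negbTE h).
  apply/(measurable_restrictT _ (measurableX measurableT mI)).
  apply/measurable_EFinP; apply: measurable_funX; apply: measurable_funB.
    apply: measurable_funS mpath; first exact: measurableX.
    by move=> z [_ h]; split => //; apply: subset_itv_oo_cc h.
  apply: measurable_funTS; apply: (measurableT_comp mG); exact: measurable_snd.
have FE s : (\int[lebesgue_measure]_(x in `[0%R, 1%R]) ((path s x - f x) ^+ 2)%:E =
   \int[lebesgue_measure]_x F (s, x))%E.
  have mFs : measurable_fun setT (fun x => F (s, x)) by exact: measurableT_comp mF (pair1_measurable s).
  have Fsf : {in `]0%R, 1%R[%classic, (fun x => F (s, x)) =1 (fun x => ((path s x - f x) ^+ 2)%:E)}.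
    by move=> x; rewrite inE/= in_itv/= => x01; rewrite /F x01 fG.
  rewrite (integral_itv_bndoo _ _ (eq_measurable_fun _ Fsf (measurable_funTS mFs))).
  rewrite integral_mkcond; apply: eq_integral => x _; rewrite patchE.
  by rewrite oo01E; case: ifPn => x01; [rewrite -Fsf// oo01E|rewrite /F (negbTE x01)].
pose I s := fubini_F lebesgue_measure F s.
have mI : measurable_fun setT I by exact: measurable_fun_fubini_tonelli_F.
have -> : [set s | (b%:E < L2norm (fun t => (path s t - f t)%R))%E] =
    [set s | ((b ^+ 2)%:E < I s)%E].
  by apply/seteqP; split => s /=; rewrite L2norm_gtE ?ltW// FE.
apply: (le_trans (markov_gt _ _ mI _)); first by rewrite exprn_gt0.
  by move=> s; apply: integral_ge0 => x _; exact: F0.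
rewrite /I /fubini_F fubini_tonelli//.
rewrite [leRHS]integral_mkcond; apply: ge0_le_integral => //.
- by move=> t _; apply: integral_ge0.
- exact: measurable_fun_fubini_tonelli_G.
- apply/(measurable_restrictT _ (measurable_itv _)).
  by apply: measurable_funTS; exact/measurable_EFinP.
move=> t _; rewrite patchE oo01E; case: ifPn => t01; last first.
  rewrite (_ : (fun s => F (s, t)) = cst 0%E) ?integral0//.
  by apply/funext => s; rewrite /F/= (negbTE t01).
have tI : t \in `[0, 1] by case/andP: t01 => ? ?; rewrite in_itv/= !ltW.
have := gp 1%N (fun=> t) (fun=> 1) (fun=> tI); rewrite !big_ord1 !mul1r => -[V0 law].
have mpt' := mpt t t01.
rewrite (_ : (fun s => F (s, t)) = (fun s => ((path s t - G t) ^+ 2)%:E)); last first.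
  by apply/funext => s; rewrite /F/= t01.
apply: (@le_trans _ _ (2 * (V t t + (m t - G t) ^+ 2))%:E); last by rewrite lee_fin VB.
apply: normal_law_second_moment => // A mA; rewrite -law//.
by congr (Q _); apply/seteqP; split => s /=; rewrite big_ord1 mul1r.
Qed.

(** * Functions of the analytic class as trigonometric series *)

Lemma tseries_partial_le R (h : R) (a : nat -> R) k : 0 < h -> exp_decay h a ->
  exists B : R, forall N x, `|\sum_(1 <= i < N) a i * dfourier k i x| <= B.
Proof.
move=> h0 ah; have h20 : 0 < h / 2 by rewrite divr_gt0.
have [B B0 hB] := exp_decay_sum_le h20 (exp_decay_dfourier_bound k h0 ah).
exists B => N x; apply: le_trans (hB N); apply: (le_trans (ler_norm_sum _ _ _)).
apply: ler_sum => i _; rewrite !(normrM (a i)) ler_wpM2l//.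
by rewrite (ger0_norm (dfourier_bound_ge0 _ _ _)) dfourier_le.
Qed.

Lemma bounded_measurable_tseries R (h : R) (a : nat -> R) k : 0 < h -> exp_decay h a ->
  bounded_measurable (tseries a k).
Proof.
move=> h0 ah; split.
  apply: continuous_measurable_fun; exact: continuous_tseries h0 ah.
have [B hB] := tseries_partial_le k h0 ah.
by exists B => x; apply: (cvgn_norm_le (@tseries_cvg _ _ _ k x h0 ah)) => N; exact: hB.
Qed.

(** Dominated convergence: the coefficient of a partial sum is constant once
    the sum reaches past [l]. *)
Lemma fourier_coef_tseries R (h : R) (a : nat -> R) l : 0 < h -> exp_decay h a ->
  (1 <= l)%N -> fourier_coef (tseries a 0) l = a l.
Proof.
move=> h0 ah l1; have [B hB] := tseries_partial_le 0 h0 ah.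
have B0 : 0 <= B by exact: le_trans (hB 0%N 0).
pose S N x := (\sum_(1 <= i < N) a i * dfourier 0 i x) * fourier l x.
have bS N : bounded_measurable (S N).
  apply: bounded_measurableM; last exact: bounded_measurable_fourier.
  apply: bounded_measurable_sum => i; apply: bounded_measurableM.
    exact: bounded_measurable_cst.
  exact: bounded_measurable_dfourier.
have bG : bounded_measurable (fun x => tseries a 0 x * fourier l x).
  by apply: bounded_measurableM; [exact: bounded_measurable_tseries h0 ah|exact: bounded_measurable_fourier].
have fb (x : R) : `|fourier l x| <= 2.
  by have := dfourier_le 0 l x; rewrite dfourier0 /dfourier_bound expr0 mulr1.
have m01 : measurable (`[0%R, 1%R]%classic : set (measurableTypeR R)) by exact: measurable_itv.
have SE N : (l < N)%N -> (\int[lebesgue_measure]_(x in `[0%R, 1%R]) (S N x)%:E = (a l)%:E)%E.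
  move=> lN; have -> : a l = \int[lebesgue_measure]_(x in `[0, 1]) S N x; last first.
    rewrite /Rintegral fineK//.
    by apply: integrable_fin_num => //; exact: integrable01_bounded.
  under eq_Rintegral do rewrite /S mulr_suml.
  have ii i : lebesgue_measure.-integrable `[0, 1]
      (EFin \o (fun x => a i * dfourier 0 i x * fourier l x)).
    apply: integrable01_bounded; apply: bounded_measurableM; last exact: bounded_measurable_fourier.
    apply: bounded_measurableM; first exact: bounded_measurable_cst.
    exact: bounded_measurable_dfourier.
  rewrite (Rintegral01_sum _ ii) (bigD1_seq l) ?iota_uniq ?mem_index_iota ?l1//=.
  have e i : (1 <= i)%N -> \int[lebesgue_measure]_(x in `[0, 1]) (a i * dfourier 0 i x * fourier l x) =
      a i * (i == l)%:R.
    move=> i1; under eq_Rintegral do rewrite dfourier0 -mulrA.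
    rewrite RintegralZl ?fourier_orthonormal//.
    by apply: integrable01_bounded; apply: bounded_measurableM; exact: bounded_measurable_fourier.
  rewrite e// eqxx mulr1 big_seq_cond big1 ?addr0// => i.
  by rewrite mem_index_iota => /andP[/andP[i1 _] /negbTE il]; rewrite e// il mulr0.
have mS N : measurable_fun (`[0%R, 1%R]%classic : set (measurableTypeR R)) (fun x => (S N x)%:E).
  by apply/measurable_EFinP; apply: measurable_funTS; exact: (bS N).1.
have mG : measurable_fun (`[0%R, 1%R]%classic : set (measurableTypeR R))
    (fun x => (tseries a 0 x * fourier l x)%:E).
  by apply/measurable_EFinP; apply: measurable_funTS; exact: bG.1.
have SG : {ae lebesgue_measure, forall x, (`[0%R, 1%R]%classic : set (measurableTypeR R)) x ->
    (fun N => (S N x)%:E) @ \oo --> (tseries a 0 x * fourier l x)%:E}.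
  apply: aeW => x _; apply: cvg_EFin; first by near=> N.
  by apply: cvgMr_tmp; exact: tseries_cvg h0 ah.
have iB : lebesgue_measure.-integrable (`[0%R, 1%R]%classic : set (measurableTypeR R)) (fun=> (B * 2)%:E).
  by apply: (integrable01_bounded (q := fun=> B * 2)); exact: bounded_measurable_cst.
have SB : {ae lebesgue_measure, forall x N, (`[0%R, 1%R]%classic : set (measurableTypeR R)) x ->
    (`|(S N x)%:E| <= (B * 2)%:E)%E}.
  by apply: aeW => x N _; rewrite lee_fin normrM ler_pM.
have [_ _ cv] := dominated_convergence m01 mS mG SG iB SB.
rewrite /fourier_coef /Rintegral.
suff -> : (\int[lebesgue_measure]_(x in `[0%R, 1%R]) (tseries a 0 x * fourier l x)%:E = (a l)%:E)%E by [].
apply: (cvg_unique _ cv); first exact: ereal_hausdorff.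
by apply: cvg_near_cst; near=> N; apply: SE; near: N; exact: nbhs_infty_gt.
Unshelve. all: by end_near. Qed.

Lemma L2norm_lty_integrable R (f : R -> R) :
  measurable_fun (`[0, 1] : set R) f -> (L2norm f < +oo)%E ->
  lebesgue_measure.-integrable `[0, 1] (EFin \o f).
Proof.
move=> mf; rewrite L2normE => fi'; have fi := lty_poweRy _ fi'.
have {}fi : (\int[lebesgue_measure]_(x in `[0%R, 1%R]) (f x ^+ 2)%:E < +oo)%E.
  by apply: fi; rewrite invr_eq0.
have mf' : measurable_fun (`[0%R, 1%R]%classic : set (measurableTypeR R)) f by exact: mf.
have m01 : measurable (`[0%R, 1%R]%classic : set (measurableTypeR R)) by exact: measurable_itv.
have mf2 : measurable_fun (`[0%R, 1%R]%classic : set (measurableTypeR R)) (fun x => (f x ^+ 2)%:E).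
  by apply/measurable_EFinP; exact: measurable_funX.
have i2 : lebesgue_measure.-integrable (`[0%R, 1%R]%classic : set (measurableTypeR R))
    (fun x => (f x ^+ 2)%:E).
  apply/integrableP; split=> //; under eq_integral do rewrite gee0_abs ?lee_fin ?sqr_ge0//.
  exact: fi.
have i1 : lebesgue_measure.-integrable (`[0%R, 1%R]%classic : set (measurableTypeR R)) (fun=> 1%:E).
  by apply: (integrable01_bounded (q := fun=> 1)); exact: bounded_measurable_cst.
apply: (@le_integrable _ _ _ lebesgue_measure _ m01 _ (fun x => (1%:E + (f x ^+ 2)%:E)%E)).
- exact/measurable_EFinP.
- move=> x _ /=; rewrite lee_fin [leRHS]ger0_norm ?addr_ge0 ?sqr_ge0//.
  by rewrite -[f x ^+ 2]real_normK ?num_real//; have := normr_ge0 (f x); nra.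
- exact: integrableD.
Qed.

Lemma analytic_class_sum_le R (gamma : R) (f : R -> R) : analytic_class gamma f ->
  exists2 A : R, 0 < A & forall N,
    \sum_(1 <= i < N) expR (2 * gamma * i%:R) * fourier_coef f i ^+ 2 <= A.
Proof.
move=> [_ _]; set s := (X in (X < _)%E) => sf.
have s0 : (0 <= s)%E.
  by apply: nneseries_ge0 => i _ _; rewrite lee_fin mulr_ge0 ?expR_ge0// sqr_ge0.
exists (1 + fine s); first by rewrite ltr_pwDl// fine_ge0.
move=> N; rewrite (@le_trans _ _ (fine s))//; last by rewrite lerDr.
rewrite -lee_fin fineK ?ge0_fin_numE// -sumEFin.
by apply: nneseries_lim_ge => i _ _; rewrite lee_fin mulr_ge0 ?expR_ge0// sqr_ge0.
Qed.

Lemma analytic_class_decay R (gamma : R) (f : R -> R) : analytic_class gamma f ->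
  exp_decay gamma (fourier_coef f).
Proof.
move=> /analytic_class_sum_le [A A0 hA]; exists (1 + A) => i i1.
have := hA i.+1; rewrite big_nat_recr//=.
have e0 : 0 < expR (gamma * i%:R) by exact: expR_gt0.
have -> : 2 * gamma * i%:R = gamma * i%:R + gamma * i%:R by ring.
rewrite expRD expRN; set e := expR _ in e0 *; set b := fourier_coef f i.
set s := \sum_(_ <= _ < _) _ => h; have s0 : 0 <= s.
  by apply: sumr_ge0 => j _; rewrite mulr_ge0 ?expR_ge0// sqr_ge0.
rewrite -ler_pdivrMr ?invr_gt0// invrK.
have h2 : (`|b| * e) ^+ 2 <= A.
  by rewrite exprMn real_normK ?num_real// expr2; lra.
by have := mulr_ge0 (normr_ge0 b) (ltW e0); nra.
Qed.

(** The difference between a function and the sum of its Fourier series has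
    no Fourier coefficients. *)
Lemma analytic_class_ae R (gamma : R) (f : R -> R) : 0 < gamma -> analytic_class gamma f ->
  {ae lebesgue_measure, forall x, x \in `[0, 1] -> f x = tseries (fourier_coef f) 0 x}.
Proof.
move=> g0 fg; have ag := analytic_class_decay fg.
have [mf lf _] := fg; have fi := L2norm_lty_integrable mf lf.
set G := tseries _ _; have bG : bounded_measurable G by exact: bounded_measurable_tseries g0 ag.
have Gi := integrable01_bounded bG.
have hi : lebesgue_measure.-integrable `[0, 1] (EFin \o (fun x => f x - G x)).
  have m01 : measurable (`[0%R, 1%R]%classic : set (measurableTypeR R)) by exact: measurable_itv.
  exact: (integrableB m01 fi Gi).
apply: filterS (fourier_complete hi _).
- exact: (ae_filter_ringOfSetsType lebesgue_measure).
- by move=> x h x01; apply/eqP; rewrite -subr_eq0 h.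
move=> i i1; under eq_Rintegral do rewrite mulrBl.
rewrite RintegralB//; last 2 first.
- by apply: integrable01_mul_bounded => //; exact: bounded_measurable_fourier.
- by apply: integrable01_mul_bounded => //; exact: bounded_measurable_fourier.
by rewrite -/(fourier_coef f i) -/(fourier_coef G i) (fourier_coef_tseries g0 ag)// subrr.
Qed.

(** Intervals have positive length, so [u - v] cannot stay away from 0
    around [t]. *)
Lemma ae_eq_continuous R (u v : R -> R) (t : R) :
  {ae lebesgue_measure, forall x, x \in `[0, 1] -> u x = v x} ->
  0 < t < 1 -> {for t, continuous u} -> {for t, continuous v} -> u t = v t.
Proof.
move=> [N [mN N0 subN]] /andP[t0 t1] cu cv; apply/eqP/negP => /negP uv.
have cuv : (u x - v x) @[x --> t] --> u t - v t by exact: cvgB.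
have /nbhs_ballP[e /= e0 he] : \forall x \near t, (x \in `]0, 1[) /\ (u x - v x != 0).
  near=> x; split; near: x.
    by apply: near_in_itvoo; rewrite in_itv/= t0 t1.
  by apply: cvgr_neq0 cuv _; rewrite subr_eq0.
have : (lebesgue_measure (ball t e) <= lebesgue_measure N)%E.
  apply: le_measure; rewrite ?inE//; first exact: measurable_ball.
  move=> x /he[x01 uvx]; apply: subN => /= h.
  by move: uvx; rewrite h ?subrr ?eqxx//; exact: subset_itv_oo_cc x01.
by rewrite [lebesgue_measure N]N0 (lebesgue_measure_ball _ (ltW e0)) lee_fin leNgt pmulrn_lgt0// e0.
Unshelve. all: by end_near. Qed.

(** The sum of the Fourier series is a continuous version of [f], and the
    one selected by [continuous_version] agrees with it on ]0, 1[, hence so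
    do the derivatives. *)
Lemma derivative_of_analytic R (gamma : R) (f : R -> R) k (t : R) : 0 < gamma ->
  analytic_class gamma f -> 0 < t < 1 ->
  derivative_of k f t = tseries (fourier_coef f) k t.
Proof.
move=> g0 fg; have ag := analytic_class_decay fg.
have fG := analytic_class_ae g0 fg; set a := fourier_coef f in ag fG *.
rewrite /derivative_of -(derive1n_tseries k g0 ag).
have [] : [set g : R -> R | {within `[0%R, 1%R], continuous g} /\
    {ae lebesgue_measure, forall x : R, x \in `[0, 1] -> f x = g x}] (continuous_version f).
  apply: xgetPex; exists (tseries a 0); split => //.
  by apply: continuous_subspaceT; exact: continuous_tseries g0 ag.
move: (continuous_version f) => c cc fc.
have cG (x : R) : 0 < x < 1 -> c x = tseries a 0 x.
  move=> x01; apply: ae_eq_continuous => //.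
  - apply: filterS2 fc fG; first exact: (ae_filter_ringOfSetsType lebesgue_measure).
    by move=> y h1 h2 y01; rewrite -h1// h2.
  - by apply: (within_continuous_continuous ltr01 cc); rewrite in_itv.
  - exact: continuous_tseries g0 ag _.
elim: k t => [|k ih] t t01 /=; first exact: cG.
rewrite !derive1E; apply: near_eq_derive.
near=> y; apply: ih; suff: y \in `]0, 1[ by rewrite in_itv.
by near: y; apply: near_in_itvoo; rewrite in_itv.
Unshelve. all: by end_near. Qed.

(** The design points are uniform, so they avoid the null subset of [0, 1]
    where [f] and [G] differ. *)
Lemma design_ae d (T : measurableType d) R (P : probability T R) (sigma : R)
    (X eps : nat -> {RV P >-> R}) (f G : R -> R) :
  regression_model sigma X eps ->
  {ae lebesgue_measure, forall x, x \in `[0, 1] -> f x = G x} ->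
  {ae P, forall w, forall i, f (X i w) = G (X i w)}.
Proof.
move=> model [N [mN N0 subN]]; apply: ae_foralln => i.
pose A : set R := N `|` ~` `[0, 1].
have mA : measurable (A : set R).
  by apply: measurableU => //; apply: measurableC; exact: measurable_itv.
have mXA : measurable (X i @^-1` A).
  by rewrite -[X in measurable X]setTI; exact: measurable_funPT.
exists (X i @^-1` A); split => //.
- have mi : measurable_fun [set: R] (\1_A : R -> R) by exact: measurable_indic.
  have := design_integral model i mi.
  rewrite (_ : (fun w => (\1_A (X i w))%:E) = (fun w => (\1_(X i @^-1` A) w)%:E)); last first.
    by apply/funext => w; rewrite !indicE.
  have mA' : measurable (A : set (measurableTypeR R)) by exact: mA.
  have m01 : measurable (`[0%R, 1%R]%classic : set (measurableTypeR R)) by exact: measurable_itv.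
  rewrite integral_indic// setIT => ->.
  have -> : (\int[lebesgue_measure]_(x in `[0%R, 1%R]) (\1_A x)%:E =
      lebesgue_measure (A `&` `[0%R, 1%R]))%E by exact: integral_indic.
  apply/eqP; rewrite eq_le measure_ge0 andbT -[leRHS]N0; apply: le_measure; rewrite ?inE//.
    exact: measurableI.
  by move=> x [[//|h] h'].
- move=> w /= fG; have [x01|] := boolP (X i w \in `[0, 1]); last by move=> /negP h; right.
  by left; apply: subN => /= h; apply: fG; rewrite h.
Qed.

(** * Eigenvalue bounds *)

Lemma bigTheta_bounds R (u v : nat -> R) : u =Theta_\oo v ->
  exists c : R, exists C : R, [/\ 0 < c, 0 < C &
    \forall n \near \oo, c * `|v n| <= `|u n| /\ `|u n| <= C * `|v n|].
Proof.
rewrite eqThetaE qualifE => /asboolP[[c C] /= /andP[c0 C0] h].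
by exists c, C; split.
Qed.

(** The finitely many indices that escape the asymptotic bounds are covered
    by the monotonicity of the eigenvalues. *)
Lemma eigenvalue_bounds R (g : R) (mu : nat -> R) : 0 < g ->
  (forall i, (1 <= i)%N -> 0 < mu i) -> (forall i, (1 <= i)%N -> mu i.+1 <= mu i) ->
  mu =Theta_\oo (fun i => expR (- (g * i%:R))) ->
  exp_decay g mu /\
  exists2 c : R, 0 < c & forall i, (1 <= i)%N -> c * expR (- (g * i%:R)) <= mu i.
Proof.
move=> g0 mu0 muS /bigTheta_bounds[c [C [c0 C0 [N0 _ hN0]]]].
have mono i j : (1 <= i)%N -> (i <= j)%N -> mu j <= mu i.
  move=> i1 /subnK <-; elim: (j - i)%N => // m ih.
  by rewrite addSn (le_trans _ ih)// muS// (leq_trans i1)// leq_addl.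
pose N := N0.+1; pose e (i : nat) := expR (- (g * i%:R)).
have e0 i : 0 < e i by exact: expR_gt0.
have emono i j : (i <= j)%N -> e j <= e i.
  by move=> ij; rewrite ler_expR lerN2 ler_wpM2l ?(ltW g0)// ler_nat.
have e1 i : e i <= 1 by rewrite -expR0 ler_expR oppr_le0 mulr_ge0// ltW.
have [muN mu1] : 0 < mu N /\ 0 < mu 1%N by split; exact: mu0.
have hN i : (N <= i)%N -> c * e i <= mu i <= C * e i.
  move=> Ni; have i1 : (1 <= i)%N by exact: leq_trans Ni.
  have [] := hN0 i (ltnW Ni); rewrite (gtr0_norm (mu0 i i1)) (gtr0_norm (e0 i)).
  by move=> -> ->.
split.
  exists (C + mu 1%N / e N) => i i1; rewrite gtr0_norm ?mu0// -/(e i) mulrDl.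
  have h0 : 0 <= mu 1%N / e N * e i by rewrite mulr_ge0 ?divr_ge0// ltW.
  have h1 : 0 <= C * e i by rewrite mulr_ge0// ltW.
  have [Ni|iN] := leqP N i; first by have /andP[_] := hN i Ni; lra.
  have : mu 1%N * 1 <= mu 1%N / e N * e i.
    rewrite -mulrA ler_wpM2l ?(ltW mu1)// mulrC ler_pdivlMr ?mul1r//.
    exact: emono (ltnW iN).
  by have := mono 1%N i isT i1; lra.
exists (Num.min c (mu N)); first by rewrite lt_min c0 muN.
move=> i i1; rewrite -/(e i); have [Ni|iN] := leqP N i.
  have /andP[h _] := hN i Ni; apply: le_trans h.
  by rewrite ler_wpM2r ?(ltW (e0 i))// ge_min lexx.
apply: (@le_trans _ _ (mu N * 1)); last by rewrite mulr1 mono// ltnW.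
by rewrite ler_pM ?(ltW (e0 _))// ?ge_min ?lexx ?orbT// le_min !ltW.
Qed.

(** The analytic class is contained in the RKHS of the kernel, because the
    eigenvalues are at least of order [exp (- 2 gamma i)]. *)
Lemma analytic_class_rkhs R (gamma c : R) (f : R -> R) (mu : nat -> R) :
  analytic_class gamma f -> 0 < c ->
  (forall i, (1 <= i)%N -> c * expR (- (2 * gamma * i%:R)) <= mu i) ->
  exists2 H : R, 0 < H & forall N, \sum_(1 <= l < N) fourier_coef f l ^+ 2 / mu l <= H.
Proof.
move=> /analytic_class_sum_le [A A0 hA] c0 hc.
exists (A / c); first by rewrite divr_gt0.
move=> N; apply: (@le_trans _ _ ((\sum_(1 <= i < N) expR (2 * gamma * i%:R) * fourier_coef f i ^+ 2) / c)).
  rewrite mulr_suml !big_nat; apply: ler_sum => i /andP[i1 _].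
  have m0 : 0 < mu i by apply: lt_le_trans (hc i i1); rewrite mulr_gt0// expR_gt0.
  rewrite [expR _ * _]mulrC -[leRHS]mulrA; apply: ler_wpM2l; first exact: sqr_ge0.
  have := hc i i1; rewrite expRN ler_pdivrMr ?expR_gt0// => h.
  by rewrite ler_pdivlMr// mulrC ler_pdivrMr// mulrC.
by rewrite ler_wpM2r// invr_ge0 ltW.
Qed.

(** * Contraction at a fixed sample size *)

Section contraction_bound.
Context d (T : measurableType d) (R : realType) (P : probability T R).
Variables (sigma : R) (X eps : nat -> {RV P >-> R}).
Variables (g : R) (mu : nat -> R) (k : nat).
Hypothesis g1 : 1 < g.
Hypothesis mug : exp_decay g mu.
Hypothesis mu0 : forall i, (1 <= i)%N -> 0 < mu i.
Variables (h H : R) (a : nat -> R).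
Hypothesis h0 : 0 < h.
Hypothesis ah : exp_decay h a.
Hypothesis H0 : 0 < H.
Hypothesis aH : forall N, \sum_(1 <= l < N) a l ^+ 2 / mu l <= H.

(** Outside a null event and the event that the integrated majorant exceeds
    [delta * b ^+ 2], the posterior tail is at most [delta]. Both events are
    measurable, so covering by them bounds the outer measure; Markov's
    inequality bounds the second one. *)
Lemma contraction_probability_le d' (S : measurableType d') (path : S -> R -> R)
    (n m : nat) (Pi : 'cV[R]_n -> 'cV[R]_n -> probability S R) (f fk : R -> R)
    (lam b delta D : R) : 0 < lam -> 0 < b -> 0 < delta ->
  (forall x y, gaussian_process (Pi x y) path
     (posterior_mean (kernel_of mu) k lam x y)
     (posterior_cov (kernel_of mu) sigma k lam x)) ->
  {ae P, forall w, forall i, f (X i w) = tseries a 0 (X i w)} ->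
  (forall t, 0 < t < 1 -> fk t = tseries a k t) ->
  (forall t, \int[P]_w (risk_majorant sigma X eps mu k H m n lam t w)%:E <= D%:E)%E ->
  (P^*%mu [set w | delta%:E <
      Pi (\col_i X i w) (\col_i (f (X i w) + eps i w)%R)
        [set s | b%:E < L2norm (fun t => (path s t - fk t)%R)]] <=
   (D / (delta * b ^+ 2))%:E)%E.
Proof.
move=> l0 b0 d0 gp [N [mN PN0 subN]] fkE hD.
pose B (z : T * measurableTypeR R) := (risk_majorant sigma X eps mu k H m n lam z.2 z.1)%:E.
have mB : measurable_fun setT B.
  apply/measurable_EFinP.
  have := (measurable_risk_majorant sigma X eps k g1 mug mu0 H m n l0).
  by [].
have B0 z : (0 <= B z)%E.
  by rewrite lee_fin; exact: (risk_majorant_ge0 sigma X eps k g1 mug mu0 H0 m n _ _ l0).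
pose BI := B \_ ([set: T] `*` (`]0%R, 1%R[%classic : set (measurableTypeR R))).
have mI : measurable (`]0%R, 1%R[%classic : set (measurableTypeR R)) by exact: measurable_itv.
have mBI : measurable_fun setT BI.
  apply/(measurable_restrictT _ (measurableX measurableT mI)).
  exact: measurable_funTS.
have BI0 z : (0 <= BI z)%E by rewrite /BI patchE; case: ifP.
pose U w := fubini_F lebesgue_measure BI w.
have mU : measurable_fun setT U by exact: measurable_fun_fubini_tonelli_F.
have U0 w : (0 <= U w)%E by apply: integral_ge0 => t _.
have BIE w t : BI (w, t) = ((fun t => B (w, t)) \_ `]0%R, 1%R[) t.
  rewrite /BI !patchE; congr (if _ then _ else _).
  by apply/idP/idP; rewrite !inE/=; [case|split].
have UE w : U w = (\int[lebesgue_measure]_(t in `]0%R, 1%R[) B (w, t))%E.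
  by rewrite /U /fubini_F [RHS]integral_mkcond; apply: eq_integral => t _; exact: BIE.
have D0 : 0 <= D.
  by rewrite -lee_fin (le_trans _ (hD 0))//; apply: integral_ge0 => w _; exact: (B0 (w, 0)).
have EU : (\int[P]_w U w <= D%:E)%E.
  rewrite /U /fubini_F fubini_tonelli//.
  apply: (@le_trans _ _ (\int[lebesgue_measure]_(t in (`]0%R, 1%R[%classic : set (measurableTypeR R))) D%:E)%E).
    rewrite [leRHS]integral_mkcond; apply: ge0_le_integral => //.
    - by move=> t _; apply: integral_ge0.
    - exact: measurable_fun_fubini_tonelli_G.
    - by apply/(measurable_restrictT _ mI); exact: measurable_cst.
    - move=> t _; rewrite patchE; case: ifPn => t01; last first.
        rewrite (_ : (fun w => BI (w, t)) = cst 0%E) ?integral0//.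
        by apply/funext => w; rewrite BIE patchE (negbTE t01).
      rewrite (_ : (fun w => BI (w, t)) = (fun w => B (w, t))); first exact: hD.
      by apply/funext => w; rewrite BIE patchE t01.
  rewrite integral_cst// -[leRHS]mule1 lee_wpmul2l ?lee_fin//.
  by rewrite /= lebesgue_measure_itv/= lte_fin ltr01 -EFinB subr0.
have db0 : 0 < delta * b ^+ 2 by rewrite mulr_gt0// exprn_gt0.
(* [N] contains the samples whose responses differ from those of the series. *)
pose Bad := N `|` [set w | ((delta * b ^+ 2)%:E < U w)%E].
have mV : measurable [set w | ((delta * b ^+ 2)%:E < U w)%E].
  by rewrite -[X in measurable X]setTI; exact: emeasurable_fun_o_infty.
have mBad : measurable Bad by exact: measurableU.
apply: (@le_trans _ _ (P^*%mu Bad)).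
  apply: le_outer_measure => w /= hw; have [Nw|Nw] := pselect (N w); [by left|right => /=].
  have fG i : f (X i w) = tseries a 0 (X i w).
    have : (forall i, f (X i w) = tseries a 0 (X i w)); last by [].
    by apply: contrapT => hn; apply: Nw; exact: subN.
  set x := \col_i X i w in hw; set y := \col_i _ in hw.
  have := @gaussian_process_tail_le _ _ _ (Pi x y) path _ (tseries a k) fk
    (fun t => risk_majorant sigma X eps mu k H m n lam t w) _ b (gp x y).
  move=> tail; rewrite UE; apply: lt_le_trans (tail _ _ fkE _ b0).
  - rewrite mulrC EFinM lte_pmul2l ?lte_fin ?exprn_gt0//.
  - exact: (bounded_measurable_tseries k h0 ah).1.
  - by apply/measurable_EFinP; exact: measurableT_comp mB (pair1_measurable w).
  - move=> t _; apply: (posterior_risk_le sigma k g1 mug mu0 h0 ah H0 aH m t l0).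
    by move=> i; rewrite mxE fG.
rewrite measurable_mu_extE//.
apply: (@le_trans _ _ (P N + P [set w | ((delta * b ^+ 2)%:E < U w)%E])%E).
  exact: measureU2.
rewrite [P N]PN0 add0e [leRHS]EFinM lee_pdivlMr//.
rewrite muleC; apply: le_trans EU.
exact: markov_gt.
Qed.
End contraction_bound.

(** * The contraction rate *)

(** For [m = floor (ln n) + 1] the term [exp (- m)] is at most [1 / n],
    while [m] stays below [2 ln n]. *)
Lemma log_rate_bound R k (c C : R) : 0 < c -> 0 < C ->
  exists2 K : R, 0 <= K & forall n (r : R), (0 < n)%N -> 1 <= ln n%:R :> R ->
    c * ln n%:R <= r -> r <= C * ln n%:R ->
    exists2 m, (1 <= m)%N &
      (r^-1 + 1) * (expR (- m%:R) + (1 + r) * m%:R ^+ (k.*2).+1 / n%:R) <=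
      K * (ln n%:R ^+ k.+1 / Num.sqrt n%:R) ^+ 2.
Proof.
move=> c0 C0; set p := (k.*2).+1; pose K1 : R := 1 + (1 + C) * 2 ^+ p.
have K10 : 0 <= K1 by rewrite addr_ge0// mulr_ge0 ?exprn_ge0// addr_ge0// ltW.
have cV : 0 < c^-1 by rewrite invr_gt0.
exists ((c^-1 + 1) * K1); first by rewrite mulr_ge0//; lra.
move=> n r n0; set L := ln _ => L1 cr rC; have L0 : 0 < L by lra.
have nR : 0 < n%:R :> R by rewrite ltr0n.
have r0 : 0 < r by apply: lt_le_trans cr; rewrite mulr_gt0.
exists (Num.truncn L).+1 => //; set m := (Num.truncn L).+1.
have /andP[m1 m2] := truncn_itv (ltW L0).
have mL : m%:R <= 2 * L :> R by rewrite /m -[leLHS]natr1; lra.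
have em : expR (- m%:R) <= n%:R^-1 :> R.
  by rewrite -[n%:R]lnK ?posrE// -/L -expRN ler_expR lerN2 ltW.
have nV : 0 < n%:R^-1 :> R by rewrite invr_gt0.
have mp : m%:R ^+ p <= 2 ^+ p * L ^+ p :> R by rewrite -exprMn; apply: lerXn2r => //; rewrite nnegrE ?ler0n//; lra.
have Lp : 1 <= L ^+ p.+1 by rewrite exprn_ege1.
have h1 : (1 + r) * m%:R ^+ p <= (1 + C) * 2 ^+ p * L ^+ p.+1.
  apply: (@le_trans _ _ (((1 + C) * L) * (2 ^+ p * L ^+ p))).
    rewrite ler_pM// ?exprn_ge0//; first by lra.
    rewrite mulrDl mul1r; lra.
  by rewrite [L ^+ p.+1]exprS; move: (2 ^+ p) (L ^+ p) => u v; rewrite -!mulrA [L * (u * v)]mulrCA.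
have h2 : expR (- m%:R) + (1 + r) * m%:R ^+ p / n%:R <= K1 * (L ^+ p.+1 / n%:R).
  rewrite [K1 * _]mulrA; apply: (@le_trans _ _ ((1 + (1 + r) * m%:R ^+ p) / n%:R)).
    by rewrite [leRHS]mulrDl mul1r lerD2r.
  apply: ler_wpM2r; first exact: ltW.
  by rewrite /K1 [leRHS]mulrDl mul1r lerD.
have -> : (L ^+ k.+1 / Num.sqrt n%:R) ^+ 2 = L ^+ p.+1 / n%:R.
  by rewrite exprMn exprVn sqr_sqrtr ?(ltW nR)// -exprM /p -doubleS muln2.
rewrite -[leRHS]mulrA; apply: ler_pM => //.
- by rewrite addr_ge0// invr_ge0 ltW.
- rewrite addr_ge0 ?expR_ge0// divr_ge0 ?(ltW nR)//.
  by apply: mulr_ge0; [lra|rewrite exprn_ge0].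
- rewrite lerD2r lef_pV2 ?posrE//; apply: le_trans cr; rewrite ler_peMr//; lra.
Qed.

Lemma ln_ge1_near R : \forall n \near \oo, (0 < n)%N /\ 1 <= ln n%:R :> R.
Proof.
(* The logarithm is at least 1 from [exp 1] on. *)
exists (Num.truncn (expR 1 : R)).+1 => // n /= hn; split; first exact: leq_ltn_trans hn.
have e0 := expR_gt0 (1 : R); have /andP[_ h] := truncn_itv (ltW e0).
have en : expR 1 <= n%:R :> R by rewrite (le_trans (ltW h))// ler_nat.
by rewrite -[leLHS]expRK ler_ln ?posrE// (lt_le_trans e0).
Qed.

Theorem theorem3 (R : realType)
  (* data *)
  (dT : measure_display) (T : measurableType dT) (P : probability T R)
  (sigma : R) (f0 : R -> R) (X eps : nat -> {RV P >-> R})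
  (* kernel and regularization *)
  (gamma : R) (mu lambda : nat -> R) (k : nat)
  (* posterior of the k-th derivative given data (x, y) of size n, as a law on a
     space S of random functions *)
  (dS : measure_display) (S : measurableType dS) (path : S -> R -> R)
  (Pi : forall n : nat, 'cV[R]_n -> 'cV[R]_n -> probability S R) :
  0 < sigma ->
  regression_model sigma X eps ->
  2^-1 < gamma ->
  analytic_class gamma f0 ->
  (forall i, (1 <= i)%N -> 0 < mu i) ->
  (forall i, (1 <= i)%N -> mu i.+1 <= mu i) ->
  mu =Theta_\oo (fun i => expR (- (2 * gamma * i%:R))) ->
  (forall n, 0 < lambda n) ->
  lambda =Theta_\oo (fun n => ln n%:R / n%:R) ->
  (forall n (x y : 'cV[R]_n),
     gaussian_process (Pi n x y) path
       (posterior_mean (kernel_of mu) k (lambda n) x y)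
       (posterior_cov (kernel_of mu) sigma k (lambda n) x)) ->
  let epsilon (n : nat) : R := ln n%:R ^+ k.+1 / Num.sqrt n%:R in
  forall M : nat -> R, M n @[n --> \oo] --> +oo ->
    cvg0_in_probability P (fun n w =>
      Pi n (\col_i X i w) (\col_i (f0 (X i w) + eps i w))
        [set s | ((M n * epsilon n)%:E <
                  L2norm (fun t => (path s t - derivative_of k f0 t)%R))%E]).
Proof.
move=> s0 model g12 fA mu0 muS muT lam0 lamT gp epsilon M Minf delta d0.
have gam0 : 0 < gamma by lra.
have g1 : 1 < 2 * gamma by lra.
have g0 : 0 < 2 * gamma by lra.
have [mug [c c0 hc]] := eigenvalue_bounds g0 mu0 muS muT.
have ag := analytic_class_decay fA.
have [H H0 aH] := analytic_class_rkhs fA c0 hc.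
have fG := design_ae model (analytic_class_ae gam0 fA).
have fk t : 0 < t < 1 -> derivative_of k f0 t = tseries (fourier_coef f0) k t.
  by move=> t01; exact: derivative_of_analytic gam0 fA t01.
have [C C0 hC] := expected_risk_le s0 model k g1 mug mu0 H0.
have [cl [Cl [cl0 Cl0 lamB]]] := bigTheta_bounds lamT.
have [K K0 hK] := log_rate_bound k cl0 Cl0.
pose Z n := P^*%mu [set w | (delta%:E <
  Pi n (\col_i X i w) (\col_i (f0 (X i w) + eps i w)%R)
    [set s | (M n * epsilon n)%:E < L2norm (fun t => (path s t - derivative_of k f0 t)%R)])%E].
have Zle : \forall n \near \oo, (0 <= Z n <= (C * K / delta * (M n)^-1)%:E)%E.
  near=> n; rewrite outer_measure_ge0/=.
  have [n0 L1] : (0 < n)%N /\ 1 <= ln n%:R :> R by near: n; exact: ln_ge1_near.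
  have M1 : 1 <= M n by near: n; exact: cvgry_ge.
  have [l1 l2] : cl * `|ln n%:R / n%:R| <= `|lambda n| /\
      `|lambda n| <= Cl * `|ln n%:R / n%:R| by near: n; exact: lamB.
  have nR : 0 < n%:R :> R by rewrite ltr0n.
  have L0 : 0 < ln n%:R :> R by lra.
  have ep0 : 0 < epsilon n by rewrite divr_gt0 ?exprn_gt0// sqrtr_gt0.
  have Ln0 : 0 < ln n%:R / n%:R :> R by rewrite divr_gt0.
  have r1 : cl * ln n%:R <= n%:R * lambda n.
    by move: l1; rewrite !gtr0_norm// mulrA ler_pdivrMr// [leRHS]mulrC.
  have r2 : n%:R * lambda n <= Cl * ln n%:R.
    by move: l2; rewrite !gtr0_norm// mulrA ler_pdivlMr// [leLHS]mulrC.
  have [m m1 hm] := hK n (n%:R * lambda n) n0 L1 r1 r2.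
  have hD t : (\int[P]_w (risk_majorant sigma X eps mu k H m n (lambda n) t w)%:E <=
      (C * (K * epsilon n ^+ 2))%:E)%E.
    by apply: (le_trans (hC m n (lambda n) t n0 m1 (lam0 n))); rewrite lee_fin -mulrA ler_wpM2l.
  have Me0 : 0 < M n * epsilon n by rewrite mulr_gt0//; lra.
  have hZ := contraction_probability_le g1 mug mu0 gam0 ag H0 aH
    (lam0 n) Me0 d0 (gp n) fG fk hD.
  rewrite /Z; apply: (le_trans hZ); rewrite lee_fin.
  have -> : C * (K * epsilon n ^+ 2) / (delta * (M n * epsilon n) ^+ 2) =
      C * K / delta * ((M n)^-1 * (M n)^-1).
    by field; rewrite !gt_eqF//; lra.
  apply: ler_wpM2l; first by rewrite divr_ge0 ?mulr_ge0// ltW.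
  rewrite ler_piMr ?invr_ge0 ?invf_le1//; lra.
apply: (squeeze_cvge Zle); first exact: cvg_cst.
apply: cvg_EFin; first by near=> n.
rewrite -[X in _ --> X](mulr0 (C * K / delta)); apply: cvgMl_tmp.
apply/gtr0_cvgV0 => //; near=> n.
have M1 : 1 <= M n by near: n; exact: cvgry_ge.
exact: lt_le_trans M1.
Unshelve. all: by end_near. Qed.
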